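(* Let $n,m$ be integers with $2\le m\le\lfloor n/2\rfloor$ and let $G\in\mathbb{U}(n,m)$. (Equality of graphs below means isomorphism.) \begin{itemize} \item If $n\le 2m+2$, then $W(G)\le 2-\frac83 m^3+2m^2+\frac53 m+2m^2n-3mn-2n+n^2$, with equality if and only if: $G\in\{G^4_{0,0,0},\,G^3_{0,1}\}$ when $(n,m)=(4,2)$; $G\in\{G^4_{1,1,0},\,G^3_{2,1}\}$ when $(n,m)=(6,2)$; and $G=G^3_{n-2m,\,2m-3}$ in all other cases. \item If $n\ge 2m+3$ and $n$ is odd, then $W(G)\le \frac92-n-\frac23 m^3+\frac12 n^2-2nm+2m^2+\frac12 mn^2-\frac{11}{6}m$, with equality if and only if $G=G^4_{n/2-m+1/2,\;n/2-m-1/2,\;2m-4}$. \item If $n\ge 2m+4$ and $n$ is even, then $W(G)\le 6-n-\frac23 m^3+\frac12 n^2-2nm+2m^2+\frac12 mn^2-\frac73 m$, with equality if and only if $G=G^4_{n/2-m,\;n/2-m,\;2m-4}$. \end{itemize}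
   Context: All graphs are finite, simple and connected. A unicyclic graph is a connected graph containing exactly one cycle. The matching number of a graph is the maximum size of a set of pairwise disjoint edges. $\mathbb{U}(n,m)$ denotes the set of unicyclic graphs with $n$ vertices and matching number $m$. The Wiener index of $G$ is $W(G)=\sum_{\{u,v\}\subset V(G)}d(u,v)$, the sum over unordered pairs of distinct vertices of the graph distance $d(u,v)$. For integers $a,j\ge 0$, $G^3_{a,j}$ is the graph consisting of a triangle $A_0B_0C_0$, a path $A_0A_1\cdots A_j$ with $j$ edges that meets the triangle only in $A_0$, and $a$ additional vertices of degree $1$, each adjacent to $A_j$; it has $a+j+3$ vertices. For integers $a,c,j\ge 0$, $G^4_{a,c,j}$ is the graph consisting of a $4$-cycle $A_0B_0C_0D_0$ (in this cyclic order), a path $A_0A_1\cdots A_j$ with $j$ edges that meets the $4$-cycle only in $A_0$, $a$ additional vertices of degree $1$, each adjacent to $A_j$, and $c$ additional vertices of degree $1$, each adjacent to $C_0$; it has $a+c+j+4$ vertices. *)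

(* Defs.v *)
From HB Require Import structures.
From mathcomp Require Import all_boot all_order all_algebra.

Set Implicit Arguments.
Unset Strict Implicit.
Unset Printing Implicit Defensive.

Record sgraph := SGraph {
  vertex :> finType;
  adj : rel vertex;
  adj_sym : symmetric adj;
  adj_irr : irreflexive adj
}.

Section GraphNotions.

Variable G : sgraph.

Definition connected : Prop :=
  (0 < #|G|) /\ forall x y : G, connect (@adj G) x y.

Definition edges : {set {set G}} :=
  [set [set p.1; p.2] | p : G * G & adj p.1 p.2].

(* [next p x] is the successor of [x] on the closed walk [p], so this is the
   edge set of the cycle traversed by [p]. *)
Definition cycle_edges (p : seq G) : {set {set G}} :=
  [set [set x; next p x] | x in p].

(* A cycle is identified with its edge set: the rotations and the reversal of
   a vertex sequence describe the same cycle. *)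
Definition is_cycle (C : {set {set G}}) : Prop :=
  exists p : seq G,
    [/\ 2 < size p, ucycle (@adj G) p & C = cycle_edges p].

Definition unicyclic : Prop :=
  connected /\ exists! C : {set {set G}}, is_cycle C.

Definition matching (M : {set {set G}}) : bool :=
  (M \subset edges) && trivIset M.

Definition matching_number : nat := \max_(M | matching M) #|M|.

Definition has_walk (x y : G) (k : nat) : bool :=
  [exists p : k.-tuple G, path (@adj G) x p && (last x p == y)].

(* The least length of a walk from [x] to [y]; a shortest walk has fewer than
   [#|G|] edges.  The junk value [#|G|] is returned when there is no walk. *)
Definition gdist (x y : G) : nat := find (has_walk x y) (iota 0 #|G|).

(* [enum_rank] is used only to list each unordered pair of distinct vertices
   exactly once. *)
Definition Wiener : nat :=
  \sum_(x : G) \sum_(y : G | enum_rank x < enum_rank y) gdist x y.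

End GraphNotions.

Definition isomorphic (G H : sgraph) : Prop :=
  exists2 f : G -> H, bijective f & forall x y, adj (f x) (f y) = adj x y.

Definition in_U (n m : nat) (G : sgraph) : Prop :=
  [/\ #|G| = n, unicyclic G & matching_number G = m].

Section GraphOfArcs.

Variables (N : nat) (r : rel nat).

Definition arcs_adj : rel 'I_N := fun x y => (x != y) && (r x y || r y x).

Lemma arcs_adj_sym : symmetric arcs_adj.
Proof. by move=> x y; rewrite /arcs_adj eq_sym orbC. Qed.

Lemma arcs_adj_irr : irreflexive arcs_adj.
Proof. by move=> x; rewrite /arcs_adj eqxx. Qed.

Definition graph_of_arcs : sgraph := SGraph arcs_adj_sym arcs_adj_irr.

End GraphOfArcs.

(* Vertices of G^3_{a,j}: A_i is i (i <= j), B_0 is j+1, C_0 is j+2, and the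
   a pendant vertices are j+3, ..., j+2+a. *)
Definition G3_arcs (j : nat) : rel nat := fun u v =>
  [|| (u < j) && (v == u.+1),
      (u == 0) && (v == j.+1),
      (u == j.+1) && (v == j.+2),
      (u == j.+2) && (v == 0)
    | (u == j) && (j.+3 <= v)].

Definition G3 (a j : nat) : sgraph := graph_of_arcs (a + j + 3) (G3_arcs j).

(* Vertices of G^4_{a,c,j}: A_i is i (i <= j), B_0 is j+1, C_0 is j+2, D_0 is
   j+3, the a pendant vertices at A_j are j+4, ..., j+3+a, and the c pendant
   vertices at C_0 are j+4+a, ..., j+3+a+c. *)
Definition G4_arcs (a j : nat) : rel nat := fun u v =>
  [|| (u < j) && (v == u.+1),
      (u == 0) && (v == j.+1),
      (u == j.+1) && (v == j.+2),
      (u == j.+2) && (v == j.+3),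
      (u == j.+3) && (v == 0),
      (u == j) && (j.+4 <= v < j.+4 + a)
    | (u == j.+2) && (j.+4 + a <= v)].

Definition G4 (a c j : nat) : sgraph :=
  graph_of_arcs (a + c + j + 4) (G4_arcs a j).

(* Main.v *)
Require Import Defs.
From HB Require Import structures.
From mathcomp Require Import all_boot all_order all_algebra.
From mathcomp Require Import zify ring lra.

Set Implicit Arguments.
Unset Strict Implicit.
Unset Printing Implicit Defensive.

(* Cutting the unique cycle open at one of its edges turns G into a tree T, and
   distances in G are those of T shortened for pairs of vertices whose branches
   lie far apart along the opened cycle.

   T has fewer than 2m non-leaves, hence a connected core of t = 2m - 1 vertices
   containing all of them; the remaining vertices are pendant at the core.  The
   Wiener index of T is largest when the core is a path with the pendant
   vertices shared evenly between its two ends (a dumbbell), and any other core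
   falls short of this bound by a definite gap.

   The shortening is then estimated for every rotation of the cycle.  Averaging
   over the rotations excludes cycles of length at least 5; for triangles and
   squares, all rotations fail only if the vertices carrying further branches
   are a single vertex or two opposite vertices of a square.  In these cases
   deciding which dumbbells can be reached gives the bound and identifies G. *)

(** * Distances and trees *)

(** Every estimate has the shape [6 * Wiener G + 6 * loss <= tree_bound]; the factor 6 clears the
    denominator of (t^3 - t) / 6, the Wiener index of a path. The obstacle is that a good tree and a
    small loss compete. A triangle cut at its root loses only n - 2, but one end of the core then
    carries exactly one pendant vertex, so the shares are even only if at most three vertices lie
    outside the core, that is n <= 2m + 2. A square loses twice the size of the branch at its root,
    but any number of pendant vertices may hang at the opposite corner, and each one moved there
    also lowers the loss; so the smaller half stays on the side of the root. For at most three
    vertices outside the core the two losses agree only if m = 2 and there are one or three of them: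
    the pairs (4, 2) and (6, 2). Cores are padded with leaves to exactly 2m - 1 vertices, so that
    all cuts of all cycles are compared with the same [tree_bound]. That the listed graphs attain
    the bound needs only a lower estimate of their distances, by a level function. *)

Section Distance.

Variable G : sgraph.
Implicit Types (x y z u v w : G) (p : seq G).

Lemma has_walkP x y k :
  reflect (exists p, [/\ size p = k, path (@adj G) x p & last x p = y])
          (has_walk x y k).
Proof.
apply: (iffP existsP) => [[p /andP[pp /eqP lp]]|[p [sp pp lp]]].
  by exists p; rewrite size_tuple.
have sp' : size p == k by apply/eqP.
by exists (Tuple sp'); rewrite /= pp lp eqxx.
Qed.

Lemma gdist_le_walk x p : path (@adj G) x p -> gdist x (last x p) <= size p.
Proof.
move=> pp; rewrite /gdist leqNgt; apply/negP => lt_p.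
have ltG : size p < #|G|.
  by apply: leq_trans lt_p _; rewrite -[X in _ <= X](size_iota 0) find_size.
move: (before_find 0 lt_p); rewrite nth_iota // add0n // => /negbT/negP; apply.
by apply/has_walkP; exists p.
Qed.

Lemma gdist_shortest x y : connect (@adj G) x y ->
  exists p, [/\ size p = gdist x y, path (@adj G) x p & last x p = y].
Proof.
move=> /connectP[p0 pp0 ->]; case/shortenP: pp0 => p pp up _.
have ltG : size p < #|G|.
  by have := max_card (mem (x :: p)); rewrite (card_uniqP up).
have hs : has (has_walk x (last x p)) (iota 0 #|G|).
  apply/hasP; exists (size p); first by rewrite mem_iota.
  by apply/has_walkP; exists p.
have lt_find : find (has_walk x (last x p)) (iota 0 #|G|) < #|G|.
  by rewrite -[X in _ < X](size_iota 0) -has_find.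
by have := nth_find 0 hs; rewrite nth_iota // => /has_walkP.
Qed.

Lemma gdistxx x : gdist x x = 0.
Proof. by apply/eqP; rewrite -leqn0; apply: (@gdist_le_walk x [::]). Qed.

Hypothesis Gconn : connected G.
Let conn x y : connect (@adj G) x y. Proof. by case: Gconn. Qed.

Lemma gdist_sym x y : gdist x y = gdist y x.
Proof.
suff le u v : gdist u v <= gdist v u by apply/eqP; rewrite eqn_leq !le.
have [p [<- pp lp]] := gdist_shortest (conn v u).
have pr : path (@adj G) u (rev (belast v p)).
  by rewrite -lp rev_path (eq_path (e' := @adj G)) // => a b; rewrite adj_sym.
have E : last u (rev (belast v p)) = v.
  by case: p lp {pp pr} => [|a p] //= _; rewrite rev_cons last_rcons.
by have := gdist_le_walk pr; rewrite size_rev size_belast E.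
Qed.

Lemma gdist_triangle y x z : gdist x z <= gdist x y + gdist y z.
Proof.
have [p [<- pp lp]] := gdist_shortest (conn x y).
have [q [<- pq lq]] := gdist_shortest (conn y z).
have := @gdist_le_walk x (p ++ q).
by rewrite cat_path last_cat lp pp pq size_cat lq => ->.
Qed.

Lemma gdist_eq0 x y : (gdist x y == 0) = (x == y).
Proof.
apply/eqP/eqP => [d0|->]; last exact: gdistxx.
by have [p [sp _ <-]] := gdist_shortest (conn x y); case: p sp => //; rewrite d0.
Qed.

Lemma gdist_gt0 x y : (0 < gdist x y) = (x != y).
Proof. by rewrite lt0n gdist_eq0. Qed.

Lemma gdist_eq1 x y : (gdist x y == 1) = adj x y.
Proof.
apply/eqP/idP => [d1|axy].
  have [p [sp pp lp]] := gdist_shortest (conn x y).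
  case: p sp pp lp => [|a [|? ?]] /=; rewrite d1 // => _.
  by rewrite andbT => ? <-.
apply/eqP; rewrite eqn_leq gdist_gt0.
rewrite (@gdist_le_walk x [:: y]) /= ?axy //.
by apply/eqP => E; rewrite E adj_irr in axy.
Qed.

Lemma gdist_adj x y z : adj y z -> gdist x z <= (gdist x y).+1.
Proof.
rewrite -gdist_eq1 => /eqP d1.
by apply: leq_trans (gdist_triangle y x z) _; rewrite d1 addn1.
Qed.

Lemma gdist_pred x y : x != y ->
  exists2 z, adj z y & gdist x y = (gdist x z).+1.
Proof.
move=> nxy; have [p [sp pp lp]] := gdist_shortest (conn x y).
case/lastP: p sp pp lp => [|p z] /=; first by move=> _ _ E; rewrite E eqxx in nxy.
rewrite size_rcons rcons_path last_rcons => sp /andP[pp az] E; rewrite E in az.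
exists (last x p) => //; apply/eqP; rewrite eqn_leq gdist_adj //= -sp ltnS.
exact: gdist_le_walk.
Qed.

Lemma gdist_lipschitz (f : G -> nat) x y :
  (forall a b, adj a b -> f b <= (f a).+1) -> f y <= f x + gdist x y.
Proof.
move=> fL; have [p [<- pp <-]] := gdist_shortest (conn x y).
elim: p x pp => [|a p IH] x /=; first by rewrite addn0.
by case/andP=> /fL fa /IH; lia.
Qed.

(** A walk that leaves [A] can do so only along the edge from [u] to [v], so it is at least as long
    as the route through that edge; the triangle inequality gives the converse. *)
Lemma gdist_cut (A : pred G) u v w w' :
  adj u v -> (forall a b, adj a b -> A a -> ~~ A b -> a = u /\ b = v) ->
  A w -> ~~ A w' -> gdist w w' = (gdist w u + gdist v w').+1.
Proof.
move=> auv cutA Aw Aw'; apply/eqP; rewrite eqn_leq; apply/andP; split.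
  have := gdist_triangle u w w'; have := gdist_triangle v u w'.
  have /eqP -> : gdist u v == 1 by rewrite gdist_eq1.
  lia.
have [p [<- pp lp]] := gdist_shortest (conn w w'); rewrite -lp in Aw' *.
elim: p w Aw pp Aw' {lp} => [|a p IH] w Aw /=; first by rewrite Aw.
case/andP=> awa pp Al; have [Aa|Aa] := boolP (A a); last first.
  by have [-> <-] := cutA _ _ awa Aw Aa; rewrite gdistxx add0n ltnS gdist_le_walk.
have := IH a Aa pp Al; have := gdist_triangle a w u.
have /eqP -> : gdist w a == 1 by rewrite gdist_eq1.
lia.
Qed.

End Distance.

Section Trees.

Variable T : sgraph.
Implicit Types (u v w r : T).

(* Every edge is a bridge; [A] is the side of its first end. *)
Definition tree : Prop :=
  connected T /\ forall u v, adj u v -> exists A : pred T,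
    [/\ A u, ~~ A v & forall a b, adj a b -> A a -> ~~ A b -> a = u /\ b = v].

Hypothesis Ttree : tree.
Let Tconn : connected T. Proof. by case: Ttree. Qed.

Lemma tree_side u v w : adj u v ->
  gdist w v = (gdist w u).+1 \/ gdist w u = (gdist w v).+1.
Proof.
move=> auv; have [A [Au Av cutA]] := Ttree.2 u v auv.
have [Aw|Aw] := boolP (A w).
  by left; rewrite (gdist_cut Tconn auv cutA Aw Av) gdistxx addn0.
right; rewrite (gdist_sym Tconn w u) (gdist_cut Tconn auv cutA Au Aw) gdistxx.
by rewrite (gdist_sym Tconn v).
Qed.

Lemma tree_cross u v w w' : adj u v ->
  gdist w v = (gdist w u).+1 -> gdist w' u = (gdist w' v).+1 ->
  gdist w w' = (gdist w u + gdist v w').+1.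
Proof.
move=> auv wu w'v; have [A [Au Av cutA]] := Ttree.2 u v auv.
have Aw : A w.
  apply: contra_eqT wu => Aw.
  rewrite (gdist_sym Tconn w u) (gdist_cut Tconn auv cutA Au Aw) gdistxx.
  by rewrite (gdist_sym Tconn v); lia.
apply: (gdist_cut Tconn auv cutA) => //; apply: contra_eqN w'v => Aw'.
by rewrite (gdist_cut Tconn auv cutA Aw' Av) gdistxx; lia.
Qed.

(** The edge from [a] to [v] is a bridge with [r] on the side of [a]. Were [b] on the side of [v],
    the way from [r] to [b] would pass through [v], and [b] could not be closer to [r] than [v]
    is. *)
Lemma tree_parent_uniq r v a b : adj a v -> adj b v ->
  gdist r v = (gdist r a).+1 -> gdist r v = (gdist r b).+1 -> a = b.
Proof.
move=> aav abv ra rb; have [A [Aa Av cutA]] := Ttree.2 a v aav.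
have [Ab|Ab] := boolP (A b); first by have [-> _] := cutA _ _ abv Ab Av.
have Ar : A r.
  apply: contra_eqT ra => Ar.
  rewrite (gdist_sym Tconn r a) (gdist_cut Tconn aav cutA Aa Ar) gdistxx.
  by rewrite (gdist_sym Tconn v); lia.
have := gdist_cut Tconn aav cutA Ar Ab; lia.
Qed.

End Trees.

(** * Distance sums over a tree grown leaf by leaf *)

(** For a fixed sum the product is largest at the most even split. This bounds the number of pairs
    of pendant vertices that one tree edge separates. *)
Lemma split_product_le a c k : c <= a <= c.+1 -> k <= a + c ->
  k * (a + c - k) <= c * a.
Proof.
move=> ac lk; have [kc|ck] := leqP k c.
  have [i ->] : exists i, c = k + i by exists (c - k); lia.
  have [j ->] : exists j, a = k + j by exists (a - k); lia.
  have -> : k + j + (k + i) - k = k + i + j by lia.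
  nia.
have [i Ei] : exists i, k = a + i by exists (k - a); lia.
have [h Eh] : exists h, c = i + h by exists (c - i); lia.
have [j Ej] : exists j, a = j + h by exists (a - h); lia.
have -> : a + c - k = h by lia.
rewrite Ei Eh Ej; nia.
Qed.

(** By concavity the minimum is at [k = 1] or [k = n - 1]. This is the source of the gaps: an inner
    position of a path loses at least this much. *)
Lemma inner_product_ge k n : 0 < k < n -> n.-1 <= k * (n - k).
Proof.
case/andP; case: k => // k _ lk.
have [j ->] : exists j, n = k.+1 + j.+1 by exists (n - k.+2); lia.
have -> : k.+1 + j.+1 - k.+1 = j.+1 by lia.
nia.
Qed.

Section TreeMetric.

Variables (V : eqType) (d : V -> V -> nat).
Hypotheses (dxx : forall x, d x x = 0) (dC : forall x y, d x y = d y x).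
Implicit Types (s q : seq V) (u v w p : V).

(** The list grows at its head: [v] is a new leaf hanging at [p]. Only distances are recorded, for
    an arbitrary [d], so that subtrees are handled as lists with the ambient distance and no
    subgraph is formed. *)
Inductive tree_seq : seq V -> Prop :=
| TreeSeq1 v : tree_seq [:: v]
| TreeSeqCons v p s : tree_seq s -> p \in s -> v \notin s ->
    (forall w, w \in s -> d v w = (d p w).+1) -> tree_seq (v :: s).

Definition path_order q := forall x0 i j, i < size q -> j < size q ->
  d (nth x0 q i) (nth x0 q j) = (i - j) + (j - i).

Definition dist_sum s i := \sum_(w <- s) d i w.

Definition dist_total s := \sum_(u <- s) dist_sum s u.

Lemma path_order_rev q : path_order q -> path_order (rev q).
Proof.
move=> H x0 i j; rewrite size_rev => li lj.
by rewrite !nth_rev // H; lia.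
Qed.

Lemma path_order_cons v p q : path_order (p :: q) ->
  (forall w, w \in p :: q -> d v w = (d p w).+1) -> path_order (v :: p :: q).
Proof.
move=> H vH x0.
have v0 j : j < size (p :: q) -> d v (nth x0 (p :: q) j) = j.+1.
  by move=> lj; rewrite vH ?mem_nth // (H x0 0) //; lia.
case=> [|i] [|j] li lj; first by rewrite /= dxx.
- by rewrite v0.
- by rewrite dC v0 // addn0.
- exact: (H x0 i j).
Qed.

Lemma path_order_rcons v p q : path_order (rcons q p) ->
  (forall w, w \in rcons q p -> d v w = (d p w).+1) ->
  path_order (rcons (rcons q p) v).
Proof.
move=> H vH; rewrite -[rcons _ v]revK; apply: path_order_rev.
rewrite !rev_rcons; apply: path_order_cons; first by rewrite -rev_rcons; apply: path_order_rev.
by move=> w; rewrite -rev_rcons mem_rev; apply: vH.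
Qed.

Lemma dist_sum_cons s v (i : V) : dist_sum (v :: s) i = d i v + dist_sum s i.
Proof. by rewrite /dist_sum big_cons. Qed.

Lemma dist_sum_child s v p :
  (forall w, w \in s -> d v w = (d p w).+1) ->
  dist_sum s v = dist_sum s p + size s.
Proof.
move=> H; rewrite /dist_sum -sum1_size -big_split /=.
by apply: eq_big_seq => w /H ->; rewrite addn1.
Qed.

Lemma dist_total_cons s v :
  dist_total (v :: s) = dist_total s + 2 * dist_sum s v.
Proof.
rewrite /dist_total big_cons dist_sum_cons dxx add0n.
under eq_bigr do rewrite dist_sum_cons dC.
by rewrite big_split /= -/(dist_sum s v); lia.
Qed.

Lemma tree_seq_gt0 s : tree_seq s -> 0 < size s.
Proof. by case. Qed.

Lemma tree_seq_uniq s : tree_seq s -> uniq s.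
Proof. by elim=> //= v p {}s _ -> _ ->. Qed.

Lemma tree_seq_dist_lt s : tree_seq s -> {in s &, forall u w, d u w < size s}.
Proof.
elim=> [v|v p {}s _ IH ps vs H] u w.
  by rewrite !inE => /eqP -> /eqP ->; rewrite dxx.
rewrite !inE => /predU1P[->|us] /predU1P[->|ws] /=.
- by rewrite dxx.
- by rewrite H // ltnS IH.
- by rewrite dC H // ltnS IH.
- by apply: ltnW; rewrite ltnS IH.
Qed.

(** A new leaf is no farther from an old vertex than the number of vertices already there, and its
    own sum exceeds that of its parent by this number. The increments add up to 1 + 2 + ... + (size
    s - 1), the sum at an end of a path. *)
Lemma dist_sum_le s i : tree_seq s -> i \in s ->
  2 * dist_sum s i <= size s * (size s).-1.
Proof.
move=> ts; elim: ts i => [v|v p {}s ts IH ps vs H] i.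
  by rewrite inE => /eqP ->; rewrite /dist_sum big_seq1 dxx.
rewrite inE dist_sum_cons => /predU1P[->|si].
  by rewrite dxx (dist_sum_child H); have := IH p ps; have := tree_seq_gt0 ts; simpl; nia.
have := IH i si; have := tree_seq_dist_lt ts ps si; rewrite (dC i v) H //.
have := tree_seq_gt0 ts; simpl; nia.
Qed.

(** Position [k] on a path of t vertices has k vertices on one side and r = t - 1 - k on the other,
    and k(k + 1) + r(r + 1) = t(t - 1) - 2kr. The product is the shortfall against an end of the
    path. *)
Lemma path_dist_sum x0 q k : path_order q -> k < size q ->
  2 * dist_sum q (nth x0 q k) + 2 * (k * ((size q).-1 - k)) = size q * (size q).-1.
Proof.
move=> H lk; rewrite /dist_sum (big_nth x0) big_mkord.
under eq_bigr => j _ do rewrite H //.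
move: (size q) lk => t {H}.
elim: t => // t IH; rewrite ltnS leq_eqVlt => /predU1P[->|lk]; last first.
  have := IH lk; rewrite big_ord_recr /=; nia.
rewrite big_ord_recr /= subnn.
suff E : 2 * (\sum_(j < t) (t - j + (j - t))) = t * t.+1.
  by rewrite !addn0 muln0 muln0 addn0 E mulnC.
elim: t {IH k} => [|t IH]; first by rewrite big_ord0.
rewrite big_ord_recl /= (eq_bigr (fun j : 'I_t => t - j + (j - t))).
  by rewrite mulnDr IH subn0 addn0 -mulnDl mulnC.
by move=> j _; rewrite /= /bump /=; lia.
Qed.

Lemma perm_dist_sum q s i : perm_eq q s -> dist_sum q i = dist_sum s i.
Proof. by move=> H; rewrite /dist_sum (perm_big _ H). Qed.

(** The case of equality in [dist_sum_le]: unless [i] is an end of a path through all of [s], at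
    least one unit is lost, doubled here. *)
Lemma dist_sum_lt s i : tree_seq s -> i \in s ->
  (exists2 q, perm_eq (i :: q) s & path_order (i :: q)) \/
  2 * dist_sum s i + 2 <= size s * (size s).-1.
Proof.
move=> ts; elim: ts i => [v|v p {}s ts IH ps vs H] i.
  rewrite inE => /eqP ->; left; exists [::] => //.
  by move=> x0 [|//] [|//] _ _ /=; rewrite dxx.
have s0 := tree_seq_gt0 ts.
rewrite inE dist_sum_cons => /predU1P[->|si].
  rewrite dxx (dist_sum_child H).
  case: (IH p ps) => [[q pq oq]|]; last by simpl; right; nia.
  left; exists (p :: q); first by rewrite perm_cons.
  by apply: path_order_cons => // w; rewrite (perm_mem pq); apply: H.
have dle := dist_sum_le ts si; have dlt := tree_seq_dist_lt ts si ps.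
rewrite dC H // [d p i]dC.
case: (IH i si) => [[q pq oq]|]; last by simpl; right; nia.
have sq : size s = (size q).+1 by rewrite -(perm_size pq).
(* Hanging anywhere but at the far end of the path from [i], the new leaf is closer to [i] than the
   maximum. *)
have [E|ne] := eqVneq p (last i q); last first.
  right; suff: d i p < (size s).-1 by simpl; nia.
  have iq : index p (i :: q) < size (i :: q) by rewrite index_mem (perm_mem pq).
  have -> : d i p = index p (i :: q).
    rewrite -{1}(nth_index i (_ : p \in i :: q)) ?(perm_mem pq) //.
    by rewrite (oq i 0) //; lia.
  rewrite sq /= ltn_neqAle -ltnS iq andbT.
  apply: contra_neqN ne => /eqP E'; have E : index p (i :: q) = size q := E'.
  rewrite -[LHS](nth_index i (_ : p \in i :: q)) ?(perm_mem pq) //.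
  by rewrite E (last_nth i).
left; exists (rcons q v); first by rewrite -rcons_cons perm_rcons perm_cons.
move: oq pq E; rewrite -rcons_cons lastI => oq pq E.
rewrite -E in oq pq *; apply: path_order_rcons => // w.
by rewrite (perm_mem pq); apply: H.
Qed.

Lemma dist_total_le s : tree_seq s -> 3 * dist_total s + size s <= size s ^ 3.
Proof.
elim=> [v|v p {}s ts IH ps vs H].
  by rewrite /dist_total big_seq1 /dist_sum big_seq1 dxx.
rewrite dist_total_cons (dist_sum_child H).
have := dist_sum_le ts ps; have := tree_seq_gt0 ts; simpl.
move: IH; rewrite !expnS expn0; nia.
Qed.

(** With s the size, a path attains s^3 - s in [dist_total_le], and the gap is 6(s - 3): an inner
    vertex of a path on s - 1 vertices has shortfall at least s - 3, and each leaf added after the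
    tree has ceased to be a path loses at least one more. *)
Lemma dist_total_gap s : tree_seq s ->
  (exists2 q, perm_eq q s & path_order q) \/
  3 * dist_total s + 7 * size s <= size s ^ 3 + 18.
Proof.
elim=> [v|v p {}s ts IH ps vs H].
  by left; exists [:: v] => // x0 [|//] [|//] _ _; rewrite /= dxx.
rewrite dist_total_cons (dist_sum_child H).
have s0 := tree_seq_gt0 ts; have Wle := dist_total_le ts.
case: IH => [[q pq oq]|W]; last first.
  case: (dist_sum_lt ts ps) => [[q pq oq]|D].
    left; exists (v :: p :: q); first by rewrite perm_cons.
    by apply: path_order_cons => // w; rewrite (perm_mem pq); apply: H.
  right; simpl; move: W Wle; rewrite !expnS expn0; nia.
have sq : size s = size q by rewrite -(perm_size pq).
have pinq : p \in q by rewrite (perm_mem pq).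
have iq : index p q < size q by rewrite index_mem.
have [k0|k0] := posnP (index p q).
  left; exists (v :: q); first by rewrite perm_cons.
  case: q pq oq sq pinq iq k0 => [//|p' q] pq oq sq pinq iq /=.
  case: eqP => // E _; rewrite E in pq oq *; apply: path_order_cons => // w.
  by rewrite (perm_mem pq) => /H.
have [k1|k1] := eqVneq (index p q) (size q).-1.
  have [q' Eq] : exists q', q = rcons q' p.
    case/lastP: q pq oq sq pinq iq k0 k1 => [//|q' p'] pq oq sq pinq iq k0 k1.
    exists q'; congr rcons; have := nth_index p pinq.
    by rewrite k1 size_rcons /= nth_rcons ltnn eqxx.
  left; exists (rcons q v); first by rewrite perm_rcons perm_cons.
  rewrite Eq in oq pq *; apply: path_order_rcons => // w.
  by rewrite (perm_mem pq); apply: H.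
right; have := path_dist_sum p oq iq; rewrite nth_index // (perm_dist_sum p pq) -sq.
have : (size s).-1.-1 <= index p q * ((size s).-1 - index p q).
  by apply: inner_product_ge; lia.
move: Wle; rewrite /= !expnS expn0; nia.
Qed.

(** * Weights placed on the vertices of a tree *)

Section Placement.

Variable I : eqType.
Implicit Types (f : I -> V) (L : seq I).

Lemma sum_xor (P : pred I) L :
  \sum_(l <- L) \sum_(l' <- L) (P l (+) P l') =
  2 * (count P L * (size L - count P L)).
Proof.
have cnt b : \sum_(l' <- L) (b (+) P l') = if b then size L - count P L else count P L.
  case: b => /=; last by rewrite -sum1_count [RHS]big_mkcond; apply: eq_bigr => l _; case: (P l).
  rewrite -[size L](count_predC P) addKn -sum1_count [RHS]big_mkcond.
  by apply: eq_bigr => l _ /=; case: (P l).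
under eq_bigr => l _ do rewrite cnt.
rewrite (bigID P) /= (eq_bigr (fun=> size L - count P L)); last by move=> l ->.
rewrite [X in _ + X](eq_bigr (fun=> count P L)); last by move=> l /negPf ->.
rewrite !big_const_seq !iter_addn_0.
have := count_predC P L; rewrite (@eq_count _ (fun i => ~~ P i) (predC P)) //; nia.
Qed.

Definition placed_dist L f := \sum_(l <- L) \sum_(l' <- L) d (f l) (f l').

(** Moving everything placed at the leaf [v] to its neighbour [p] shortens by one exactly the
    distances between the [k] elements at [v] and the others. The leaf edge thus contributes the
    number of pairs that it separates. *)
Lemma placed_dist_peel s v p L f :
  (forall w, w \in s -> d v w = (d p w).+1) -> v \notin s -> p \in s ->
  {in L, forall l, f l \in v :: s} ->
  let k := count (fun l => f l == v) L in
  placed_dist L f = placed_dist L (fun l => if f l == v then p else f l)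
                    + 2 * (k * (size L - k)).
Proof.
move=> H vs ps fL /=; rewrite -sum_xor -big_split /=.
apply: eq_big_seq => l /fL; rewrite inE => fl; rewrite -big_split /=.
apply: eq_big_seq => l' /fL; rewrite inE => fl'.
have sv w : w \in s -> (w == v) = false by apply: contraTF => /eqP ->.
case/predU1P: fl => [->|fl]; case/predU1P: fl' => [->|fl'];
  rewrite ?eqxx ?dxx ?sv //= ?H ?addn1 ?addn0 //.
by rewrite dC H // dC.
Qed.

(** Peeling off leaves accounts for the edges one at a time; each of the [(size s).-1] edges
    separates at most [c * a] pairs. *)
Lemma placed_dist_le s L f a c : tree_seq s -> {in L, forall l, f l \in s} ->
  size L = a + c -> c <= a <= c.+1 ->
  placed_dist L f <= 2 * ((size s).-1 * (c * a)).
Proof.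
move=> ts; elim: ts f => [v|v p {}s ts IH ps vs H] f fL sL ac.
  rewrite /placed_dist big_seq big1 // => l /fL; rewrite inE => /eqP ->.
  by rewrite big_seq big1 // => l' /fL; rewrite inE => /eqP ->.
rewrite (placed_dist_peel H vs ps fL).
set f' := fun l => _; have fL' : {in L, forall l, f' l \in s}.
  move=> l /fL; rewrite inE /f'; case: eqP => [_ _|_] //=.
have := IH f' fL' sL ac; have := tree_seq_gt0 ts.
move: (count_size (fun l => f l == v) L).
set k := count _ _; rewrite sL /=.
move=> /(split_product_le ac); nia.
Qed.

(* Either all weight sits at the two ends of a path, or at least [size s - 2]
   is lost, counting each unordered pair of vertices once. *)
Lemma dumbbell_gap s L f : tree_seq s -> {in L, forall l, f l \in s} ->
  0 < size L -> 2 < size s ->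
  (exists q, [/\ perm_eq q s, path_order q & forall x0, {in L, forall l,
     f l = nth x0 q 0 \/ f l = nth x0 q (size s).-1}]) \/
  3 * dist_total s + 6 * (\sum_(l <- L) dist_sum s (f l)) + 7 * size s <=
  size s ^ 3 + 12 + 3 * (size L * (size s * (size s).-1)).
Proof.
move=> ts fL L0 s2.
have sumle L' : {subset L' <= L} ->
    2 * (\sum_(l <- L') dist_sum s (f l)) <= size L' * (size s * (size s).-1).
  elim: L' => [|l L' IH] sub; first by rewrite big_nil.
  have lL : l \in L by apply: sub; rewrite mem_head.
  have sub' : {subset L' <= L} by move=> x xL; apply: sub; rewrite inE xL orbT.
  rewrite big_cons; have := dist_sum_le ts (fL _ lL); have := IH sub'; simpl; nia.
have Wle := dist_total_le ts.
have memL l : l \in L -> 2 * (\sum_(l <- L) dist_sum s (f l)) <=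
    2 * dist_sum s (f l) + (size L).-1 * (size s * (size s).-1).
  move=> lL; rewrite (perm_big _ (perm_to_rem lL)) big_cons.
  have := sumle (rem l L) (fun x xr => mem_rem xr); rewrite size_rem // mulnDr leq_add2l.
  exact.
have on_path q : perm_eq q s -> path_order q ->
  (exists q, [/\ perm_eq q s, path_order q & forall x0, {in L, forall l,
     f l = nth x0 q 0 \/ f l = nth x0 q (size s).-1}]) \/
  3 * dist_total s + 6 * (\sum_(l <- L) dist_sum s (f l)) + 7 * size s <=
  size s ^ 3 + 12 + 3 * (size L * (size s * (size s).-1)).
  move=> pq oq; have sq : size s = size q by rewrite -(perm_size pq).
  have fq l : l \in L -> f l \in q by rewrite (perm_mem pq) => /fL.
  (* One element at an inner position of the path already costs [size s - 2], by [path_dist_sum]. *)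
  have [/allP ends|/allPn[l lL]] :=
    boolP (all (fun l => (index (f l) q == 0) || (index (f l) q == (size s).-1)) L).
    left; exists q; split=> // x0 l lL; have := ends l lL.
    by case/orP => /eqP <-; [left|right]; rewrite nth_index ?fq.
  rewrite negb_or => /andP[k0 k1]; right.
  have iq : index (f l) q < size q by rewrite index_mem fq.
  have := path_dist_sum (f l) oq iq; rewrite nth_index ?fq // (perm_dist_sum _ pq) -sq.
  have := memL l lL; rewrite -sq in iq.
  have : (size s).-1.-1 <= index (f l) q * ((size s).-1 - index (f l) q).
    by apply: inner_product_ge; lia.
  by move: L0 Wle; case: (size L) => //= x _; rewrite mulSn; lia.
(* A core that is not a path loses [size s - 3] by itself. The missing unit comes from any single
   element: its vertex either is an end of a path through [s], which leads back to the first case,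
   or misses the maximal distance sum. *)
have [[q pq oq]|W] := dist_total_gap ts; first exact: on_path oq.
case: L L0 fL {sumle} memL on_path => // l L _ fL memL on_path.
have lL := mem_head l L; have := memL l lL.
case: (dist_sum_lt ts (fL l lL)) => [[q pq oq] _|D]; first exact: on_path oq.
by move=> M; right; rewrite /= mulSn; simpl in M; lia.
Qed.

End Placement.

End TreeMetric.

Lemma Wiener_double (G : sgraph) : connected G ->
  2 * Wiener G = \sum_(x : G) \sum_(y : G) gdist x y.
Proof.
move=> Gc; have -> : \sum_(x : G) \sum_(y : G) gdist x y =
    \sum_(x : G) \sum_(y : G | enum_rank x < enum_rank y) gdist x y +
    \sum_(x : G) \sum_(y : G | enum_rank y < enum_rank x) gdist x y.
  rewrite -big_split /=; apply: eq_bigr => x _.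
  rewrite (bigD1 x) //= gdistxx add0n (bigID (fun y => enum_rank x < enum_rank y)) /=.
  congr (_ + _); apply: eq_bigl => y; have [->|ne] /= := eqVneq y x; rewrite ?ltnn //.
  rewrite -leqNgt leq_eqVlt; case: eqP => //= E.
  by case/eqP: ne; apply: enum_rank_inj; apply: val_inj.
rewrite mul2n -addnn; congr (_ + _).
rewrite /Wiener (exchange_big_dep xpredT) //=; apply: eq_bigr => x _; apply: eq_bigr => y _.
by rewrite gdist_sym.
Qed.

Lemma isomorphic_Wiener (G H : sgraph) : connected G -> connected H ->
  isomorphic G H -> Wiener G = Wiener H.
Proof.
move=> Gc Hc [f [g fK gK] fadj]; apply/eqP; rewrite -(eqn_pmul2l (isT : 0 < 2)).
rewrite !Wiener_double //; apply/eqP.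
have le x y : gdist (f x) (f y) <= gdist x y.
  case: Gc => _ Gc; have [p [<- pp <-]] := gdist_shortest (Gc x y).
  rewrite -[X in _ <= X](size_map f) -(last_map f).
  by apply: gdist_le_walk; elim: p x pp => //= a p IH x /andP[xa /IH ->]; rewrite fadj xa.
have ge x y : gdist x y <= gdist (f x) (f y).
  case: Hc => _ Hc; have [p [<- pp lp]] := gdist_shortest (Hc (f x) (f y)).
  have -> : y = last x (map g p) by rewrite -{1}(fK x) last_map lp fK.
  rewrite -[X in _ <= X](size_map g); apply: gdist_le_walk.
  rewrite -{1}(fK x); elim: p (f x) pp {lp} => //= a p IH z /andP[za /IH ->].
  by rewrite -fadj !gK za.
rewrite (reindex f) /=; last by exists g => ? _.
apply: eq_bigr => x _; rewrite (reindex f) /=; last by exists g => ? _.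
by apply: eq_bigr => y _; apply/eqP; rewrite eqn_leq ge le.
Qed.

(** * Matchings and non-leaves *)

Section Matching.

Variable G : sgraph.
Implicit Types (M : {set {set G}}) (u v : G).

Lemma edgesP (E : {set G}) :
  reflect (exists u v, adj u v /\ E = [set u; v]) (E \in edges G).
Proof.
apply: (iffP imsetP) => [[[u v]]|[u [v [uv ->]]]].
  by rewrite inE /= => uv ->; exists u, v.
by exists (u, v); rewrite ?inE.
Qed.

Lemma set2_edge u v : ([set u; v] \in edges G) = adj u v.
Proof.
apply/edgesP/idP => [[a [b [ab E]]]|uv]; last by exists u, v.
have /set2P ua : u \in [set a; b] by rewrite -E set21.
have /set2P va : v \in [set a; b] by rewrite -E set22.
have ne : a != b by apply: contraTneq ab => ->; rewrite adj_irr.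
have := set21 a b; have := set22 a b; rewrite -E.
case: ua va => -> [] -> //.
- by rewrite setUid inE eq_sym (negPf ne).
- by rewrite adj_sym.
- by rewrite setUid !inE (negPf ne).
Qed.

Lemma matching_add M u v : matching M -> adj u v ->
  u \notin cover M -> v \notin cover M -> matching ([set u; v] |: M).
Proof.
case/andP=> sM tM uv uM vM; apply/andP; split.
  by rewrite subUset sub1set set2_edge uv.
have n0 : set0 \notin M.
  apply/negP => /(subsetP sM)/edgesP[a [b [_ E]]].
  by have := set21 a b; rewrite -E inE.
case: (@trivIsetU1 _ [set u; v] M) => // E EM; rewrite disjoint_sym.
apply/pred0P => w /=; apply/negP => /andP[wE /set2P wuv].
have : w \in cover M by apply/bigcupP; exists E.
by case: wuv => ->; apply/negP.
Qed.

Lemma cover_add M (E : {set G}) : cover (E |: M) = E :|: cover M.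
Proof. by rewrite /cover bigcup_setU big_set1. Qed.

Lemma matching_rem M E : matching M -> matching (M :\ E).
Proof.
case/andP=> sM tM; apply/andP; split; first exact: subset_trans (subsetDl _ _) sM.
by apply: trivIsetS tM; apply: subsetDl.
Qed.

Lemma matching_rem_disjoint M E v : matching M -> E \in M -> v \in E ->
  v \notin cover (M :\ E).
Proof.
case/andP=> _ /trivIsetP tM EM vE; apply/bigcupP => -[F]; rewrite !inE => /andP[nFE FM] vF.
by have /pred0P/(_ v) := tM _ _ FM EM nFE; rewrite /= vE vF.
Qed.

Lemma matching_cover_card M : matching M -> #|cover M| = 2 * #|M|.
Proof.
case/andP=> sM tM; have [_] := leq_card_cover M; rewrite tM => /eqP ->.
have E2 (E : {set G}) : E \in M -> #|E| = 2.
  move=> /(subsetP sM)/edgesP[u [v [uv ->]]].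
  by rewrite cards2; case: eqP uv => // ->; rewrite adj_irr.
by rewrite (eq_bigr (fun=> 2) E2) sum_nat_const mulnC.
Qed.

End Matching.

Section TreeCore.

Variable T : sgraph.
Hypothesis Ttree : tree T.
Let Tc : connected T. Proof. by case: Ttree. Qed.
Implicit Types (u v w r : T) (R : {set T}).

(** Closure under parents towards [r] makes [R] stand for the subtree it spans, measured with the
    distances of [T]. *)
Definition rooted r R : Prop :=
  r \in R /\ forall v, v \in R -> v != r ->
    exists p, [/\ p \in R, adj p v & gdist r v = (gdist r p).+1].

Lemma rooted_tree_seq r R : rooted r R ->
  exists s, [/\ tree_seq (@gdist T) s, uniq s & s =i R].
Proof.
elim: {R}#|R| {-2}R (leqnn #|R|) => [|k IH] R.
  by rewrite leqn0 cards_eq0 => /eqP -> []; rewrite inE.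
move=> leR [rR Rpar].
(* A vertex of [R] farthest from [r] is no parent of another vertex of [R], so it can be the leaf
   added last. *)
case: (@arg_maxnP _ r (mem R) (gdist r) rR) => v vR' vmax'.
have vR : v \in R := vR'.
have vmax x : x \in R -> gdist r x <= gdist r v := vmax' x.
have [vr|vr] := eqVneq v r.
  exists [:: r]; split=> // [|x]; first exact: TreeSeq1.
  rewrite inE; apply/idP/idP => [/eqP -> //|xR].
  by have := vmax x xR; rewrite vr gdistxx leqn0 gdist_eq0 // eq_sym.
have [p [pR apv dv]] := Rpar v vR vr.
have [||s [ts us sR]] := IH (R :\ v).
- by move: leR; rewrite (cardsD1 v) vR.
- split=> [|w]; first by rewrite !inE rR eq_sym vr.
  rewrite !inE => /andP[wv wR] wr; have [p' [p'R ap' dw]] := Rpar w wR wr.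
  exists p'; split=> //; rewrite !inE p'R andbT; apply/eqP => E.
  by have := vmax w wR; rewrite dw E ltnn.
exists (v :: s); split.
- apply: (TreeSeqCons ts (p := p)).
  + by rewrite sR !inE pR andbT; apply/eqP => E; rewrite E adj_irr in apv.
  + by rewrite sR !inE eqxx.
  + move=> w; rewrite sR !inE => /andP[wv wR].
    rewrite (gdist_sym Tc v) (gdist_sym Tc p).
    case: (tree_side Ttree w apv) => // wp.
    have := tree_cross Ttree apv dv wp; have := vmax w wR.
    have : 0 < gdist v w by rewrite gdist_gt0 // eq_sym.
    rewrite /=; lia.
- by rewrite /= us sR !inE eqxx.
- by move=> x; rewrite inE sR !inE; case: eqVneq => // ->.
Qed.

Definition has_child r v := [exists w, adj v w && (gdist r w == (gdist r v).+1)].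

Definition nonleaf v := 1 < #|[set w | adj v w]|.

Lemma nonleafP v :
  reflect (exists a b, [/\ a != b, adj v a & adj v b]) (nonleaf v).
Proof.
apply: (iffP card_gt1P) => [[a [b []]]|[a [b [ab va vb]]]].
  by rewrite !inE => va vb ab; exists a, b.
by exists a, b; rewrite !inE.
Qed.

Lemma nonleaf_child r v : nonleaf v -> has_child r v.
Proof.
case/nonleafP=> a [b [ab va vb]]; apply/existsP.
case: (tree_side Ttree r va) => [da|da]; first by exists a; rewrite va da eqxx.
case: (tree_side Ttree r vb) => [db|db]; first by exists b; rewrite vb db eqxx.
by case/eqP: ab; apply: (tree_parent_uniq Ttree) da db; rewrite adj_sym.
Qed.

Lemma gdist_lt_card u v : gdist u v < #|T|.
Proof.
have [p0 pp0 lp0] := connectP (Tc.2 u v); rewrite lp0; case/shortenP: pp0 => p pp up _.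
apply: leq_ltn_trans (gdist_le_walk pp) _.
by have := max_card (mem (u :: p)); rewrite (card_uniqP up).
Qed.

(* A matching covering as many vertices with a child as possible, those near [r]
   counting more, covers them all: an uncovered one could be matched with one of
   its children, which is free or matched farther away from [r]. *)
Lemma card_has_child r : #|[set v | has_child r v]| <= 2 * matching_number T.
Proof.
pose wt v := if has_child r v then #|T| - gdist r v else 0.
have m0 : matching (set0 : {set {set T}}).
  by rewrite /matching sub0set; apply/trivIsetP => A; rewrite inE.
case: (@arg_maxnP _ set0 (@matching T) (fun M => \sum_(v in cover M) wt v) m0) => M mM Mmax.
have covers v : has_child r v -> v \in cover M.
  move=> hv; apply/negPn/negP => vM.
  have [u /andP[vu /eqP du]] := existsP hv.
  have wtv : 0 < wt v by rewrite /wt hv subn_gt0 gdist_lt_card.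
  have nvu : v != u by apply: contraTneq vu => ->; rewrite adj_irr.
  have [uM|uM] := boolP (u \in cover M); last first.
    have := Mmax _ (matching_add mM vu vM uM); rewrite cover_add -setUA.
    rewrite big_setU1 ?big_setU1 ?inE ?negb_or ?nvu //=; lia.
  have [E EM uE] := bigcupP uM.
  have [w [uw EE]] : exists w, adj u w /\ E = [set u; w].
    case/andP: mM => sM _; have /edgesP[a [b [ab EE]]] := subsetP sM E EM.
    move: uE; rewrite EE => /set2P[->|->]; first by exists b.
    by exists a; rewrite adj_sym setUC.
  have nuw : u != w by apply: contraTneq uw => ->; rewrite adj_irr.
  have wE : w \in E by rewrite EE set22.
  have wM : w \in cover M by apply/bigcupP; exists E.
  have nvw : v != w by apply: contraNneq vM => ->.
  have vM1 : v \notin cover (M :\ E).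
    by apply: contra vM => /bigcupP[F /setD1P[_ FM] vF]; apply/bigcupP; exists F.
  have uM1 := matching_rem_disjoint mM EM uE.
  have wM1 := matching_rem_disjoint mM EM wE.
  have := Mmax _ (matching_add (matching_rem E mM) vu vM1 uM1).
  have -> : cover M = [set u; w] :|: cover (M :\ E) by rewrite -cover_add -EE setD1K.
  rewrite cover_add -!setUA !big_setU1 ?inE ?negb_or ?nvu ?nuw //=.
  rewrite addnCA leq_add2l leq_add2r leqNgt => /negP; apply.
  (* The parent of [u] is [v], so its other neighbour [w] lies deeper. Trading the edge from [u] to
     [w] for the one from [v] to [u] replaces the weight of [w] by the larger weight of [v]. *)
  have dw : gdist r w = (gdist r u).+1.
    case: (tree_side Ttree r uw) => // dw; case/eqP: nvw.
    by apply: (tree_parent_uniq Ttree vu) du dw; rewrite adj_sym.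
  rewrite {1}/wt; case: ifP => // _; rewrite /wt hv dw du.
  by apply: ltn_sub2l; rewrite ?gdist_lt_card.
apply: leq_trans (_ : #|cover M| <= _).
  by apply/subset_leq_card/subsetP => v; rewrite inE; apply: covers.
rewrite (matching_cover_card mM) leq_mul2l /=.
exact: (@leq_bigmax_cond _ (@matching T) (fun M : {set {set T}} => #|M|) M mM).
Qed.

Lemma leaf_exists : exists v, ~~ nonleaf v.
Proof.
have [/card_gt0P[r _] _] := Tc.
case: (@arg_maxnP _ r xpredT (gdist r) isT) => v _ vmax; exists v.
apply/negP => /(nonleaf_child r)/existsP[w /andP[_ /eqP dw]].
by have := vmax w isT; rewrite /= dw ltnn.
Qed.

(** Root the tree at a leaf [r]. All non-leaves have a child, and so has [r] itself; this additional
    vertex makes the inequality of [card_has_child] strict. *)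
Lemma card_nonleaf : 1 < #|T| -> #|[set v | nonleaf v]| < 2 * matching_number T.
Proof.
move=> T1; have [r rleaf] := leaf_exists.
apply: leq_trans (card_has_child r); apply: proper_card; apply/properP; split.
  by apply/subsetP => v; rewrite !inE; apply: nonleaf_child.
exists r; rewrite inE //.
have [w wr] : exists w, w != r.
  case/card_gt1P: T1 => a [b [_ _ ab]]; have [E|] := eqVneq a r; last by exists a.
  by exists b; rewrite -E eq_sym.
have [z zr _] := gdist_pred Tc wr; apply/existsP; exists z.
rewrite adj_sym zr gdistxx //; apply/eqP/eqP; rewrite gdist_eq1 // adj_sym //.
Qed.

End TreeCore.

(** * Cores and dumbbells *)

Lemma set_between (V : finType) (A B : {set V}) k :
  A \subset B -> #|A| <= k <= #|B| ->
  exists R : {set V}, [/\ A \subset R, R \subset B & #|R| = k].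
Proof.
move=> sAB /andP[Ak kB].
elim: {k Ak}(k - #|A|) {-2}k (erefl (k - #|A|)) Ak kB => [|i IH] k Ei Ak kB.
  by exists A; split=> //; apply/eqP; rewrite eqn_leq Ak -subn_eq0 Ei eqxx.
case: k Ei Ak kB => // k Ei Ak kB.
have [|||R [AR RB Rk]] := IH k; try by lia.
have /subsetPn[v vB vR] : ~~ (B \subset R).
  by apply: contraL kB => /subset_leq_card; rewrite Rk -ltnNge.
exists (v |: R); rewrite cardsU1 vR Rk; split=> //.
- exact: subset_trans AR (subsetUr _ _).
- by rewrite subUset sub1set vB.
Qed.

(* Six times the Wiener index of a path on [t] vertices with [c] pendant vertices
   at one end and [a] at the other. *)
Definition tree_bound (t c a : nat) :=
  (t ^ 3 - t) + 3 * ((a + c) * (t * t.-1)) + 6 * ((a + c) * t)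
  + 6 * (t.-1 * (c * a)) + 6 * ((a + c) * (a + c).-1).

Section Core.

Variable T : sgraph.
Hypothesis Ttree : tree T.
Let Tc : connected T. Proof. by case: Ttree. Qed.
Implicit Types (u v w r l : T) (R : {set T}).

Lemma neighbor_exists u w : u != w -> exists v, adj u v.
Proof.
by rewrite eq_sym => wu; have [z zu _] := gdist_pred Tc wu; exists z; rewrite adj_sym.
Qed.

Lemma leaf_neighbor_uniq l u v : ~~ nonleaf l -> adj l u -> adj l v -> u = v.
Proof.
move=> nl lu lv; apply/eqP; apply: contraNT nl => uv.
by apply/nonleafP; exists u, v.
Qed.

Lemma leaf_dist l p w : ~~ nonleaf l -> adj l p -> w != l ->
  gdist l w = (gdist p w).+1.
Proof.
move=> nl lp wl; have [z zl E] := gdist_pred Tc wl.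
rewrite (gdist_sym Tc l) E (gdist_sym Tc p); congr (gdist _ _).+1.
by apply: leaf_neighbor_uniq lp; rewrite // adj_sym.
Qed.

Lemma leaf_neighbor_nonleaf l p : 2 < #|T| -> ~~ nonleaf l -> adj l p -> nonleaf p.
Proof.
move=> T2 nl lp; have [w wl wp] : exists2 w, w != l & w != p.
  have : 0 < #|~: [set l; p]|.
    by rewrite cardsCs setCK subn_gt0; apply: leq_ltn_trans T2; rewrite cards2; case: eqP.
  by case/card_gt0P => w; rewrite !inE negb_or => /andP[]; exists w.
have [z zp E] := gdist_pred Tc wp; apply/nonleafP; exists z, l; split.
- apply/eqP => zl; have := leaf_dist nl lp wl.
  by rewrite (gdist_sym Tc l) (gdist_sym Tc p) E zl; lia.
- by rewrite adj_sym.
- by rewrite adj_sym.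
Qed.

Definition core R := forall v, nonleaf v -> v \in R.

(** A parent other than [r] has both a child and a parent, so it is a non-leaf and lies in [R]. *)
Lemma core_rooted r R : core R -> r \in R -> rooted r R.
Proof.
move=> cR rR; split=> // v vR vr.
have [|p pv dv] := @gdist_pred _ Tc r v; first by rewrite eq_sym.
exists p; split=> //; have [<-//|rp] := eqVneq r p.
apply: cR; apply/nonleafP; have [q qp dp] := gdist_pred Tc rp.
exists v, q; split=> //; last by rewrite adj_sym.
by apply/eqP => vq; move: dp; rewrite -vq dv; lia.
Qed.

(** The non-leaves number at most [(2 * m).-1] and avoid [l], so they can be padded to this size
    without using [l]. In the applications to triangles and squares [l] is the last vertex of the
    opened cycle. *)
Lemma core_exists m l : matching_number T <= m -> 2 * m <= #|T| -> 1 < #|T| ->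
  ~~ nonleaf l -> exists R, [/\ core R, #|R| = (2 * m).-1 & l \notin R].
Proof.
move=> leM leT T1 nl.
have sub : [set v | nonleaf v] \subset [set~ l].
  by apply/subsetP => v; rewrite !inE; apply: contraTneq => ->.
have [|R [sR Rl cR]] := @set_between _ _ _ (2 * m).-1 sub.
  have := card_nonleaf Ttree T1; rewrite cardsC1.
  by move: (#|_|) (#|T|) (matching_number T) leM leT => x y z; lia.
exists R; split=> // [v nv|]; first by apply: (subsetP sR); rewrite inE.
by apply/negP => /(subsetP Rl); rewrite !inE eqxx.
Qed.

Section WithCore.

Variables (R : {set T}) (T2 : 2 < #|T|).
Hypothesis cR : core R.

Definition leaf_parent l := odflt l [pick p | adj l p].

Lemma leaf_parent_adj l : adj l (leaf_parent l).
Proof.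
rewrite /leaf_parent; case: pickP => [p //|none].
have [w wl] : exists w, l != w.
  have : 0 < #|[set~ l]| by rewrite cardsC1; apply: leq_trans (_ : 2 <= _); lia.
  by case/card_gt0P => w; rewrite !inE eq_sym; exists w.
by have [v] := neighbor_exists wl; rewrite none.
Qed.

Lemma leaf_parent_core l : l \notin R -> leaf_parent l \in R.
Proof.
move=> lR; apply/cR/(@leaf_neighbor_nonleaf l) => //; last exact: leaf_parent_adj.
by apply: contra lR; apply: cR.
Qed.

Lemma leaf_parent_dist l w : l \notin R -> w != l ->
  gdist l w = (gdist (leaf_parent l) w).+1.
Proof.
move=> lR; apply: leaf_dist (leaf_parent_adj l).
by apply: contra lR; apply: cR.
Qed.

Lemma leaf_parentE l p : l \notin R -> adj l p -> leaf_parent l = p.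
Proof.
move=> lR lp; apply: leaf_neighbor_uniq (leaf_parent_adj l) lp.
by apply: contra lR; apply: cR.
Qed.

Let L := enum (~: R).

(** A vertex outside the core is one step farther than its parent: a pair with a core vertex gains
    1, and two distinct outside vertices gain 2, also when they hang at the same vertex. *)
Lemma core_dist_total s : uniq s -> s =i R ->
  \sum_(x : T) \sum_(y : T) gdist x y =
  dist_total (@gdist T) s
  + 2 * (\sum_(l <- L) dist_sum (@gdist T) s (leaf_parent l) + size L * size s)
  + placed_dist (@gdist T) L leaf_parent + 2 * (size L * (size L).-1).
Proof.
move=> us sR.
have sumR (F : T -> nat) : \sum_(x : T) F x = \sum_(x <- s) F x + \sum_(x <- L) F x.
  rewrite (bigID (mem R)) /=; congr (_ + _).
    by rewrite (big_uniq _ us); apply: eq_bigl => x; rewrite sR.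
  by rewrite big_enum; apply: eq_bigl => x; rewrite !inE.
have LR l : l \in L -> l \notin R by rewrite mem_enum inE.
have lr l x : l \in L -> x \in s -> gdist l x = (gdist (leaf_parent l) x).+1.
  move=> /LR lR xs; rewrite leaf_parent_dist //.
  by apply: contraNneq lR => <-; rewrite -sR.
have cross : \sum_(l <- L) \sum_(x <- s) gdist l x =
    \sum_(l <- L) dist_sum (@gdist T) s (leaf_parent l) + size L * size s.
  rewrite -[in RHS]sum1_size big_distrl -big_split /=; apply: eq_big_seq => l lL.
  rewrite mul1n -sum1_size -big_split /=; apply: eq_big_seq => x xs.
  by rewrite lr // addn1.
have leaves : \sum_(l <- L) \sum_(l' <- L) gdist l l' =
    placed_dist (@gdist T) L leaf_parent + 2 * (size L * (size L).-1).
  have -> : 2 * (size L * (size L).-1) = \sum_(l <- L) \sum_(l' <- L) 2 * (l' != l).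
    rewrite mulnCA -[X in X * _]sum1_size big_distrl /=; apply: eq_big_seq => l lL.
    rewrite mul1n -big_distrr /=.
    congr (_ * _); have uL : uniq L by apply: enum_uniq.
    rewrite (perm_size (perm_to_rem lL)) /= (perm_big _ (perm_to_rem lL)) big_cons eqxx.
    rewrite /= add0n -sum1_size; apply: eq_big_seq => l'.
    by rewrite mem_rem_uniq // inE => /andP[->].
  rewrite /placed_dist -big_split /=; apply: eq_big_seq => l lL.
  rewrite -big_split /=; apply: eq_big_seq => l' lL'.
  have [->|ne] := eqVneq l' l; first by rewrite !gdistxx.
  have pl : l' != leaf_parent l.
    by apply: contraNneq (LR _ lL') => ->; apply: leaf_parent_core; apply: LR.
  rewrite leaf_parent_dist ?LR // (gdist_sym Tc) leaf_parent_dist ?LR // 1?eq_sym //.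
  by rewrite (gdist_sym Tc (leaf_parent l')) /= muln1 addn2.
rewrite sumR; under eq_bigr => x _ do rewrite sumR.
under [X in _ + X]eq_bigr => x _ do rewrite sumR.
rewrite !big_split /= leaves cross.
have -> : \sum_(i <- s) \sum_(x <- L) gdist i x = \sum_(l <- L) \sum_(x <- s) gdist l x.
  by rewrite exchange_big /=; do 2 apply: eq_bigr => ? _; rewrite (gdist_sym Tc).
by rewrite cross [2 * (_ + _)]mul2n -addnn !addnA.
Qed.

Lemma core_seq r : r \in R -> exists s,
  [/\ tree_seq (@gdist T) s, uniq s, s =i R & size s = #|R|].
Proof.
move=> rR; have [s [ts us sR]] := rooted_tree_seq Ttree (core_rooted cR rR).
by exists s; split=> //; rewrite -(card_uniqP us); apply: eq_card.
Qed.

Lemma core_total s a c : uniq s -> s =i R -> size L = a + c ->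
  3 * (\sum_(x : T) \sum_(y : T) gdist x y) =
  3 * dist_total (@gdist T) s
  + 6 * (\sum_(l <- L) dist_sum (@gdist T) s (leaf_parent l))
  + 6 * ((a + c) * size s) + 3 * placed_dist (@gdist T) L leaf_parent
  + 6 * ((a + c) * (a + c).-1).
Proof.
move=> us sR <-; rewrite (core_dist_total us sR).
move: (dist_total _ _) (\sum_(_ <- _) _) (placed_dist _ _ _) => A S P.
by move: (size L * size s) (size L * (size L).-1) => B C; lia.
Qed.

Lemma leaf_parent_seq (s : seq T) : s =i R -> {in L, forall l, leaf_parent l \in s}.
Proof. by move=> sR l; rewrite mem_enum inE sR => /leaf_parent_core. Qed.

Definition dumbbell (q : seq T) := [/\ q =i R, uniq q, path_order (@gdist T) q
  & forall x0 l, l \notin R -> leaf_parent l = nth x0 q 0 \/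
                               leaf_parent l = nth x0 q #|R|.-1].

Lemma core_gap s : tree_seq (@gdist T) s -> uniq s -> s =i R -> 2 < #|R| -> #|R| < #|T| ->
  (exists q, dumbbell q) \/
  3 * dist_total (@gdist T) s
  + 6 * (\sum_(l <- L) dist_sum (@gdist T) s (leaf_parent l)) + 7 * size s <=
  size s ^ 3 + 12 + 3 * (size L * (size s * (size s).-1)).
Proof.
move=> ts us sR R2 RT.
have ss : size s = #|R| by rewrite -(card_uniqP us); apply: eq_card.
have L0 : 0 < size L by rewrite -cardE cardsCs setCK subn_gt0.
have s2 : 2 < size s by rewrite ss.
have := dumbbell_gap (@gdistxx T) (gdist_sym Tc) ts (leaf_parent_seq sR) L0 s2.
case=> [[q [pq oq ends]]|]; [left|by right].
exists q; split=> //; first by move=> x; rewrite (perm_mem pq) sR.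
  by rewrite (perm_uniq pq).
by move=> x0 l lR; rewrite -ss; apply: ends; rewrite mem_enum inE.
Qed.

Lemma core_sums_le s : tree_seq (@gdist T) s -> s =i R ->
  3 * dist_total (@gdist T) s + size s <= size s ^ 3 /\
  2 * (\sum_(l <- L) dist_sum (@gdist T) s (leaf_parent l)) <=
  size L * (size s * (size s).-1).
Proof.
move=> ts sR; split; first exact: (dist_total_le (@gdistxx T) (gdist_sym Tc) ts).
rewrite -sum1_size big_distrl big_distrr /= !big_seq; apply: leq_sum => l lL.
rewrite mul1n; apply: (dist_sum_le (@gdistxx T) (gdist_sym Tc) ts).
exact: leaf_parent_seq lL.
Qed.

Lemma core_placed_le s a c : tree_seq (@gdist T) s -> s =i R ->
  size L = a + c -> c <= a <= c.+1 ->
  placed_dist (@gdist T) L leaf_parent <= 2 * ((size s).-1 * (c * a)).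
Proof.
move=> ts sR; apply: (placed_dist_le (@gdistxx T) (gdist_sym Tc) ts).
exact: leaf_parent_seq.
Qed.

(** [v] and its non-leaf neighbours [y1] and [y2] lie on the core path, so [v] is an inner vertex
    and both places beside it are taken. A third neighbour has no place in the core, and outside the
    core it would hang at an inner vertex. *)
Lemma not_dumbbell q v y1 y2 y3 : dumbbell q ->
  adj v y1 -> adj v y2 -> adj v y3 -> y1 != y2 -> y1 != y3 -> y2 != y3 ->
  nonleaf y1 -> nonleaf y2 -> False.
Proof.
move=> [qR uq oq ends] v1 v2 v3 n12 n13 n23 l1 l2.
have vq : v \in q by rewrite qR; apply/cR/nonleafP; exists y1, y2.
have y1q : y1 \in q by rewrite qR; apply: cR.
have y2q : y2 \in q by rewrite qR; apply: cR.
have qs : size q = #|R| by rewrite -(card_uniqP uq); apply: eq_card.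
have near y : y \in q -> adj v y ->
    (index v q - index y q) + (index y q - index v q) = 1.
  move=> yq vy; rewrite -(oq v) ?index_mem // !nth_index //.
  by apply/eqP; rewrite gdist_eq1.
have inj y y' : y \in q -> y' \in q -> y != y' -> index y q != index y' q.
  by move=> yq y'q; apply: contra_neq => E; rewrite -(nth_index v yq) E nth_index.
have e1 := near _ y1q v1; have e2 := near _ y2q v2; have e12 := inj _ _ y1q y2q n12.
have i1 : index y1 q < size q by rewrite index_mem.
have i2 : index y2 q < size q by rewrite index_mem.
have [y3R|y3R] := boolP (y3 \in R).
  have y3q : y3 \in q by rewrite qR.
  have e3 := near _ y3q v3.
  have e13 := inj _ _ y1q y3q n13; have e23 := inj _ _ y2q y3q n23.
  by move: e1 e2 e3 e12 e13 e23; clear; lia.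
have p3 : leaf_parent y3 = v by apply: leaf_parentE; rewrite 1?adj_sym.
have := ends v y3 y3R; rewrite p3 -qs => E.
have iv : index v q = 0 \/ index v q = (size q).-1.
  have q0 : 0 < size q by apply: leq_ltn_trans i1.
  have ix k : k < size q -> v = nth v q k -> index v q = k.
    by move=> lk Ek; have := index_uniq v lk uq; rewrite -Ek.
  by case: E => E; [left|right]; apply: ix => //; rewrite prednK.
by move: e1 e2 e12 i1 i2 iv; clear; lia.
Qed.

End WithCore.

End Core.

(** * Cutting the cycle open *)

Section Delete.

Variables (G : sgraph) (p q : G).

(** The vertex type stays that of [G], so distances before and after the deletion compare on the
    same vertices. *)
Definition delete_adj : rel G := fun x y => adj x y && ([set x; y] != [set p; q]).

Lemma delete_adj_sym : symmetric delete_adj.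
Proof. by move=> x y; rewrite /delete_adj adj_sym setUC. Qed.

Lemma delete_adj_irr : irreflexive delete_adj.
Proof. by move=> x; rewrite /delete_adj adj_irr. Qed.

Definition delete_edge : sgraph := SGraph delete_adj_sym delete_adj_irr.

End Delete.

Lemma set2_eq (T : finType) (a b x y : T) : [set a; b] = [set x; y] ->
  a = x /\ b = y \/ a = y /\ b = x.
Proof.
move=> E; have /set2P xa : x \in [set a; b] by rewrite E set21.
have /set2P ya : y \in [set a; b] by rewrite E set22.
have /set2P ax : a \in [set x; y] by rewrite -E set21.
have /set2P bx : b \in [set x; y] by rewrite -E set22.
case: ax => Ea; case: bx => Eb; [|by left|by right|].
  by left; case: ya => ->; rewrite Ea Eb.
by right; case: xa => ->; rewrite Ea Eb.
Qed.

(** A vertex sequence instead of an edge set, since its starting point selects the edge to be cut;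
    rotating it moves the cut around the cycle. *)
Definition sole_cycle (G : sgraph) (z : seq G) : Prop :=
  [/\ 2 < size z, ucycle (@adj G) z
    & forall p : seq G, 2 < size p -> ucycle (@adj G) p ->
        cycle_edges p = cycle_edges z].

Lemma cycle_edges_rot (G : sgraph) (z : seq G) i : uniq z ->
  cycle_edges (rot i z) = cycle_edges z.
Proof.
move=> uz; apply/setP => E; apply/imsetP/imsetP => -[x xz ->]; exists x.
- by rewrite mem_rot in xz.
- by rewrite next_rot.
- by rewrite mem_rot.
- by rewrite next_rot.
Qed.

Lemma sole_cycle_rot (G : sgraph) (z : seq G) i :
  sole_cycle z -> sole_cycle (rot i z).
Proof.
move=> [sz uz only]; split; rewrite ?size_rot //; first by rewrite rot_ucycle.
by move=> p sp up; rewrite cycle_edges_rot ?only //; case/andP: uz.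
Qed.

(** * Branches at the cycle, and what the closing edge saves between them *)

Section Branch.

Variables (G : sgraph) (z : seq G).

Definition off_cycle : rel G :=
  fun x y => adj x y && ([set x; y] \notin cycle_edges z).

(* For a sole cycle [z], the vertex of [z] at which the tree containing [v]
   hangs. *)
Definition branch v := odflt v [pick x in z | connect off_cycle v x].

Definition branch_size x := #|[set v | branch v == x]|.

End Branch.

Lemma branch_rot (G : sgraph) (z : seq G) i : uniq z -> branch (rot i z) =1 branch z.
Proof.
move=> uz v; rewrite /branch; congr odflt; apply: eq_pick => x /=.
rewrite mem_rot; congr (_ && _); apply: eq_connect => a b.
by rewrite /off_cycle cycle_edges_rot.
Qed.

Lemma branch_size_rot (G : sgraph) (z : seq G) i : uniq z ->
  branch_size (rot i z) =1 branch_size z.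
Proof. by move=> uz x; apply: eq_card => v; rewrite !inE branch_rot. Qed.

Definition base (G : sgraph) (Gc : connected G) : G := xchoose (card_gt0P Gc.1).

Section SoleCycle.

Variables (G : sgraph) (Gc : connected G) (z : seq G).
Hypothesis Hz : sole_cycle z.
Implicit Types (u v w x y : G).

Let sz : 2 < size z. Proof. by case: Hz. Qed.
Let uz : uniq z. Proof. by case: Hz => _ /andP[]. Qed.
Let cz : cycle (@adj G) z. Proof. by case: Hz => _ /andP[]. Qed.

Notation x0 := (base Gc).
Notation zn i := (nth x0 z i).

Lemma cycle_adj i : i.+1 < size z -> adj (zn i) (zn i.+1).
Proof.
case: z cz => // a s /= H; rewrite rcons_path in H; case/andP: H => /pathP H _.
exact: H.
Qed.

Lemma cycle_adj_last : adj (zn (size z).-1) (zn 0).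
Proof.
by case: z cz sz => // a s; rewrite /= rcons_path => /andP[_]; rewrite (last_nth x0).
Qed.

Lemma cycle_edgesP (E : {set G}) :
  reflect (E = [set zn (size z).-1; zn 0] \/
           exists2 i, i.+1 < size z & E = [set zn i; zn i.+1])
          (E \in cycle_edges z).
Proof.
have nz i : i < size z -> next z (zn i) = if i == (size z).-1 then zn 0 else zn i.+1.
  move=> li; rewrite next_nth mem_nth //.
  case: z uz sz li => // a s us _ li; rewrite index_uniq //=.
  case: eqP => [->|ne]; first by rewrite nth_default.
  by apply: set_nth_default; move: li ne => /=; lia.
apply: (iffP imsetP) => [[x xz ->]|].
  have [k lk ->] : exists2 k, k < size z & x = zn k.
    by exists (index x z); rewrite ?index_mem ?nth_index.
  rewrite nz //; case: eqP => [->|ne]; [by left|right; exists k => //].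
  by move: lk ne; clear; lia.
case=> [->|[i li ->]].
  have l : (size z).-1 < size z by move: sz; clear; lia.
  by exists (zn (size z).-1); rewrite ?mem_nth ?nz ?eqxx.
have l : i < size z by apply: ltnW.
exists (zn i); rewrite ?mem_nth // nz //.
by case: eqP => // Ei; move: li; rewrite Ei; move: sz; clear; lia.
Qed.

(* The spanning tree obtained by cutting the cycle open between its last and
   its first vertex. *)
Definition opened : sgraph := delete_edge (zn (size z).-1) (zn 0).

Lemma opened_sub x y : @adj opened x y -> adj x y.
Proof. by case/andP. Qed.

Lemma nth_z_inj i j : i < size z -> j < size z -> zn i = zn j -> i = j.
Proof. by move=> li lj /eqP; rewrite nth_uniq // => /eqP. Qed.

Lemma opened_cycle_adj i : i.+1 < size z -> @adj opened (zn i) (zn i.+1).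
Proof.
move=> li; apply/andP; split; first exact: cycle_adj.
have l : (size z).-1 < size z by move: sz; clear; lia.
have l0 : 0 < size z by move: sz; clear; lia.
apply/eqP => /set2_eq[[/nth_z_inj A /nth_z_inj B]|[/nth_z_inj A /nth_z_inj B]].
  by have := B li l0.
by have := A (ltnW li) l0; have := B li l; move: sz; clear; lia.
Qed.

Lemma opened_connect_cycle i j : i <= j -> j < size z ->
  connect (@adj opened) (zn i) (zn j).
Proof.
move=> ij lj; elim: j ij lj => [|j IH]; first by case: i.
rewrite leq_eqVlt => /predU1P[-> //|ij] lj.
exact: connect_trans (IH ij (ltnW lj)) (connect1 (opened_cycle_adj lj)).
Qed.

Lemma opened_connected : connected opened.
Proof.
split; first by case: Gc.
have S : connect_sym (@adj opened) := sym_connect_sym (@adj_sym opened).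
have C : connect (@adj opened) (zn 0) (zn (size z).-1).
  by apply: opened_connect_cycle => //; move: sz; clear; lia.
move=> x y; case: Gc => _ /(_ x y); apply: connect_sub => {x y} x y xy.
have [E|ne] := eqVneq [set x; y] [set zn (size z).-1; zn 0]; last first.
  by apply: connect1; apply/andP.
by case: (set2_eq E) => -[-> ->] //; rewrite S.
Qed.

(** If an edge were no bridge, a path joining its ends without it would close up to a cycle of
    [opened]. By uniqueness this cycle has the edges of [z], including the deleted one. *)
Lemma opened_tree : tree opened.
Proof.
split=> [|u v uv]; first exact: opened_connected.
pose e' : rel G := fun x y => @adj opened x y && ([set x; y] != [set u; v]).
exists (connect e' u); split; first exact: connect0.
  apply/negP => /connectP[p0 pp0 lp0].
  move: lp0; case/shortenP: pp0 => p pp up _ lp0.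
  have pp' : path (@adj opened) u p by apply: sub_path pp => x y /andP[].
  have cyc : cycle (@adj opened) (u :: p).
    have vu : @adj opened v u by rewrite adj_sym.
    by rewrite /cycle rcons_path -lp0; apply/andP.
  have sp : 2 < size (u :: p).
    case: p pp up lp0 {pp' cyc} => [|a [|b p]] //=.
      by move=> _ _ E; rewrite E adj_irr in uv.
    by move=> /andP[/andP[_ /eqP H] _] _ E; rewrite E in H.
  have [_ _ only] := Hz; have := only (u :: p) sp.
  rewrite /ucycle up andbT (sub_cycle opened_sub cyc) => /(_ isT) E.
  have : [set zn (size z).-1; zn 0] \in cycle_edges z by apply/cycle_edgesP; left.
  rewrite -E => /imsetP[x xp Ex].
  by have /andP[_] := next_cycle cyc xp; rewrite Ex eqxx.
move=> a b ab ua ub; have [E|ne] := eqVneq [set a; b] [set u; v]; last first.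
  by case/negP: ub; apply: connect_trans ua (connect1 _); apply/andP.
case: (set2_eq E) => // -[av bu]; case/negP: ub; rewrite bu; exact: connect0.
Qed.

(** The edge between positions 0 and 1 is a bridge of the opened graph. All positions from 1 on lie
    on its far side, and off-cycle edges never change sides. *)
Lemma off_cycle_first j : 0 < j < size z -> ~~ connect (off_cycle z) (zn 0) (zn j).
Proof.
move=> /andP[j0 lj]; apply/negP => C.
have l1 : 1 < size z by apply: leq_ltn_trans lj.
have [A [A0 A1 cutA]] := opened_tree.2 _ _ (opened_cycle_adj l1).
have offA a b : off_cycle z a b -> A a -> A b.
  move=> /andP[ab nab] Aa; apply/negPn/negP => Ab.
  have ab' : @adj opened a b.
    apply/andP; split=> //; apply: contra nab => /eqP ->.
    by apply/cycle_edgesP; left.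
  have [Ea Eb] := cutA _ _ ab' Aa Ab.
  by case/negP: nab; rewrite Ea Eb; apply/cycle_edgesP; right; exists 0.
have Aj : A (zn j).
  case/connectP: C => p pp ->; elim: p (zn 0) A0 pp => //= a p IH x Ax /andP[xa pp].
  exact: IH (offA _ _ xa Ax) pp.
have down k : 0 < k -> k < size z -> A (zn k) -> False.
  elim: k => // k IH _ lk Ak; have [k0|k0] := posnP k; first by rewrite k0 (negPf A1) in Ak.
  apply: (IH k0 (ltnW lk)); apply/negPn/negP => Ak'.
  have adjk : @adj opened (zn k.+1) (zn k) by rewrite adj_sym opened_cycle_adj.
  have [/nth_z_inj E _] := cutA _ _ adjk Ak Ak'.
  by have := E lk (ltn_trans (ltn0Sn _) lk).
exact: down j0 lj Aj.
Qed.

End SoleCycle.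

Section Branches.

Variables (G : sgraph) (Gc : connected G) (z : seq G).
Hypothesis Hz : sole_cycle z.
Implicit Types (u v w x y : G).

Let sz : 2 < size z. Proof. by case: Hz. Qed.
Let uz : uniq z. Proof. by case: Hz => _ /andP[]. Qed.
Notation x0 := (base Gc).
Notation zn i := (nth x0 z i).
Notation T := (opened Gc z).
Let Tc : connected T := opened_connected Gc Hz.

Lemma off_cycle_sym : connect_sym (off_cycle z).
Proof. by apply: sym_connect_sym => x y; rewrite /off_cycle adj_sym setUC. Qed.

(** Rotating [x] to the front reduces this to [off_cycle_first]. Hence each vertex belongs to
    exactly one branch. *)
Lemma off_cycle_connect_inj x y : x \in z -> y \in z ->
  connect (off_cycle z) x y -> x = y.
Proof.
move=> xz yz C; apply/eqP/negPn/negP => ne.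
pose i := index x z; have li : i < size z by rewrite index_mem.
have Hr := sole_cycle_rot i Hz.
have r0 : nth x0 (rot i z) 0 = x by rewrite /rot nth_cat size_drop subn_gt0 li nth_drop addn0 nth_index.
have yr : y \in rot i z by rewrite mem_rot.
have ly : index y (rot i z) < size (rot i z) by rewrite index_mem.
have y0 : 0 < index y (rot i z).
  by rewrite lt0n; apply: contra ne => /eqP E; rewrite -r0 -E nth_index.
have := @off_cycle_first G Gc _ Hr (index y (rot i z)); rewrite y0 ly r0 nth_index // => /(_ isT).
rewrite (eq_connect (e' := off_cycle z)) ?C // => a b.
by rewrite /off_cycle cycle_edges_rot.
Qed.

Lemma branch_connect v : branch z v \in z /\ connect (off_cycle z) v (branch z v).
Proof.
rewrite /branch; case: pickP => [x /andP[]//|none] /=.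
have z0 : zn 0 \in z by rewrite mem_nth //; apply: ltn_trans sz.
suff [x xz C] : exists2 x, x \in z & connect (off_cycle z) v x.
  by have := none x; rewrite /= xz C.
case/connectP: (Gc.2 (zn 0) v) => p pp Ev; rewrite {v none}Ev.
elim/last_ind: p pp => [|p w IH] /=; first by exists (zn 0); rewrite ?connect0.
rewrite rcons_path last_rcons => /andP[/IH [x xz C] lw].
set l := last _ p in C lw; have [E|off] := boolP ([set l; w] \in cycle_edges z).
  have [a az] := imsetP E; move=> /set2_eq[[_ ->]|[_ ->]].
    by exists (next z a); rewrite ?mem_next ?connect0.
  by exists a; rewrite ?connect0.
exists x => //; apply: connect_trans C; rewrite off_cycle_sym; apply: connect1.
by apply/andP.
Qed.

Lemma branch_mem v : branch z v \in z.
Proof. by case: (branch_connect v). Qed.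

Lemma branchE v x : x \in z -> connect (off_cycle z) v x -> branch z v = x.
Proof.
move=> xz C; have [bz bC] := branch_connect v.
by apply: off_cycle_connect_inj => //; apply: connect_trans C; rewrite off_cycle_sym.
Qed.

Lemma branch_id x : x \in z -> branch z x = x.
Proof. by move=> xz; apply: branchE. Qed.

Lemma branch_off x y : off_cycle z x y -> branch z x = branch z y.
Proof.
move=> xy; have [bz bC] := branch_connect y; apply: branchE => //.
exact: connect_trans (connect1 xy) bC.
Qed.

Definition branch_index v := index (branch z v) z.

Lemma branch_index_lt v : branch_index v < size z.
Proof. by rewrite index_mem branch_mem. Qed.

Lemma branch_index_nth i : i < size z -> branch_index (zn i) = i.
Proof. by move=> li; rewrite /branch_index branch_id ?mem_nth ?index_uniq. Qed.

Lemma opened_branch_index x y : @adj T x y -> branch_index x <> branch_index y ->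
  exists2 i, i.+1 < size z & x = zn i /\ y = zn i.+1 \/ x = zn i.+1 /\ y = zn i.
Proof.
case/andP=> xy nxy ne; have [E|off] := boolP ([set x; y] \in cycle_edges z); last first.
  by case: ne; rewrite /branch_index (branch_off (_ : off_cycle z x y)) //; apply/andP.
case/(cycle_edgesP Gc Hz): E => [E|[i li E]]; first by rewrite E eqxx in nxy.
by exists i => //; case: (set2_eq E); [left|right].
Qed.

(** Every edge of the opened cycle between the two branches is a bridge of [T], so [gdist_cut]
    applies to each of them in turn. *)
Lemma opened_dist u v : branch_index u < branch_index v ->
  gdist (u : T) v = gdist (u : T) (branch z u) + (branch_index v - branch_index u)
                    + gdist (branch z v : T) v.
Proof.
have cut k a b w w' : k.+1 < size z -> a = zn k -> b = zn k.+1 ->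
    branch_index w <= k -> k < branch_index w' ->
    gdist (w : T) w' = (gdist (w : T) a + gdist (b : T) w').+1.
  move=> lk -> -> wk kw'.
  apply: (gdist_cut Tc (A := [pred y | branch_index y <= k])) => //=.
  - exact: opened_cycle_adj.
  - move=> c e ce ck; rewrite -ltnNge => ke.
    have [|i li [[Ec Ee]|[Ec Ee]]] := opened_branch_index ce.
    + by move=> E; move: ck; rewrite E leqNgt ke.
    + move: ck ke; rewrite Ec Ee (branch_index_nth li) (branch_index_nth (ltnW li)).
      by rewrite ltnS => ik ki; have -> : i = k by apply/eqP; rewrite eqn_leq ik ki.
    + move: ck ke; rewrite Ec Ee (branch_index_nth li) (branch_index_nth (ltnW li)).
      by move=> ik ki; have := leq_trans ik (ltnW ki); rewrite ltnn.
  - by rewrite -ltnNge.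
have zb w : zn (branch_index w) = branch z w by rewrite nth_index ?branch_mem.
have lv := branch_index_lt v.
move Ek : (branch_index v - branch_index u) => k.
elim: k u Ek => [|k IH] u Ek uv; first by move: Ek uv; lia.
have lu : (branch_index u).+1 < size z by apply: leq_ltn_trans lv.
have iu : branch_index (zn (branch_index u).+1) = (branch_index u).+1.
  by rewrite branch_index_nth.
rewrite (cut _ (branch z u) (zn (branch_index u).+1) _ _ lu (esym (zb u))) //.
move: uv; rewrite leq_eqVlt => /predU1P[E|uv].
  have -> : k = 0 by move: Ek E; lia.
  by rewrite E zb addn1 addSn.
have Ek' : branch_index v - branch_index (zn (branch_index u).+1) = k by rewrite iu subnS Ek.
rewrite (IH _ Ek') ?iu // (branch_id (mem_nth x0 lu)) gdistxx add0n.
by rewrite !addnS addnA.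
Qed.

Lemma opened_dist_first i : i < size z -> gdist (zn 0 : T) (zn i) = i.
Proof.
move=> li; have l0 := ltn_trans (ltn0Sn 1) sz.
case: i li => [|i] li; first by rewrite gdistxx.
rewrite opened_dist ?branch_index_nth ?branch_id ?mem_nth ?gdistxx //; lia.
Qed.

Lemma opened_dist_last i : i < size z ->
  gdist (zn i : T) (zn (size z).-1) = (size z).-1 - i.
Proof.
move=> li; have ll : (size z).-1 < size z by move: sz; clear; lia.
have [E|ne] := eqVneq i (size z).-1; first by rewrite E gdistxx subnn.
rewrite opened_dist ?branch_index_nth ?branch_id ?mem_nth ?gdistxx //;
  move: li ll ne; clear; lia.
Qed.

Lemma gdist_le_opened x y : gdist (x : G) y <= gdist (x : T) y.
Proof.
have [p [<- pp <-]] := gdist_shortest (Tc.2 x y).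
by apply: gdist_le_walk; apply: sub_path pp => a b /andP[].
Qed.

(** The walk from [u] to the cycle, back to the first cycle vertex, over the closing edge to the
    last one and on to [v] replaces d = [branch_index v - branch_index u] steps along the cycle by
    [size z] - d. *)
Lemma gdist_shortcut u v : branch_index u < branch_index v ->
  gdist u v + 2 * (branch_index v - branch_index u) <= gdist (u : T) v + size z.
Proof.
move=> uv; rewrite (opened_dist uv).
have zb w : zn (branch_index w) = branch z w by rewrite nth_index ?branch_mem.
have lu := branch_index_lt u; have lv := branch_index_lt v.
have l0 : 0 < size z by apply: leq_ltn_trans lu.
have uz0 := gdist_triangle Gc (branch z u) u (zn 0).
have zlv := gdist_triangle Gc (branch z v) (zn (size z).-1) v.
have u0v := gdist_triangle Gc (zn 0) u v.
have l0v := gdist_triangle Gc (zn (size z).-1) (zn 0) v.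
have le1 := gdist_le_opened u (branch z u).
have le2 := gdist_le_opened (branch z v) v.
have le3 := gdist_le_opened (zn 0) (branch z u).
have le4 := gdist_le_opened (branch z v) (zn (size z).-1).
have E3 : gdist (zn 0 : T) (branch z u) = branch_index u by rewrite -zb opened_dist_first.
have E4 : gdist (branch z v : T) (zn (size z).-1) = (size z).-1 - branch_index v.
  by rewrite -zb opened_dist_last.
have E5 : gdist (zn 0) (zn (size z).-1) = 1.
  by apply/eqP; rewrite gdist_eq1 // adj_sym cycle_adj_last.
rewrite (gdist_sym Gc (zn 0)) in le3; rewrite (gdist_sym Gc (branch z v)) in le4.
lia.
Qed.

(* What the closing edge saves on a path between the branches numbered [i] and
   [j]; truncated subtraction gives [0] when it does not help. *)
Definition shortcut i j := 2 * (i - j + (j - i)) - size z.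

Lemma Wiener_shortcut :
  \sum_(u : G) \sum_(v : G) gdist u v +
  \sum_(u : G) \sum_(v : G) shortcut (branch_index u) (branch_index v) <=
  \sum_(u : T) \sum_(v : T) gdist u v.
Proof.
rewrite -big_split /=; apply: leq_sum => u _; rewrite -big_split /=; apply: leq_sum => v _.
rewrite /shortcut; case: (ltngtP (branch_index u) (branch_index v)) => uv.
- have := gdist_shortcut uv; have := gdist_le_opened u v; lia.
- have := gdist_shortcut uv; have := gdist_le_opened u v.
  by rewrite (gdist_sym Tc u) (gdist_sym Gc u); lia.
- by rewrite uv subnn addn0 muln0 addn0 gdist_le_opened.
Qed.

Lemma sum_branch_pair i j : i < size z -> j < size z ->
  \sum_(u : G) \sum_(v : G) ((branch_index u == i) && (branch_index v == j)) =
  branch_size z (zn i) * branch_size z (zn j).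
Proof.
have E k : k < size z -> \sum_(v : G) (branch_index v == k) = branch_size z (zn k).
  move=> lk; rewrite /branch_size -sum1_card [RHS]big_mkcond /=; apply: eq_bigr => v _.
  rewrite inE; congr (nat_of_bool _); apply/eqP/eqP => [<-|bv].
    by rewrite nth_index ?branch_mem.
  by rewrite /branch_index bv index_uniq.
move=> li lj; rewrite -(E i li) -(E j lj) big_distrl /=; apply: eq_bigr => u _.
by rewrite big_distrr /=; apply: eq_bigr => v _; case: eqP; rewrite ?mul1n.
Qed.

Lemma sum_branch_size : \sum_(x <- z) branch_size z x = #|G|.
Proof.
rewrite -sum1_card [RHS](partition_big (branch z) (mem z)) => [|v _]; last exact: branch_mem.
rewrite (big_uniq _ uz); apply: eq_bigr => x _; rewrite /branch_size -sum1_card.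
by apply: eq_bigl => v; rewrite !inE.
Qed.

Lemma branch_size_gt0 x : x \in z -> 0 < branch_size z x.
Proof. by move=> xz; apply/card_gt0P; exists x; rewrite inE branch_id. Qed.

Lemma branch_neighbor x : x \in z -> 1 < branch_size z x ->
  exists2 y, adj x y & y \notin z.
Proof.
move=> xz; rewrite /branch_size (cardsD1 x) inE branch_id // eqxx ltnS.
case/card_gt0P => v; rewrite !inE => /andP[vx /eqP bv].
have [_] := branch_connect v; rewrite bv off_cycle_sym => /connectP[p pp lp].
case: p pp lp => [|y p] /=; first by move=> _ E; rewrite E eqxx in vx.
case/andP=> xy pp lp; exists y; first by case/andP: xy.
apply/negP => yz; have := branch_off xy; rewrite !branch_id // => E.
by move: xy; rewrite /off_cycle E adj_irr.
Qed.

Lemma branch_size1 x y : x \in z -> branch_size z x = 1 -> adj x y -> y \in z.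
Proof.
move=> xz b1 xy; apply/negPn/negP => yz.
have off : off_cycle z x y.
  apply/andP; split=> //; apply: contra yz => /imsetP[a az].
  by case/set2_eq => -[_ ->]; rewrite ?mem_next.
have : [set x; y] \subset [set v | branch z v == x].
  by apply/subsetP => v /set2P[->|->]; rewrite inE -?(branch_off off) branch_id.
move/subset_leq_card; rewrite cards2 -/(branch_size z x) b1.
by case: eqP => // E; rewrite E adj_irr in xy.
Qed.

End Branches.

Lemma nth_rot (T : Type) (x0 : T) (s : seq T) i k : i < size s -> k < size s ->
  nth x0 (rot i s) k = nth x0 s ((i + k) %% size s).
Proof.
move=> li lk; rewrite /rot nth_cat size_drop nth_drop.
case: ltnP => h; first by rewrite modn_small //; move: h; clear; lia.
have -> : i + k = k - (size s - i) + size s by move: h li; clear; lia.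
rewrite modnDr modn_small; last by move: h lk li; clear; lia.
by rewrite nth_take //; move: h lk li; clear; lia.
Qed.

(** Positions at distance [g - 1] save 2(g - 1) - g = g - 2, those at distance [g - 2] save g - 4,
    truncated to 0 for g <= 4; every pair is listed in both orders. *)
Lemma shortcut_ge g i j : 2 < g -> i < g -> j < g ->
  (g - 2) * ((i == 0) && (j == g.-1)) + (g - 2) * ((i == g.-1) && (j == 0)) +
  (g - 4) * ((i == 0) && (j == g.-2)) + (g - 4) * ((i == g.-2) && (j == 0)) +
  (g - 4) * ((i == 1) && (j == g.-1)) + (g - 4) * ((i == g.-1) && (j == 1))
  <= 2 * (i - j + (j - i)) - g.
Proof.
move=> g2 ig jg.
do 6! (case: (boolP (_ && _)) => [/andP[/eqP ? /eqP ?]|_]); rewrite ?muln1 ?muln0; lia.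
Qed.

(** * The estimates supplied by a single cut *)

Section Bound.

Variables (G : sgraph) (Gc : connected G) (m : nat).
Hypotheses (m1 : 1 < m) (mG : matching_number G <= m) (mn : 2 * m <= #|G|).
Implicit Types (z : seq G) (u v w x y : G).

Notation t := (2 * m).-1.
Notation k := (#|G| - t).
Notation c := (k./2).
Notation a := (k - k./2).
Notation x0 := (base Gc).
Notation w z i := (branch_size z (nth x0 z i)).

Let card2 : 2 < #|G|. Proof. by move: m1 mn; clear; lia. Qed.
Let ac : k = a + c. Proof. by clear; lia. Qed.
Let ca : c <= a <= c.+1. Proof. by clear; lia. Qed.

(* The value of [loss] at the extremal graphs: the triangle wins in the first
   case, the square in the second. *)
Definition defect := if k <= 3 then #|G| - 2 else 2 * (t - 2) + 2 * c.

(** 2n - 6 = 2(n - 3) is the least product of two branch sizes at least 2 with sum n - 1, the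
    smallest loss when a triangle with two nontrivial branches is cut between them. *)
Lemma defect_small : 4 < #|G| -> defect < 2 * #|G| - 6.
Proof. by move=> n4; rewrite /defect; case: (leqP k 3); move: n4 m1 mn; clear; lia. Qed.

Section OneCycle.

Variable z : seq G.
Hypothesis Hz : sole_cycle z.
Let sz : 2 < size z. Proof. by case: Hz. Qed.
Let uz : uniq z. Proof. by case: Hz => _ /andP[]. Qed.
Notation T := (opened Gc z).
Notation zn i := (nth x0 z i).

(* Only the pairs of branches at distance [size z - 1] or [size z - 2] along the
   opened cycle are counted. *)
Definition loss := (size z - 2) * (w z 0 * w z (size z).-1) +
  (size z - 4) * (w z 0 * w z (size z).-2 + w z 1 * w z (size z).-1).

Lemma loss_le : 6 * Wiener G + 6 * loss <=
  3 * (\sum_(x : T) \sum_(y : T) gdist x y).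
Proof.
have -> : 6 * Wiener G = 3 * (\sum_(x : G) \sum_(y : G) gdist x y).
  by rewrite -Wiener_double // mulnA.
have := Wiener_shortcut Gc Hz.
suff : 2 * loss <= \sum_(u : G) \sum_(v : G)
    shortcut z (branch_index z u) (branch_index z v).
  move: loss (\sum_(u : G) \sum_(v : G) gdist u v) => l A.
  by move: (\sum_(u : G) _) (\sum_(u : T) _) => B C; clear; lia.
have l0 : 0 < size z by move: sz; clear; lia.
have l1 : 1 < size z by move: sz; clear; lia.
have lg : (size z).-1 < size z by move: sz; clear; lia.
have lh : (size z).-2 < size z by move: sz; clear; lia.
pose ind (i j : nat) (u v : G) := nat_of_bool ((branch_index z u == i) && (branch_index z v == j)).
have sumi i j : i < size z -> j < size z ->
    \sum_(u : G) \sum_(v : G) ind i j u v = w z i * w z j := @sum_branch_pair _ Gc _ Hz i j.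
have -> : 2 * loss = \sum_(u : G) \sum_(v : G)
   ((size z - 2) * ind 0 (size z).-1 u v + (size z - 2) * ind (size z).-1 0 u v +
    (size z - 4) * ind 0 (size z).-2 u v + (size z - 4) * ind (size z).-2 0 u v +
    (size z - 4) * ind 1 (size z).-1 u v + (size z - 4) * ind (size z).-1 1 u v).
  under eq_bigr => u _ do rewrite !big_split /= -!big_distrr /=.
  rewrite !big_split /= -!big_distrr /= !sumi // /loss.
  rewrite [w z (size z).-1 * w z 0]mulnC [w z (size z).-2 * w z 0]mulnC.
  rewrite [w z (size z).-1 * w z 1]mulnC.
  move: (w z 0 * _) (w z 0 * _) (w z 1 * _) (size z - 2) (size z - 4).
  by clear=> A B C D E; rewrite (mulnDr E); lia.
apply: leq_sum => u _; apply: leq_sum => v _.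
exact: shortcut_ge (branch_index_lt Gc Hz u) (branch_index_lt Gc Hz v).
Qed.

Let Ttree : tree T. Proof. exact: opened_tree. Qed.
Let T2 : 2 < #|T|. Proof. exact: card2. Qed.
Let mnT : 2 * m <= #|T|. Proof. exact: mn. Qed.

Lemma opened_matching : matching_number T <= m.
Proof.
apply: leq_trans mG; apply/bigmax_leqP => M /andP[/subsetP sM tM].
apply: (@leq_bigmax_cond _ (@matching G) (fun M : {set {set G}} => #|M|) M).
apply/andP; split=> //; apply/subsetP => E /sM/edgesP[u [v [uv ->]]].
by rewrite set2_edge; case/andP: uv.
Qed.

Lemma opened_core (l : T) : ~~ nonleaf l -> exists R, [/\ core R, #|R| = t & l \notin R].
Proof. by apply: core_exists => //; [exact: opened_matching | apply: ltnW]. Qed.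

Lemma core_leaves (R : {set T}) : #|R| = t -> size (enum (~: R)) = a + c.
Proof. by move=> Rt; rewrite -cardE cardsCs setCK Rt -ac. Qed.

Lemma core_bound (R : {set T}) : core R -> #|R| = t ->
  3 * (\sum_(x : T) \sum_(y : T) gdist x y) <= tree_bound t c a.
Proof.
move=> cR Rt; have [r rR] : exists r, r \in R.
  by apply/card_gt0P; rewrite Rt; move: m1; clear; lia.
have [s [ts us sR ss]] := core_seq Ttree cR rR.
have sL := core_leaves Rt.
have := core_total Ttree T2 cR us sR sL.
have [H1 H2] := core_sums_le Ttree T2 cR ts sR.
have := core_placed_le Ttree T2 cR ts sR sL ca.
move: H1 H2; rewrite sL ss Rt /tree_bound.
move: (dist_total _ _) (\sum_(l <- _) _) (placed_dist _ _ _) (\sum_(x : T) _).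
move=> A B C D; clear.
move: ((a + c) * (t * t.-1)) ((a + c) * t) (t.-1 * (c * a)) ((a + c) * (a + c).-1) (t ^ 3).
by move=> E F H I J; clear; lia.
Qed.

Lemma core_bound_gap (R : {set T}) : core R -> #|R| = t ->
  (exists q, dumbbell R q) \/
  3 * (\sum_(x : T) \sum_(y : T) gdist x y) + 6 * (t - 2) <= tree_bound t c a.
Proof.
move=> cR Rt; have [r rR] : exists r, r \in R.
  by apply/card_gt0P; rewrite Rt; move: m1; clear; lia.
have [s [ts us sR ss]] := core_seq Ttree cR rR.
have sL := core_leaves Rt.
have [||H|gap] := core_gap Ttree T2 cR ts us sR; first by rewrite Rt; move: m1; clear; lia.
- by rewrite Rt; move: m1 mnT; clear; lia.
- by left.
right; have := core_total Ttree T2 cR us sR sL.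
have := core_placed_le Ttree T2 cR ts sR sL ca.
move: gap; rewrite sL ss Rt /tree_bound.
have : t <= t ^ 3 by rewrite !expnS expn0; move: m1; clear; nia.
move: (dist_total _ _) (\sum_(l <- _) _) (placed_dist _ _ _) (\sum_(x : T) _).
move=> A B C D.
move: ((a + c) * (t * t.-1)) ((a + c) * t) (t.-1 * (c * a)) ((a + c) * (a + c).-1) (t ^ 3).
by move=> E F H I J; move: m1; clear; lia.
Qed.

Lemma opened_core_exists : exists R : {set T}, core R /\ #|R| = t.
Proof.
by have [l nl] := leaf_exists Ttree; have [R []] := opened_core nl; exists R.
Qed.

Lemma opened_bound : 3 * (\sum_(x : T) \sum_(y : T) gdist x y) <= tree_bound t c a.
Proof. by have [R [cR Rt]] := opened_core_exists; apply: core_bound Rt. Qed.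

Lemma opened_adj_off x y : adj x y -> y \notin z -> @adj T x y.
Proof.
move=> xy yz; apply/andP; split=> //; apply: contra yz.
have l0 : 0 < size z by apply: ltnW (ltnW sz).
have lg : (size z).-1 < size z by rewrite prednK.
by case/eqP/set2_eq => -[_ ->]; apply: mem_nth.
Qed.

Lemma nth_neq i j : i < size z -> j < size z -> i != j -> zn i != zn j.
Proof. by move=> li lj; rewrite nth_uniq. Qed.

Lemma opened_nonleaf j : j < size z -> (0 < j < (size z).-1) || (1 < w z j) ->
  nonleaf (zn j : T).
Proof.
move=> lj /orP[/andP[j0 jg]|wj]; apply/nonleafP.
  have lj1 : j.+1 < size z by move: jg; clear; lia.
  have lt_pred : j.-1 < size z by apply: leq_ltn_trans (leq_pred j) lj.
  have pred_ne : j.-1 != j.+1 by move: j0; clear; lia.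
  exists (zn j.-1 : T), (zn j.+1 : T); split.
  - exact: nth_neq lt_pred lj1 pred_ne.
  - by rewrite adj_sym -{2}(prednK j0); apply: opened_cycle_adj; rewrite // prednK.
  - exact: opened_cycle_adj.
have [y zy yz] := branch_neighbor Gc Hz (mem_nth x0 lj) wj.
have ne i : i < size z -> zn i != y.
  by move=> li; apply: contraNneq yz => <-; rewrite mem_nth.
have [lj1|lj1] := boolP (j.+1 < size z).
  exists (zn j.+1 : T), (y : T); split; [exact: ne| |exact: opened_adj_off].
  exact: opened_cycle_adj.
have j0 : 0 < j by move: lj1 sz; clear; lia.
have ljp : j.-1 < size z by move: lj; clear; lia.
exists (zn j.-1 : T), (y : T); split; [exact: ne| |exact: opened_adj_off].
by rewrite adj_sym -{2}(prednK j0); apply: opened_cycle_adj; rewrite // prednK.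
Qed.

(** The cycle vertex at [j] has a neighbour in its branch and two on the opened cycle, both of them
    non-leaves by the last two conditions. Then [not_dumbbell] leaves only the gap. *)
Lemma opened_gap j : 0 < j < (size z).-1 -> 1 < w z j ->
  (1 < j) || (1 < w z j.-1) -> (j.+1 < (size z).-1) || (1 < w z j.+1) ->
  3 * (\sum_(x : T) \sum_(y : T) gdist x y) + 6 * (t - 2) <= tree_bound t c a.
Proof.
move=> /andP[j0 jg] wj wp wn; have [R [cR Rt]] := opened_core_exists.
have [[q qd]|//] := core_bound_gap cR Rt.
have lj1 : j.+1 < size z by move: jg; clear; lia.
have lj : j < size z by apply: ltnW.
have ljp : j.-1 < size z by move: lj; clear; lia.
have [y zy yz] := branch_neighbor Gc Hz (mem_nth x0 lj) wj.
have ne i : i < size z -> zn i != y.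
  by move=> li; apply: contraNneq yz => <-; rewrite mem_nth.
case: (not_dumbbell Ttree T2 cR (v := zn j) (y1 := zn j.-1) (y2 := zn j.+1) (y3 := y) qd).
- by rewrite adj_sym -{2}(prednK j0); apply: opened_cycle_adj; rewrite // prednK.
- exact: opened_cycle_adj.
- exact: opened_adj_off.
- by apply: nth_neq => //; move: j0; clear; lia.
- exact: ne.
- exact: ne.
- apply: opened_nonleaf => //; case/orP: wp => [j1|->]; last by rewrite orbT.
  by apply/orP; left; move: j1 jg; clear; lia.
- exact: opened_nonleaf.
Qed.

End OneCycle.

End Bound.

(** * Long cycles and spread branches *)

(** Since p + r <= pr + 1 for positive numbers, a bound on products of branch sizes yields one on
    their sums. Only the latter is linear and can be averaged over the rotations. *)
Lemma loss_sum_arith g n p q r s e : 4 < g -> 0 < p -> 0 < q -> 0 < r -> 0 < s ->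
  e < 2 * n - 6 -> (g - 2) * (p * r) + (g - 4) * (p * s + q * r) <= e ->
  (g - 2) * (p + r) + (g - 4) * (p + s + (q + r)) <= 2 * n - 7 + (g - 2) + 2 * (g - 4).
Proof.
move=> g4 p0 q0 r0 s0 en le.
have e1 : p + r <= p * r + 1 by nia.
have e2 : p + s + (q + r) <= p * s + q * r + 2 by nia.
have h1 : (g - 2) * (p + r) <= (g - 2) * (p * r) + (g - 2).
  by have := leq_mul (leqnn (g - 2)) e1; rewrite [X in _ <= X]mulnDr muln1.
have h2 : (g - 4) * (p + s + (q + r)) <= (g - 4) * (p * s + q * r) + 2 * (g - 4).
  by have := leq_mul (leqnn (g - 4)) e2; rewrite [X in _ <= X]mulnDr (mulnC _ 2).
by move: h1 h2 le en; clear; lia.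
Qed.

(** On the left stands g times the bound of [loss_sum_arith], on the right the total over all
    rotations, where each position collects n. *)
Lemma loss_average_arith g n : 4 < g <= n ->
  g * (2 * n - 7 + (g - 2) + 2 * (g - 4)) < (g - 2) * (n + n) + (g - 4) * (n + n + (n + n)).
Proof.
case/andP=> g4 gn; have [i Eg] : exists i, g = i + 5 by exists (g - 5); lia.
have [j ->] : exists j, n = i + 5 + j by exists (n - (i + 5)); lia.
rewrite {}Eg in g4 gn *.
have -> : 2 * (i + 5 + j) - 7 + (i + 5 - 2) + 2 * (i + 5 - 4) = 5 * i + 2 * j + 8 by lia.
have -> : i + 5 - 2 = i + 3 by lia.
have -> : i + 5 - 4 = i + 1 by lia.
nia.
Qed.

Section Strict.

Variables (G : sgraph) (Gc : connected G) (m : nat).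
Hypotheses (m1 : 1 < m) (mG : matching_number G <= m) (mn : 2 * m <= #|G|).
Implicit Types (z : seq G).

Notation t := (2 * m).-1.
Notation k := (#|G| - t).
Notation c := (k./2).
Notation a := (k - k./2).
Notation x0 := (base Gc).
Notation w z i := (branch_size z (nth x0 z i)).
Notation B := (tree_bound t c a).
Notation strict := (6 * Wiener G + 6 * defect G m < B).

Lemma sole_cycle_uniq z : sole_cycle z -> uniq z.
Proof. by case=> _ /andP[]. Qed.

Lemma w_rot z r i : sole_cycle z -> r < size z -> i < size z ->
  w (rot r z) i = w z ((r + i) %% size z).
Proof.
by move=> Hz lr li; rewrite branch_size_rot ?nth_rot //; apply: sole_cycle_uniq.
Qed.

Lemma strict_of_loss z : sole_cycle z -> defect G m < loss Gc z -> strict.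
Proof.
move=> Hz; have := loss_le Gc Hz; have := opened_bound Gc m1 mG mn Hz.
move: (\sum_(x : opened Gc z) _) => A; move: (tree_bound _ _ _) (defect _ _) (loss _ _).
by clear; lia.
Qed.

(** The gap contributes [t - 2] towards exceeding [defect], so a loss of n - 1 is enough. Since t >=
    3, n <= 6 forces k <= 3, and then n - 2 is enough; a triangle with three branches of size 2 has
    just this loss. *)
Lemma strict_of_gap z : sole_cycle z ->
  3 * (\sum_(x : opened Gc z) \sum_(y : opened Gc z) gdist x y) + 6 * (t - 2) <= B ->
  #|G| <= loss Gc z + (#|G| <= 6) + 1 -> strict.
Proof.
move=> Hz; have := loss_le Gc Hz.
move: (\sum_(x : opened Gc z) _) => A; rewrite /defect.
case: (leqP k 3); move: m1 mn; move: (tree_bound _ _ _) (loss _ _); clear; lia.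
Qed.

Lemma sum_w_rot z i : sole_cycle z -> i < size z ->
  \sum_(r < size z) w (rot r z) i = #|G|.
Proof.
move=> Hz li; have uz := sole_cycle_uniq Hz.
rewrite -(sum_branch_size Gc Hz) -(perm_big _ (permEl (perm_rot i z))) /=.
rewrite [RHS](big_nth x0) big_mkord size_rot; apply: eq_bigr => r _.
by rewrite branch_size_rot // !nth_rot // addnC.
Qed.

(** If the strict inequality failed, the loss would be at most [defect] for every rotation at once,
    and summing over the rotations gives a contradiction. *)
Lemma strict_long z : sole_cycle z -> 4 < size z -> strict.
Proof.
move=> Hz g4; rewrite ltnNge; apply/negP => Ble.
have n4 : 4 < #|G|.
  by apply: leq_trans g4 _; rewrite -(card_uniqP (sole_cycle_uniq Hz)) max_card.
have gn : size z <= #|G|.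
  by rewrite -(card_uniqP (sole_cycle_uniq Hz)) max_card.
have dle := defect_small m1 mn n4.
have lle (r : 'I_(size z)) : (size z - 2) * (w (rot r z) 0 + w (rot r z) (size z).-1)
    + (size z - 4) * (w (rot r z) 0 + w (rot r z) (size z).-2
                      + (w (rot r z) 1 + w (rot r z) (size z).-1)) <=
    2 * #|G| - 7 + (size z - 2) + 2 * (size z - 4).
  have Hr := sole_cycle_rot r Hz.
  have : loss Gc (rot r z) <= defect G m.
    have := loss_le Gc Hr; have := opened_bound Gc m1 mG mn Hr; move: Ble.
    move: (\sum_(x : opened Gc _) _) (tree_bound _ _ _) (defect _ _) (loss _ _).
    by clear; lia.
  have pos i : i < size z -> 0 < w (rot r z) i.
    by move=> li; apply: (branch_size_gt0 Gc Hr); rewrite mem_nth ?size_rot.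
  have p0 := pos 0; have p1 := pos 1; have p2 := pos (size z).-1; have p3 := pos (size z).-2.
  rewrite /loss size_rot; apply: loss_sum_arith dle => //.
  - by apply: p0; move: g4; clear; lia.
  - by apply: p1; move: g4; clear; lia.
  - by apply: p2; move: g4; clear; lia.
  - by apply: p3; move: g4; clear; lia.
have : \sum_(r < size z) ((size z - 2) * (w (rot r z) 0 + w (rot r z) (size z).-1)
    + (size z - 4) * (w (rot r z) 0 + w (rot r z) (size z).-2
                      + (w (rot r z) 1 + w (rot r z) (size z).-1))) <=
    \sum_(r < size z) (2 * #|G| - 7 + (size z - 2) + 2 * (size z - 4)).
  by apply: leq_sum => r _; apply: lle.
rewrite sum_nat_const card_ord big_split /= -!big_distrr /= !big_split /=.
rewrite !sum_w_rot //; try (by move: g4; clear; lia).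
by rewrite leqNgt loss_average_arith ?g4 ?gn.
Qed.

(** With exactly two nontrivial branches, the cut between them loses enough. With three, every
    rotation has a branch in the middle of the opened cycle, hence a gap, and one of the three
    products of sizes is large enough to go with it. *)
Lemma strict_triangle z : sole_cycle z -> size z = 3 ->
  strict \/ exists2 r, r < size z & w (rot r z) 1 = 1 /\ w (rot r z) 2 = 1.
Proof.
move=> Hz s3.
have H i : i < 3 -> sole_cycle (rot i z) by move=> _; apply: sole_cycle_rot.
have L i : i < 3 -> loss Gc (rot i z) = w z i * w z ((i + 2) %% 3).
  move=> li; rewrite /loss !size_rot s3 /= mul0n addn0 mul1n !w_rot ?s3 //.
  by rewrite addn0 modn_small.
have pos i : i < 3 -> 0 < w z i.
  by move=> li; apply: (branch_size_gt0 Gc Hz); rewrite mem_nth ?s3.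
have sumw : w z 0 + w z 1 + w z 2 = #|G|.
  by rewrite -(sum_branch_size Gc Hz) (big_nth x0) s3 big_mkord !big_ord_recr big_ord0.
have L0 : loss Gc (rot 0 z) = w z 0 * w z 2 := L 0 isT.
have L1 : loss Gc (rot 1 z) = w z 1 * w z 0 := L 1 isT.
have L2 : loss Gc (rot 2 z) = w z 2 * w z 1 := L 2 isT.
have p0 := pos 0 isT; have p1 := pos 1 isT; have p2 := pos 2 isT.
have two i j l : i < 3 -> loss Gc (rot i z) = w z i * w z j ->
    w z i + w z j + w z l = #|G| -> 1 < w z i -> 1 < w z j -> w z l = 1 -> strict.
  move=> li Li sw wi wj wl; apply: (strict_of_loss (H i li)); rewrite Li.
  rewrite wl in sw; have n4 : 4 < #|G| by move: sw wi wj; clear; lia.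
  apply: leq_trans (defect_small m1 mn n4) _; rewrite -sw.
  by move: (w z i) (w z j) wi wj; clear=> p q; nia.
have three : 1 < w z 0 -> 1 < w z 1 -> 1 < w z 2 -> strict.
  move=> w0 w1 w2.
  have gap i : i < 3 -> #|G| <= loss Gc (rot i z) + (#|G| <= 6) + 1 -> strict.
    move=> li; have wi j : j < 3 -> 1 < w (rot i z) j.
      by move=> lj; rewrite w_rot ?s3 //; case: ((i + j) %% 3) (ltn_pmod (i + j) (isT : 0 < 3)) => [|[|[|]]].
    apply: (strict_of_gap (H i li)); apply: (opened_gap m1 mG mn (H i li) (j := 1)).
    - by rewrite size_rot s3.
    - exact: wi.
    - by rewrite wi ?orbT.
    - by rewrite wi ?orbT.
  have [g0|g0] := leqP #|G| (loss Gc (rot 0 z) + (#|G| <= 6) + 1); first exact: gap g0.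
  have [g1|g1] := leqP #|G| (loss Gc (rot 1 z) + (#|G| <= 6) + 1); first exact: gap g1.
  have [g2|g2] := leqP #|G| (loss Gc (rot 2 z) + (#|G| <= 6) + 1); first exact: gap g2.
  exfalso; move: g0 g1 g2; rewrite L0 L1 L2 -sumw; move: w0 w1 w2.
  by move: (w z 0) (w z 1) (w z 2); clear=> p q r; case: leqP; nia.
have R i : i < 3 -> w z ((i + 1) %% 3) = 1 -> w z ((i + 2) %% 3) = 1 ->
    strict \/ exists2 r, r < size z & w (rot r z) 1 = 1 /\ w (rot r z) 2 = 1.
  by move=> li e1 e2; right; exists i; rewrite ?s3 // !w_rot ?s3.
have [a0|a0] := leqP (w z 0) 1; have [a1|a1] := leqP (w z 1) 1; have [a2|a2] := leqP (w z 2) 1.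
- by apply: (R 0) => //=; apply/eqP; rewrite eqn_leq ?a1 ?a2.
- by apply: (R 2) => //=; apply/eqP; rewrite eqn_leq ?a0 ?a1.
- by apply: (R 1) => //=; apply/eqP; rewrite eqn_leq ?a0 ?a2.
- by left; apply: (two 2 1 0) => //; [move: sumw; clear; lia|apply/eqP; rewrite eqn_leq a0].
- by apply: (R 0) => //=; apply/eqP; rewrite eqn_leq ?a1 ?a2.
- by left; apply: (two 0 2 1) => //; [move: sumw; clear; lia|apply/eqP; rewrite eqn_leq a1].
- by left; apply: (two 1 0 2) => //; [move: sumw; clear; lia|apply/eqP; rewrite eqn_leq a2].
- by left; apply: three.
Qed.

(** Two adjacent nontrivial branches give the strict inequality. Otherwise nontrivial branches sit
    at most at two opposite corners, and the rotation puts the larger one at position 0. *)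
Lemma strict_square z : sole_cycle z -> size z = 4 ->
  strict \/ exists2 r, r < size z &
    [/\ w (rot r z) 1 = 1, w (rot r z) 3 = 1 & w (rot r z) 2 <= w (rot r z) 0].
Proof.
move=> Hz s4.
have H i : sole_cycle (rot i z) by apply: sole_cycle_rot.
have adj2 i : i < 4 -> 1 < w z i -> 1 < w z ((i + 1) %% 4) -> strict.
  have base z' : sole_cycle z' -> size z' = 4 -> 1 < w z' 0 -> 1 < w z' 1 -> strict.
    move=> Hz' s4' w0 w1.
    have H' j : sole_cycle (rot j z') by apply: sole_cycle_rot.
    have L j : j < 4 -> loss Gc (rot j z') = 2 * (w z' j * w z' ((j + 3) %% 4)).
      move=> lj; rewrite /loss !size_rot s4' /= mul0n addn0 !w_rot ?s4' //.
      by rewrite addn0 modn_small.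
    have pos j : j < 4 -> 0 < w z' j.
      by move=> lj; apply: (branch_size_gt0 Gc Hz'); rewrite mem_nth ?s4'.
    have sumw : w z' 0 + w z' 1 + w z' 2 + w z' 3 = #|G|.
      by rewrite -(sum_branch_size Gc Hz') (big_nth x0) s4' big_mkord !big_ord_recr big_ord0.
    have p2 := pos 2 isT; have p3 := pos 3 isT.
    have L0 : loss Gc (rot 0 z') = 2 * (w z' 0 * w z' 3) := L 0 isT.
    have L1 : loss Gc (rot 1 z') = 2 * (w z' 1 * w z' 0) := L 1 isT.
    have L2 : loss Gc (rot 2 z') = 2 * (w z' 2 * w z' 1) := L 2 isT.
    (* Rotations 0 and 2 keep a nontrivial branch at an inner position between two non-leaves, so
       the gap is available. If their losses are both too small, rotation 1, which cuts the edge
       between the two branches, loses enough. *)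
    have [g0|g0] := leqP #|G| (loss Gc (rot 0 z') + (#|G| <= 6) + 1).
      apply: (strict_of_gap (H' 0) _ g0); apply: (opened_gap m1 mG mn (H' 0) (j := 1)).
      - by rewrite size_rot s4'.
      - by rewrite rot0.
      - by rewrite rot0 w0 ?orbT.
      - by rewrite size_rot s4'.
    have [g2|g2] := leqP #|G| (loss Gc (rot 2 z') + (#|G| <= 6) + 1).
      apply: (strict_of_gap (H' 2) _ g2); apply: (opened_gap m1 mG mn (H' 2) (j := 2)).
      - by rewrite size_rot s4'.
      - by rewrite w_rot ?s4'.
      - by [].
      - by rewrite w_rot ?s4' //= w1 orbT.
    have n4 : 4 < #|G| by move: sumw w0 w1 p2 p3; clear; lia.
    apply: (strict_of_loss (H' 1)); apply: leq_trans (defect_small m1 mn n4) _.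
    move: g0 g2; rewrite L0 L1 L2 -sumw; move: w0 w1 p2 p3.
    by move: (w z' 0) (w z' 1) (w z' 2) (w z' 3); clear=> p q r s; case: leqP; nia.
  move=> li wi wi1; apply: (base (rot i z)) => //; first by rewrite size_rot.
    by rewrite w_rot ?s4 // addn0 modn_small.
  by rewrite w_rot ?s4.
have R i : i < 4 -> w z ((i + 1) %% 4) = 1 -> w z ((i + 3) %% 4) = 1 ->
    w z ((i + 2) %% 4) <= w z i ->
    strict \/ exists2 r, r < size z &
    [/\ w (rot r z) 1 = 1, w (rot r z) 3 = 1 & w (rot r z) 2 <= w (rot r z) 0].
  move=> li e1 e3 e2; right; exists i; rewrite ?s4 // !w_rot ?s4 //.
  by rewrite e1 e3 addn0 [i %% 4]modn_small.
have pos i : i < 4 -> 0 < w z i.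
  by move=> li; apply: (branch_size_gt0 Gc Hz); rewrite mem_nth ?s4.
have one i : i < 4 -> w z i <= 1 -> w z i = 1.
  by move=> li le; apply/eqP; rewrite eqn_leq le pos.
have opp i : i < 4 -> w z ((i + 1) %% 4) <= 1 -> w z ((i + 3) %% 4) <= 1 ->
    strict \/ exists2 r, r < size z &
    [/\ w (rot r z) 1 = 1, w (rot r z) 3 = 1 & w (rot r z) 2 <= w (rot r z) 0].
  move=> li /one e1 /one e3; have [le|lt] := leqP (w z ((i + 2) %% 4)) (w z i).
    by apply: (R i); rewrite // ?e1 ?e3 // ltn_mod.
  apply: (R ((i + 2) %% 4)); rewrite ?ltn_mod //; move: li e1 e3 lt.
  - by case: i => [|[|[|[|]]]] //= _ _ -> .
  - by case: i => [|[|[|[|]]]] //= _ -> .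
  - by case: i => [|[|[|[|]]]] //= _ _ _ /ltnW.
have [a0|a0] := leqP (w z 0) 1; have [a2|a2] := leqP (w z 2) 1.
- exact: (opp 1).
- have [a1|a1] := leqP (w z 1) 1; last by left; apply: (adj2 1).
  have [a3|a3] := leqP (w z 3) 1; last by left; apply: (adj2 2).
  exact: (opp 0).
- have [a1|a1] := leqP (w z 1) 1; last by left; apply: (adj2 0).
  have [a3|a3] := leqP (w z 3) 1; last by left; apply: (adj2 3).
  exact: (opp 0).
- have [a1|a1] := leqP (w z 1) 1; last by left; apply: (adj2 0).
  have [a3|a3] := leqP (w z 3) 1; last by left; apply: (adj2 3).
  exact: (opp 0).
Qed.

End Strict.

(** * Triangles *)

Lemma isomorphic_arcs (G : sgraph) N (r : rel nat) (s : seq G) (x0 : G) :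
  uniq s -> s =i predT -> size s = N ->
  (forall i j, i < j -> j < N -> adj (nth x0 s i) (nth x0 s j) = r i j || r j i) ->
  isomorphic G (graph_of_arcs N r).
Proof.
move=> us sG sN H; subst N.
have ix (x : G) : index x s < size s by rewrite index_mem sG.
exists (fun x => Ordinal (ix x)).
  exists (fun i : 'I_(size s) => nth x0 s i) => [x|i] /=; first by rewrite nth_index ?sG.
  by apply: val_inj; rewrite /= index_uniq.
move=> x y; rewrite /= /arcs_adj -val_eqE /=.
have nx (v : G) : nth x0 s (index v s) = v by rewrite nth_index ?sG.
case: ltngtP => [lt|lt|E] /=.
- by rewrite -(H _ _ lt (ix y)) !nx.
- by rewrite orbC -(H _ _ lt (ix x)) !nx adj_sym.
- by rewrite -(nx x) E nx adj_irr.
Qed.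

Section ClosingLeaf.

Variables (G : sgraph) (Gc : connected G) (z : seq G).
Hypothesis Hz : sole_cycle z.
Notation x0 := (base Gc).
Notation zn i := (nth x0 z i).
Notation T := (opened Gc z).
Hypothesis G2 : 2 < #|G|.
Variable R : {set T}.
Hypotheses (cR : core R) (AR : zn 0 \in R) (KR : zn (size z).-1 \notin R).
Implicit Types (x y l : G).

Let Ttree : tree T. Proof. exact: opened_tree. Qed.
Let Tc : connected T. Proof. exact: opened_connected. Qed.
Let T2 : 2 < #|T|. Proof. exact: G2. Qed.

Lemma adj_opened x y : adj x y =
  @adj T x y || ([set x; y] == [set zn (size z).-1; zn 0]).
Proof.
rewrite /= /delete_adj; case: eqP => [E|_]; last by rewrite andbT orbF.
rewrite orbT; have /set2_eq[[-> ->]|[-> ->]] := E; last rewrite adj_sym.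
  exact: cycle_adj_last.
exact: cycle_adj_last.
Qed.

(** The closing edge does not lie inside the core, because its end [zn (size z).-1] is outside. *)
Lemma adj_core x y : x \in R -> y \in R -> adj x y = (gdist (x : T) y == 1).
Proof.
move=> xR yR; rewrite adj_opened (gdist_eq1 Tc); case: eqP => [E|_]; last by rewrite orbF.
have /set2_eq[[Ex _]|[_ Ey]] := E.
  by move: xR; rewrite Ex (negPf KR).
by move: yR; rewrite Ey (negPf KR).
Qed.

Lemma adj_leaf (x l : T) : l \notin R -> @adj T x l = (x == leaf_parent l).
Proof.
move=> lR; apply/idP/eqP => [xl|->].
  by rewrite (leaf_parentE Ttree T2 cR lR (_ : @adj T l x)) // adj_sym.
by rewrite adj_sym; apply: leaf_parent_adj.
Qed.

Lemma adj_off_core x l : l \notin R -> adj x l =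
  (x == leaf_parent (l : T)) || ((l == zn (size z).-1) && (x == zn 0)).
Proof.
move=> lR; rewrite adj_opened adj_leaf //; congr (_ || _).
apply/eqP/andP => [/set2_eq[[_ El]|[-> ->]]|[/eqP -> /eqP ->]].
- by move: lR; rewrite El AR.
- by rewrite !eqxx.
- by rewrite setUC.
Qed.

Lemma dumbbell_rev (q : seq T) : dumbbell R q -> dumbbell R (rev q).
Proof.
move=> [qR uq oq ends]; split.
- by move=> x; rewrite mem_rev.
- by rewrite rev_uniq.
- exact: path_order_rev.
- move=> y l lR; have qs : size q = #|R| by rewrite -(card_uniqP uq); apply: eq_card.
  have q0 : 0 < size q by rewrite qs; apply/card_gt0P; exists (zn 0).
  rewrite -qs !nth_rev ?prednK // subn1 subnn.
  by case: (ends y l lR) => ->; [right|left]; rewrite ?qs.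
Qed.

(* The dumbbell can be listed starting from the end carrying the vertex at
   which the cycle was cut open. *)
Lemma dumbbell_oriented (q : seq T) : dumbbell R q ->
  exists q', dumbbell R q' /\ nth x0 q' 0 = leaf_parent (zn (size z).-1 : T).
Proof.
move=> qd; have [qR uq oq ends] := qd.
have qs : size q = #|R| by rewrite -(card_uniqP uq); apply: eq_card.
have q0 : 0 < size q by rewrite qs; apply/card_gt0P; exists (zn 0).
have [E|E] := ends x0 _ KR; first by exists q.
exists (rev q); split; first exact: dumbbell_rev.
by rewrite nth_rev // subn1 E -qs.
Qed.

Lemma dumbbell_nth (q : seq T) x i : dumbbell R q -> x \in R ->
  gdist (nth x0 q 0 : T) x = i -> nth x0 q i = x.
Proof.
move=> [qR uq oq ends] xR <-; have xq : x \in q by rewrite qR.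
have lx : index x q < size q by rewrite index_mem.
have -> : gdist (nth x0 q 0 : T) x = index x q.
  by rewrite -{1}(nth_index x0 xq) oq ?subn0 ?sub0n //; apply: leq_ltn_trans lx.
exact: nth_index.
Qed.

End ClosingLeaf.

Section Triangle.

Variables (G : sgraph) (Gc : connected G) (m : nat).
Hypotheses (m1 : 1 < m) (mG : matching_number G <= m) (mn : 2 * m <= #|G|).
Variable z : seq G.
Hypotheses (Hz : sole_cycle z) (s3 : size z = 3).

Notation t := (2 * m).-1.
Notation k := (#|G| - t).
Notation c := (k./2).
Notation a := (k - k./2).
Notation x0 := (base Gc).
Notation zn i := (nth x0 z i).
Notation w i := (branch_size z (zn i)).
Notation B := (tree_bound t c a).
Notation T := (opened Gc z).

Hypotheses (w1 : w 1 = 1) (w2 : w 2 = 1).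

Let ac : k = a + c. Proof. by clear; lia. Qed.
Let ca : c <= a <= c.+1. Proof. by clear; lia. Qed.
Let G2 : 2 < #|G|. Proof. by move: m1 mn; clear; lia. Qed.
Let Ttree : tree T. Proof. exact: opened_tree. Qed.
Let Tc : connected T. Proof. exact: opened_connected. Qed.
Let T2 : 2 < #|T|. Proof. exact: G2. Qed.

Let zmem i : i < 3 -> zn i \in z. Proof. by move=> li; rewrite mem_nth ?s3. Qed.
Let zneq i j : i < 3 -> j < 3 -> i != j -> zn i != zn j.
Proof. by move=> li lj; apply: (nth_neq Gc Hz); rewrite s3. Qed.
Let memz (x : G) : x \in z -> [\/ x = zn 0, x = zn 1 | x = zn 2].
Proof.
move=> xz; rewrite -(nth_index x0 xz).
have : index x z < 3 by rewrite -s3 index_mem.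
by case: (index x z) => [|[|[|]]] // _; [constructor 1|constructor 2|constructor 3].
Qed.

Lemma triangle_root_size : w 0 = #|G| - 2.
Proof.
have := sum_branch_size Gc Hz; rewrite (big_nth x0) s3 big_mkord !big_ord_recr big_ord0 /=.
by rewrite w1 w2; clear; lia.
Qed.

Lemma triangle_loss : loss Gc z = #|G| - 2.
Proof. by rewrite /loss s3 /= mul0n addn0 mul1n w2 muln1 triangle_root_size. Qed.

Lemma triangle_edges : @adj T (zn 0) (zn 1) /\ @adj T (zn 1) (zn 2).
Proof. by split; apply: (opened_cycle_adj Gc Hz); rewrite s3. Qed.

Lemma triangle_last_adj y : @adj T (zn 2) y -> y = zn 1.
Proof.
move=> Cy; have yz := branch_size1 Gc Hz (zmem (isT : 2 < 3)) w2 (opened_sub Cy).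
case: (memz yz) => // E; move: Cy; rewrite E; last by rewrite adj_irr.
by rewrite /= /delete_adj s3 /= eqxx andbF.
Qed.

Lemma triangle_mid_adj y : @adj T (zn 1) y -> y = zn 0 \/ y = zn 2.
Proof.
move=> By; have yz := branch_size1 Gc Hz (zmem (isT : 1 < 3)) w1 (opened_sub By).
by case: (memz yz) => E; [left | move: By; rewrite E adj_irr | right].
Qed.

Lemma triangle_last_leaf : ~~ nonleaf (zn 2 : T).
Proof.
apply/negP => /nonleafP[y [y' [ne Cy Cy']]]; case/eqP: ne.
by rewrite (triangle_last_adj Cy) (triangle_last_adj Cy').
Qed.

Section WithCore.

Variable R : {set T}.
Hypotheses (cR : core R) (Rt : #|R| = t) (CR : zn 2 \notin R).

Let KR : zn (size z).-1 \notin R. Proof. by rewrite s3. Qed.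

Lemma triangle_root_core : zn 0 \in R.
Proof.
apply: cR; apply: (opened_nonleaf Hz); first by rewrite s3.
by rewrite triangle_root_size; move: m1 mn; clear; lia.
Qed.

Lemma triangle_mid_core : zn 1 \in R.
Proof. by apply: cR; apply: (opened_nonleaf Hz); rewrite s3. Qed.

Lemma triangle_parent l : l \notin R -> leaf_parent (l : T) = zn 1 -> l = zn 2.
Proof.
move=> lR E; have := leaf_parent_adj Ttree T2 l; rewrite E adj_sym => /triangle_mid_adj[] // El.
by move: lR; rewrite El triangle_root_core.
Qed.

Lemma triangle_parent_last : leaf_parent (zn 2 : T) = zn 1.
Proof. by apply: triangle_last_adj; apply: leaf_parent_adj. Qed.

Let L := enum (~: R).

Lemma triangle_count : count (fun l : T => leaf_parent l == zn 1) L = 1.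
Proof.
have CL : zn 2 \in L by rewrite mem_enum inE CR.
rewrite (seq.permP (perm_to_rem CL)) /= triangle_parent_last eqxx.
rewrite (_ : count _ _ = 0) //; apply/eqP; rewrite -leqn0 leqNgt -has_count.
apply/hasPn => l; rewrite mem_rem_uniq ?enum_uniq // !inE => /andP[lC lL].
apply: contra lC => /eqP/triangle_parent ->; first by [].
by move: lL; rewrite mem_enum inE.
Qed.

(** Presents [zn 1] as the last leaf of the core, so that [placed_dist_peel] applies to the edge
    from [zn 0] to [zn 1]. *)
Lemma triangle_core_seq : exists s, [/\ tree_seq (@gdist T) s, zn 1 \notin s,
  zn 0 \in s, forall x, x \in s -> gdist (zn 1 : T) x = (gdist (zn 0 : T) x).+1
  & zn 1 :: s =i R].
Proof.
have [AR BR] := (triangle_root_core, triangle_mid_core).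
have [AB BC] := triangle_edges.
have [r0 par] := core_rooted Ttree cR AR.
have [|s [ts us sR]] := @rooted_tree_seq T Ttree (zn 0) (R :\ zn 1).
  split=> [|v]; first by rewrite !inE AR zneq.
  rewrite !inE => /andP[vB vR] vA; have [p [pR pv dv]] := par v vR vA.
  exists p; split=> //; rewrite !inE pR andbT; apply/eqP => pB.
  move: pv; rewrite pB => /triangle_mid_adj[] E; first by rewrite E eqxx in vA.
  by rewrite E (negPf CR) in vR.
exists s; split=> //.
- by rewrite sR !inE eqxx.
- by rewrite sR !inE AR zneq.
- move=> x; rewrite sR !inE => /andP[xB xR].
  rewrite (gdist_sym Tc (zn 1)) (gdist_sym Tc (zn 0)).
  have [y yB E] := gdist_pred Tc xB.
  rewrite adj_sym in yB; case: (triangle_mid_adj yB) => Ey; first by rewrite E Ey.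
  have xC : x != zn 2 by apply: contraNneq CR => <-.
  have CB : @adj T (zn 2) (zn 1) by rewrite adj_sym.
  have := leaf_dist Ttree triangle_last_leaf CB xC.
  by rewrite (gdist_sym Tc (zn 2)) (gdist_sym Tc (zn 1)) E Ey; move: (gdist _ _); clear; lia.
- by move=> x; rewrite inE sR !inE; case: eqVneq => // ->.
Qed.

(** Only [zn 2] hangs at [zn 1], so the edge from [zn 0] to [zn 1] separates [k - 1] pairs, while
    [c * a >= k]. In a dumbbell the same deficit occurs at all t - 1 core edges; otherwise it adds 1
    to the gap t - 2. Either way t - 1 is added to the loss n - 2, and the sum exceeds [defect]. *)
Lemma triangle_strict : 3 < k -> 6 * Wiener G + 6 * defect G m < B.
Proof.
move=> k3; have [s [ts Bs As sB sR]] := triangle_core_seq.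
have ts' : tree_seq (@gdist T) (zn 1 :: s) := TreeSeqCons ts As Bs sB.
have us' := tree_seq_uniq ts'.
have sL := core_leaves Rt.
have ss : size (zn 1 :: s) = t by rewrite -Rt -(card_uniqP us'); apply: eq_card.
have fL := leaf_parent_seq Ttree T2 cR sR.
have tot := core_total Ttree T2 cR us' sR sL.
have loss_bd := loss_le Gc Hz; rewrite triangle_loss in loss_bd.
have LR l : l \in L -> l \notin R by rewrite mem_enum inE.
have ka : k <= c * a by rewrite {1}ac; move: k3; clear; nia.
have [W1 W2] := core_sums_le Ttree T2 cR ts' sR.
have Lk : size L = k by rewrite sL -ac.
have cnt := triangle_count.
have def4 : defect G m = 2 * (t - 2) + 2 * c by rewrite /defect leqNgt k3.
have [||[q qd]|gap] := core_gap Ttree T2 cR ts' us' sR.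
- by rewrite Rt; move: m1; clear; lia.
- have mnT : 2 * m <= #|T| := mn.
  by rewrite Rt; move: m1 mnT; clear; lia.
- have [q' [[qR uq oq ends] q0]] := dumbbell_oriented triangle_root_core KR qd.
  rewrite s3 /= triangle_parent_last in q0.
  have : placed_dist (@gdist T) L (@leaf_parent T) <= t.-1 * (2 * (1 * (k - 1))).
    have := sum_xor (fun l : T => leaf_parent l == zn 1) L; rewrite cnt Lk => <-.
    rewrite big_distrr /= /placed_dist !big_seq.
    apply: leq_sum => l lL; rewrite big_distrr /= !big_seq; apply: leq_sum => l' l'L.
    have [pl pl'] := (ends (zn 0) _ (LR _ lL), ends (zn 0) _ (LR _ l'L)).
    have Q0 : nth (zn 0) q' 0 = zn 1.
      by rewrite -q0; apply: set_nth_default; rewrite -(card_uniqP uq) (eq_card qR) Rt; move: m1; clear; lia.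
    have dlt : @gdist T (@leaf_parent T l) (@leaf_parent T l') <= t.-1.
      have := tree_seq_dist_lt (@gdistxx T) (gdist_sym Tc) ts' (fL _ lL) (fL _ l'L).
      by rewrite ss; move: (gdist _ _) m1; clear; lia.
    rewrite Q0 in pl pl'; case: (eqVneq (@leaf_parent T l) (zn 1)) => [E|ne];
      case: (eqVneq (@leaf_parent T l') (zn 1)) => [E'|ne'] /=; rewrite ?muln1 //.
    + by rewrite E E' gdistxx.
    + case: pl => [/eqP|->]; first by rewrite (negPf ne).
      by case: pl' => [/eqP|->]; [rewrite (negPf ne') | rewrite gdistxx].
  move: tot loss_bd W1 W2; rewrite def4 sL ss /tree_bound -ac.
  have h1 := leq_mul (leqnn t.-1) ka.
  have h2 : t.-1 * (2 * (1 * (k - 1))) + 2 * t.-1 = 2 * (t.-1 * k).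
    move: k3; move: k t.-1 => [|x] y // _; rewrite subn1 /= mul1n mulnS mulnCA.
    by rewrite -mulnDr addnC.
  move: h1 h2; move: (placed_dist _ _ _) (dist_total _ _) (\sum_(l <- _) _) (\sum_(x : T) _).
  move: (t.-1 * k) (t.-1 * (c * a)) (t.-1 * _) (k * t) (k * (t * t.-1)) (k * k.-1) (t ^ 3).
  by move: (Wiener G) m1 k3 mn; clear; lia.
- have := placed_dist_peel (@gdistxx T) (gdist_sym Tc) sB Bs As fL.
  rewrite cnt Lk; set f' := fun l => _ => peel.
  have fL' : {in L, forall l, f' l \in s}.
    by move=> l /fL; rewrite inE /f'; case: eqP.
  have := placed_dist_le (@gdistxx T) (gdist_sym Tc) ts fL' sL ca.
  have -> : (size s).-1 = t.-1.-1 by rewrite -ss.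
  move=> hf; move: tot loss_bd gap; rewrite peel def4 sL ss /tree_bound -ac.
  have h2 : t.-1 * (c * a) = t.-1.-1 * (c * a) + c * a.
    by rewrite -{1}(prednK (_ : 0 < t.-1)) ?mulSn ?[c * a + _]addnC //; move: m1; clear; lia.
  have h3 : t <= t ^ 3 by rewrite !expnS expn0; move: m1; clear; nia.
  move: h2 h3 hf; move: (placed_dist _ _ _) (dist_total _ _) (\sum_(l <- _) _) (\sum_(x : T) _).
  move: ka; move: (t.-1 * (c * a)) (t.-1.-1 * (c * a)) (c * a) (k * t) (k * (t * t.-1)) (k * k.-1) (t ^ 3).
  by move: (Wiener G) m1 k3 mn; clear; lia.
Qed.

Lemma triangle_iso (q : seq T) n : #|G| = n -> dumbbell R q -> nth x0 q 0 = zn 1 ->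
  isomorphic G (G3 (n - 2 * m) (2 * m - 3)).
Proof.
move=> nG qd q0; have [qR uq oq ends] := qd.
have nm : 2 * m <= n by rewrite -nG.
have kE : k = n - t by rewrite nG.
have qs : size q = t by rewrite -Rt -(card_uniqP uq); apply: eq_card.
have [AR BR] := (triangle_root_core, triangle_mid_core).
have LR l : l \in L -> l \notin R by rewrite mem_enum inE.
have CL : zn 2 \in L by rewrite mem_enum inE CR.
have uL : uniq L := enum_uniq _.
have sL : size (rem (zn 2) L) = k.-1.
  by rewrite size_rem // (core_leaves Rt) -ac.
have [AB BC] := triangle_edges.
have q1 : nth x0 q 1 = zn 0.
  apply: (dumbbell_nth qd AR); rewrite q0; apply/eqP.
  by rewrite (gdist_eq1 Tc) adj_sym.
(* The order in which [G3] numbers its vertices: [behead q] lists A_0 = [zn 0], ..., A_j, then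
   follow B_0 = [zn 1], C_0 = [zn 2] and the pendant vertices. *)
pose s : seq G := behead q ++ zn 1 :: zn 2 :: rem (zn 2) L.
have sz : size s = n - 2 * m + (2 * m - 3) + 3.
  by rewrite size_cat size_behead qs /= sL kE; move: m1 nm; clear; lia.
have js : size (behead q) = (2 * m - 3).+1 by rewrite size_behead qs; move: m1; clear; lia.
have sG : s =i predT.
  move=> x; rewrite inE mem_cat !inE; apply/idP.
  have [xR|xR] := boolP (x \in R).
    have : x \in q by rewrite qR.
    case: (q) q0 => [|y q'] //= ->; rewrite inE => /predU1P[->|->] //.
    by rewrite eqxx orbT.
  have [->|xC] := eqVneq x (zn 2); first by rewrite !orbT.
  by rewrite mem_rem_uniq // !inE xC mem_enum inE xR !orbT.
have us : uniq s.
  by apply/card_uniqP; rewrite (eq_card sG) sz -[LHS]/#|G| nG; move: m1 nm; clear; lia.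
have nq i : i <= 2 * m - 3 -> nth x0 s i = nth x0 q i.+1.
  by move=> li; rewrite nth_cat js ltnS li nth_behead.
have nB : nth x0 s (2 * m - 3).+1 = zn 1 by rewrite nth_cat js ltnn subnn.
have nC : nth x0 s (2 * m - 3).+2 = zn 2 by rewrite nth_cat js ltnNge leqnSn /= subSnn.
have lt_eq i j : i < size s -> j < size s -> (nth x0 s i == nth x0 s j) = (i == j).
  by move=> li lj; rewrite nth_uniq.
apply: (isomorphic_arcs us sG sz) => u v uv lv; rewrite -sz in lv.
have lu := ltn_trans uv lv.
have nR i : i <= (2 * m - 3).+1 -> nth x0 s i \in R.
  rewrite leq_eqVlt => /predU1P[->|li]; first by rewrite nB.
  by rewrite nq // -qR mem_nth // qs; move: li m1; clear; lia.
have [v1|v1] := leqP v (2 * m - 3).+1.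
  have u1 := leq_trans (ltnW uv) v1.
  apply: (etrans (adj_core Hz KR (nR u u1) (nR v v1))).
  have dq i : i <= (2 * m - 3).+1 -> nth x0 s i = nth x0 q (if i == (2 * m - 3).+1 then 0 else i.+1).
    by move=> li; case: eqP => [->|ne]; [rewrite nB q0 | rewrite nq //; move: li ne; clear; lia].
  rewrite (dq u u1) (dq v v1) oq; first last.
  - by rewrite qs; case: eqP; move: v1 m1; clear; lia.
  - by rewrite qs; case: eqP; move: uv v1 m1; clear; lia.
  rewrite /G3_arcs; move: uv v1 m1; move: (2 * m - 3) => j; clear.
  by case: (u =P j.+1) => [->|]; case: (v =P j.+1) => [->|]; lia.
have s0 : 0 < size s by apply: leq_ltn_trans lv.
have n0 : nth x0 s 0 = zn 0 by rewrite nq ?q1.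
have jlt : (2 * m - 3).+1 < size s by rewrite sz; move: m1 nm; clear; lia.
move: v1; rewrite leq_eqVlt => /predU1P[Ev|v1].
  rewrite -Ev nC; apply: (etrans (adj_off_core Hz G2 cR AR (nth x0 s u) CR)).
  rewrite triangle_parent_last s3 /= eqxx -nB -n0 /= !lt_eq //.
  rewrite /G3_arcs; move: uv; rewrite -Ev; move: m1; clear=> m1.
  by move: (2 * m - 3) => j; lia.
have lR : nth x0 s v \in rem (zn 2) L.
  rewrite nth_cat js ltnNge (ltnW (ltnW v1)) /=.
  have Ev : v - (2 * m - 3).+1 = (v - (2 * m - 3).+3).+2 by move: v1; clear; lia.
  rewrite Ev /= mem_nth // sL kE; move: lv v1; rewrite sz; move: m1 nm; clear; lia.
move: lR; rewrite mem_rem_uniq // !inE => /andP[vC vL].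
have vR := LR _ vL.
have pv : @leaf_parent T (nth x0 s v) = nth x0 s (2 * m - 3).
  rewrite (nq _ (leqnn _)); have -> : (2 * m - 3).+1 = #|R|.-1 by rewrite Rt; move: m1; clear; lia.
  case: (ends x0 _ vR) => // E; case/eqP: vC; apply: triangle_parent => //.
  by rewrite E q0.
apply: (etrans (adj_off_core Hz G2 cR AR (nth x0 s u) vR)).
rewrite pv s3 /= (negPf vC) andFb orbF (lt_eq _ _ lu (ltnW jlt)).
rewrite /G3_arcs; move: uv v1; clear; move: (2 * m - 3) => j; lia.
Qed.

(** Here the loss equals [defect], so equality leaves no room for the positive gap [t - 2] and the
    core is a dumbbell. *)
Lemma triangle_small : k <= 3 -> 6 * Wiener G + 6 * defect G m <= B /\
  (6 * Wiener G + 6 * defect G m = B ->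
   forall n, #|G| = n -> isomorphic G (G3 (n - 2 * m) (2 * m - 3))).
Proof.
move=> k3; have -> : defect G m = #|G| - 2 by rewrite /defect k3.
have := loss_le Gc Hz; rewrite triangle_loss => lo.
have up := core_bound m1 mn Hz cR Rt; split.
  by move: lo up; move: (tree_bound _ _ _) => b; move: (\sum_(x : T) _) (Wiener _); clear; lia.
move=> E n nG; have [[q qd]|gap] := core_bound_gap m1 mn Hz cR Rt; last first.
  move: lo gap E; move: (tree_bound _ _ _) => b; move: (\sum_(x : T) _) (Wiener _) m1.
  by clear; lia.
have [q' [qd' q0]] := dumbbell_oriented triangle_root_core KR qd.
by apply: triangle_iso nG qd' _; rewrite q0 s3 /= triangle_parent_last.
Qed.

End WithCore.

Lemma triangle_bound : 6 * Wiener G + 6 * defect G m <= B /\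
  (6 * Wiener G + 6 * defect G m = B ->
   k <= 3 /\ forall n, #|G| = n -> isomorphic G (G3 (n - 2 * m) (2 * m - 3))).
Proof.
have [R [cR Rt CR]] := opened_core m1 mG mn Hz triangle_last_leaf.
have [k3|k3] := leqP k 3.
  by have [le eq] := triangle_small cR Rt CR k3; split=> // /eq.
have lt := triangle_strict cR Rt CR k3; split; first exact: ltnW.
by move=> E; rewrite E ltnn in lt.
Qed.

End Triangle.

(** * Squares *)

(** With [x] pendant vertices on the side of the root of a square, each of the two edges between the
    sides separates x(a + c - x) pairs, while the loss contains 2x. The difference x(a + c - 1 - x)
    is concave, with maximum at [x = c] and at [x = a - 1]. *)
Lemma split_product_excess a c x : c <= a <= c.+1 -> x <= a + c ->
  c + x * (a + c - x) <= x + c * a.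
Proof.
move=> ac lx; have [xc|cx] := leqP x c.
  have [i Ei] : exists i, c = x + i by exists (c - x); lia.
  have [j Ej] : exists j, a = x + j by exists (a - x); lia.
  have -> : a + c - x = x + i + j by lia.
  have : i <= i * j by nia.
  rewrite Ei Ej; nia.
have [i Ei] : exists i, x = a + i by exists (x - a); lia.
have [h Eh] : exists h, c = i + h by exists (c - i); lia.
have [j Ej] : exists j, a = j + h by exists (a - h); lia.
have -> : a + c - x = h by lia.
rewrite Ei Eh Ej; nia.
Qed.

Lemma split_product_excess_eq a c x : c <= a <= c.+1 -> x <= a + c ->
  c + x * (a + c - x) = x + c * a -> x = c \/ x.+1 = a.
Proof.
move=> ac lx; have [xc|cx] := leqP x c.
  have [i Ei] : exists i, c = x + i by exists (c - x); lia.
  have [j Ej] : exists j, a = x + j by exists (a - x); lia.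
  have -> : a + c - x = x + i + j by lia.
  rewrite Ei Ej => E; have ij : i = i * j by nia.
  have [i0|i0] := posnP i; first by left; lia.
  right; have j1 : j = 1 by nia.
  lia.
have [i Ei] : exists i, x = a + i by exists (x - a); lia.
have [h Eh] : exists h, c = i + h by exists (c - i); lia.
have [j Ej] : exists j, a = j + h by exists (a - h); lia.
have -> : a + c - x = h by lia.
rewrite Ei Eh Ej; nia.
Qed.

(** [p] and [q] count the core vertices in the branches of [zn 0] and [zn 2], and [y] the pairs of
    pendant vertices on different sides. Of the t - 1 = (p - 1) + (q - 1) + 2 core edges, the two
    between [zn 0] and [zn 2] separate [y] pairs each, any other one at most [c * a]. *)
Lemma square_sum_arith t c a p q S W D P y : 0 < p -> 0 < q -> p + q + 1 = t ->
  3 * S = 3 * W + 6 * D + 6 * ((a + c) * t) + 3 * P + 6 * ((a + c) * (a + c).-1) ->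
  3 * W + t <= t ^ 3 ->
  2 * D + 2 * ((q - 1) * p.+1) <= (a + c) * (t * t.-1) ->
  P <= 2 * ((p - 1) * (c * a)) + 2 * ((q - 1) * (c * a)) + 4 * y ->
  3 * S + 6 * ((q - 1) * p.+1) + 12 * (c * a) <= tree_bound t c a + 12 * y.
Proof.
move=> p0 q0 pq -> hW hD hP; rewrite /tree_bound.
have -> : t.-1 * (c * a) = (p - 1) * (c * a) + (q - 1) * (c * a) + 2 * (c * a).
  by rewrite -!mulnDl; congr (_ * _); lia.
move: hW hD hP; move: (t ^ 3) ((a + c) * (t * t.-1)) ((a + c) * t) ((a + c) * (a + c).-1).
move: ((p - 1) * (c * a)) ((q - 1) * (c * a)) ((q - 1) * p.+1) (c * a); lia.
Qed.

(** The loss contributes 2p, and the shortfall at [zn 2] is (q - 1)(p + 1) >= 2(q - 1); together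
    they give 2(t - 2). The remaining 2c comes from [split_product_excess]. *)
Lemma square_bound_arith t c a p q x W S b e : 0 < p -> 0 < q -> p + q + 1 = t ->
  c <= a <= c.+1 -> x <= a + c -> 6 * W + 6 * (2 * (p + x)) <= 3 * S ->
  3 * S + 6 * ((q - 1) * p.+1) + 12 * (c * a) <= b + 12 * (x * (a + c - x)) ->
  e <= 2 * (t - 2) + 2 * c ->
  6 * W + 6 * e <= b /\
  (6 * W + 6 * e = b -> [/\ e = 2 * (t - 2) + 2 * c, x = c \/ x.+1 = a
    & 6 * W + 12 * (p + x) = 3 * S]).
Proof.
move=> p0 q0 pq ac lx h1 h2 he; have := split_product_excess ac lx.
have := split_product_excess_eq ac lx.
have hU : 2 * (q - 1) <= (q - 1) * p.+1 by rewrite mulnC leq_mul2l; lia.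
move: h2 hU; move: (x * _) (c * a) ((q - 1) * p.+1) => Y Z U h2 hU eqY leY.
by split=> [|E]; [lia | split; [lia | apply: eqY; lia | lia]].
Qed.

(** Equality forces q = 1 or p = 1. If q = 1, the gap t - 2 is too much. If p = 1, comparing the two
    branches leaves t <= 4, so t = 3 by parity, and q = 1 again. *)
Lemma square_gap_arith t c a p q x W S b e : 0 < p -> 0 < q -> p + q + 1 = t -> odd t ->
  c <= a <= c.+1 -> x <= a + c -> 6 * W + 6 * (2 * (p + x)) <= 3 * S ->
  3 * S + 6 * ((q - 1) * p.+1) + 12 * (c * a) <= b + 12 * (x * (a + c - x)) ->
  3 * S + 6 * (t - 2) + 12 * (c * a) <= b + 12 * (x * (a + c - x)) ->
  q - 1 + (a + c - x) <= p + x ->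
  e <= 2 * (t - 2) + 2 * c -> 6 * W + 6 * e <> b.
Proof.
move=> p0 q0 pq ot ac lx h1 h2 h3 wle he E.
have [_ /(_ E)[Ee Ex ES]] := square_bound_arith p0 q0 pq ac lx h1 h2 he.
have leY := split_product_excess ac lx.
have hq : (q - 1) * p.+1 = 2 * (q - 1).
  have : 2 * (q - 1) <= (q - 1) * p.+1 by rewrite mulnC leq_mul2l; lia.
  move: h2 leY; move: (x * _) (c * a) ((q - 1) * p.+1) => Y Z U; lia.
have {}hq : q = 1 \/ p = 1.
  have [q1|q1] := posnP (q - 1); [by left; lia | right].
  by move/eqP: hq; rewrite mulnC eqn_pmul2r // => /eqP [].
move: h3 leY; move: (x * _) (c * a) => Y Z h3 leY; lia.
Qed.

(** In a dumbbell all t - 1 core edges separate x(a + c - x) pairs, which breaks the tie between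
    [x = c] and [x = a - 1]: the latter is worse unless p = 1, and then the root would have the
    smaller branch. *)
Lemma square_dumbbell_arith t c a p x W S b e : 0 < p -> p.+2 = t ->
  c <= a <= c.+1 -> x <= a + c -> 6 * W + 6 * (2 * (p + x)) <= 3 * S ->
  3 * S + 6 * (t.-1 * (c * a)) <= b + 6 * (t.-1 * (x * (a + c - x))) ->
  a + c - x <= p + x -> x = c \/ x.+1 = a ->
  6 * W + 6 * e = b -> e = 2 * (t - 2) + 2 * c -> x = c.
Proof.
move=> p0 pt ac lx h1 h2 wle [//|xa] E Ee.
have [//|ne] := eqVneq x c.
have Ea : a = c by lia.
have Ec : c = x.+1 by lia.
rewrite -pt Ea Ec /= in h2 Ee.
have E1 : x.+1 + x.+1 - x = x.+2 by lia.
rewrite E1 in h2.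
have E2 : p.+1 * (x.+1 * x.+1) = p.+1 * (x * x.+2) + p.+1 by nia.
rewrite E2 in h2; move: h2; move: (p.+1 * (x * x.+2)) => Y h2; lia.
Qed.

Lemma square_sum_gap_arith t c a p q S W D P y : 0 < p -> 0 < q -> p + q + 1 = t ->
  3 * S = 3 * W + 6 * D + 6 * ((a + c) * t) + 3 * P + 6 * ((a + c) * (a + c).-1) ->
  3 * W + 6 * D + 7 * t <= t ^ 3 + 12 + 3 * ((a + c) * (t * t.-1)) ->
  P <= 2 * ((p - 1) * (c * a)) + 2 * ((q - 1) * (c * a)) + 4 * y ->
  3 * S + 6 * (t - 2) + 12 * (c * a) <= tree_bound t c a + 12 * y.
Proof.
move=> p0 q0 pq -> hW hP; rewrite /tree_bound.
have -> : t.-1 * (c * a) = (p - 1) * (c * a) + (q - 1) * (c * a) + 2 * (c * a).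
  by rewrite -!mulnDl; congr (_ * _); lia.
have t3 : t <= t ^ 3 by rewrite !expnS expn0; nia.
move: t3 hW hP; move: (t ^ 3) ((a + c) * (t * t.-1)) ((a + c) * t) ((a + c) * (a + c).-1).
move: ((p - 1) * (c * a)) ((q - 1) * (c * a)) (c * a); lia.
Qed.

Lemma dumbbell_sum_arith t c a S W D P y :
  3 * S = 3 * W + 6 * D + 6 * ((a + c) * t) + 3 * P + 6 * ((a + c) * (a + c).-1) ->
  3 * W + t <= t ^ 3 -> 2 * D <= (a + c) * (t * t.-1) -> P <= t.-1 * (2 * y) ->
  3 * S + 6 * (t.-1 * (c * a)) <= tree_bound t c a + 6 * (t.-1 * y).
Proof.
move=> -> hW hD hP; rewrite /tree_bound mulnCA in hP *.
move: hW hD hP; move: (t ^ 3) ((a + c) * (t * t.-1)) ((a + c) * t) ((a + c) * (a + c).-1).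
move: (t.-1 * y) (t.-1 * (c * a)); lia.
Qed.

Lemma G4_arcs_core a j u v : u < v -> v <= j.+2 ->
  G4_arcs a j u v || G4_arcs a j v u =
  [|| (u < j) && (v == u.+1), (u == 0) && (v == j.+1) | (u == j.+1) && (v == j.+2)].
Proof.
move=> uv vj; rewrite /G4_arcs.
have -> : (u == j.+2) = false by lia.
have -> : (u == j.+3) = false by lia.
have -> : (v == j.+3) = false by lia.
have -> : (j.+4 <= v) = false by lia.
have -> : (j.+4 <= u) = false by lia.
have -> : (j.+4 + a <= u) = false by lia.
have -> : (u == v.+1) = false by lia.
have -> : (v == 0) = false by lia.
by rewrite !(andbF, andFb, orbF).
Qed.

Lemma G4_arcs_pendant a j u v : u < v -> j.+3 < v ->
  G4_arcs a j u v || G4_arcs a j v u = (u == if v < j.+4 + a then j else j.+2).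
Proof.
move=> uv vj; rewrite /G4_arcs.
have -> : (v == j.+1) = false by lia.
have -> : (v == j.+2) = false by lia.
have -> : (v == j.+3) = false by lia.
have -> : (v == j) = false by lia.
have -> : (v < j) = false by lia.
have -> : (v == 0) = false by lia.
have -> : (u < j) && (v == u.+1) = false by lia.
have -> : (j.+4 <= v) = true by lia.
rewrite !(andbF, andFb, orbF, orFb, andTb).
by case: ltnP => _; rewrite ?andbT ?andbF ?orbF.
Qed.

Section Square.

Variables (G : sgraph) (Gc : connected G) (m : nat).
Hypotheses (m1 : 1 < m) (mG : matching_number G <= m) (mn : 2 * m <= #|G|).
Variable z : seq G.
Hypotheses (Hz : sole_cycle z) (s4 : size z = 4).

Notation t := (2 * m).-1.
Notation k := (#|G| - t).
Notation c := (k./2).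
Notation a := (k - k./2).
Notation x0 := (base Gc).
Notation zn i := (nth x0 z i).
Notation w i := (branch_size z (zn i)).
Notation B := (tree_bound t c a).
Notation T := (opened Gc z).

Hypotheses (w1 : w 1 = 1) (w3 : w 3 = 1) (w20 : w 2 <= w 0).

Let ac : k = a + c. Proof. by clear; lia. Qed.
Let ca : c <= a <= c.+1. Proof. by clear; lia. Qed.
Let G2 : 2 < #|G|. Proof. by move: m1 mn; clear; lia. Qed.
Let Ttree : tree T. Proof. exact: opened_tree. Qed.
Let Tc : connected T. Proof. exact: opened_connected. Qed.
Let T2 : 2 < #|T|. Proof. exact: G2. Qed.

Let zmem i : i < 4 -> zn i \in z. Proof. by move=> li; rewrite mem_nth ?s4. Qed.
Let zneq i j : i < 4 -> j < 4 -> i != j -> zn i != zn j.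
Proof. by move=> li lj; apply: (nth_neq Gc Hz); rewrite s4. Qed.
Let memz (x : G) : x \in z -> exists2 i, i < 4 & x = zn i.
Proof. by move=> xz; exists (index x z); rewrite ?nth_index // -s4 index_mem. Qed.
Let bidx i : i < 4 -> branch_index z (zn i) = i.
Proof. by move=> li; apply: (branch_index_nth Gc Hz); rewrite s4. Qed.

Lemma square_size : w 0 + w 2 + 2 = #|G|.
Proof.
have := sum_branch_size Gc Hz; rewrite (big_nth x0) s4 big_mkord !big_ord_recr big_ord0 /=.
by rewrite w1 w3; clear; lia.
Qed.

Lemma square_loss : loss Gc z = 2 * w 0.
Proof. by rewrite /loss s4 /= mul0n addn0 w3 muln1. Qed.

Lemma square_adj i j : i < 4 -> j < 4 -> @adj T (zn i) (zn j) -> j = i.+1 \/ i = j.+1.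
Proof.
move=> li lj ij; have [E|l ll] := opened_branch_index Hz ij.
  by rewrite !bidx // in E; move: ij; rewrite E adj_irr.
have l4 : l.+1 < 4 by rewrite -s4.
have l4' : l < 4 by apply: ltnW.
case=> -[Ei Ej]; [left|right].
  by rewrite -(bidx lj) -(bidx li) Ei Ej !bidx.
by rewrite -(bidx lj) -(bidx li) Ei Ej !bidx.
Qed.

Lemma square_edge i : i < 3 -> @adj T (zn i) (zn i.+1).
Proof. by move=> li; apply: (opened_cycle_adj Gc Hz); rewrite s4. Qed.

Lemma square_last_adj y : @adj T (zn 3) y -> y = zn 2.
Proof.
move=> Dy; have yz := branch_size1 Gc Hz (zmem (isT : 3 < 4)) w3 (opened_sub Dy).
have [i li E] := memz yz; rewrite E in Dy *.
by case: (square_adj (isT : 3 < 4) li Dy) => [Ei|[->]] //; rewrite Ei in li.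
Qed.

Lemma square_mid_adj y : @adj T (zn 1) y -> y = zn 0 \/ y = zn 2.
Proof.
move=> By; have yz := branch_size1 Gc Hz (zmem (isT : 1 < 4)) w1 (opened_sub By).
have [i li E] := memz yz; rewrite E in By *.
by case: (square_adj (isT : 1 < 4) li By) => [->|[<-]]; [right|left].
Qed.

Lemma square_last_leaf : ~~ nonleaf (zn 3 : T).
Proof.
apply/negP => /nonleafP[y [y' [ne Dy Dy']]]; case/eqP: ne.
by rewrite (square_last_adj Dy) (square_last_adj Dy').
Qed.

Lemma square_branch1 i v : i < 4 -> w i = 1 -> branch z v = zn i -> v = zn i.
Proof.
move=> li wi bv; have : #|[set u | branch z u == zn i]| <= 1 by rewrite -[X in X <= _]/(w i) wi.
move/card_le1_eqP; apply; last by rewrite inE bv.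
by rewrite inE (branch_id Gc Hz) // zmem.
Qed.

Lemma square_branch v : [\/ branch z v = zn 0, v = zn 1, branch z v = zn 2 | v = zn 3].
Proof.
have [i li E] := memz (branch_mem Gc Hz v).
case: i li E => [|[|[|[|]]]] // li E.
- by constructor 1.
- by constructor 2; apply: square_branch1 E.
- by constructor 3.
- by constructor 4; apply: square_branch1 E.
Qed.

Section WithCore.

Variable R : {set T}.
Hypotheses (cR : core R) (Rt : #|R| = t) (DR : zn 3 \notin R).

Let KR : zn (size z).-1 \notin R. Proof. by rewrite s4. Qed.

(** If nothing hangs at [zn 0], then by [w20] the graph is the 4-cycle itself, and the three core
    vertices are all vertices but [zn 3]. *)
Lemma square_root_core : zn 0 \in R.
Proof.
have [w0|w0] := ltnP 1 (w 0).
  by apply: cR; apply: (opened_nonleaf Hz); rewrite ?s4 // w0 orbT.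
have n4 : #|G| <= 4 by have := square_size; move: w0 w20; clear; lia.
have sub : R \subset [set~ zn 3].
  by apply/subsetP => x xR; rewrite !inE; apply: contraNneq DR => <-.
have /eqP -> : R == [set~ zn 3].
  rewrite eqEcard sub cardsC1 Rt; move: m1 mn n4; rewrite -[#|T|]/#|G|.
  by move: #|G|; clear; lia.
by rewrite !inE zneq.
Qed.

Lemma square_mid_core i : 0 < i < 3 -> zn i \in R.
Proof.
case/andP=> i0 i3; apply: cR; apply: (opened_nonleaf Hz); rewrite s4.
  exact: ltnW.
by rewrite i0 i3.
Qed.

Lemma square_parent_last : leaf_parent (zn 3 : T) = zn 2.
Proof. by apply: square_last_adj; apply: leaf_parent_adj. Qed.

Let L := enum (~: R).
Let LR l : l \in L -> l \notin R. Proof. by rewrite mem_enum inE. Qed.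

Definition side i : {set T} := [set v in R | branch z v == zn i].

(** A tree edge between different branches joins two cycle vertices, so the parent of any vertex but
    the root stays in the branch. *)
Lemma side_rooted i : i < 4 -> zn i \in R -> rooted (zn i : T) (side i).
Proof.
move=> li iR; have [_ par] := core_rooted Ttree cR iR.
split=> [|v]; first by rewrite inE iR (branch_id Gc Hz) ?zmem ?eqxx.
rewrite inE => /andP[vR /eqP bv] vi; have [p [pR pv dv]] := par v vR vi.
exists p; split=> //; rewrite inE pR /=; apply/eqP.
have [Ei|ne] := eqVneq (branch_index z p) (branch_index z v).
  rewrite -bv -(nth_index x0 (branch_mem Gc Hz p)) -(nth_index x0 (branch_mem Gc Hz v)).
  by congr nth.
have [|l ll] := opened_branch_index Hz pv; first exact/eqP.
have vz : v \in z -> False.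
  by move=> vz; move: vi; rewrite -bv (branch_id Gc Hz) // eqxx.
by case=> -[_ Ev]; case: vz; rewrite Ev mem_nth // ltnW.
Qed.

Lemma square_core_parts v : v \in R -> [\/ v \in side 0, v = zn 1 | v \in side 2].
Proof.
move=> vR; case: (square_branch v) => [E|E|E|E].
- by constructor 1; rewrite inE vR E eqxx.
- by constructor 2.
- by constructor 3; rewrite inE vR E eqxx.
- by move: vR; rewrite E (negPf DR).
Qed.

Lemma leaf_side l : l \in L ->
  @leaf_parent T l \in side (if branch z (@leaf_parent T l) == zn 0 then 0 else 2).
Proof.
move=> lL; have pR := leaf_parent_core Ttree T2 cR (LR lL).
case: (square_core_parts pR) => [p0|p1|p2].
- by move: (p0); rewrite inE => /andP[_ ->].
- have := leaf_parent_adj Ttree T2 l; rewrite p1 adj_sym => /square_mid_adj[] E.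
    by case/negP: (LR lL); rewrite E square_root_core.
  by case/negP: (LR lL); rewrite E square_mid_core.
- case: eqP => // E; move: p2; rewrite inE E => /andP[_].
  by rewrite (negPf (zneq _ _ _)).
Qed.

Let in_A (l : T) := branch z (@leaf_parent T l) == zn 0.
Let xA := count in_A L.

Lemma square_leaf_branch l : l \in L -> (branch z l == zn 0) = in_A l.
Proof.
move=> lL; have lp := leaf_parent_adj Ttree T2 l.
have [Ei|/eqP ne] := eqVneq (branch_index z l) (branch_index z (@leaf_parent T l)).
  congr (_ == _); rewrite -(nth_index x0 (branch_mem Gc Hz l)).
  by rewrite -(nth_index x0 (branch_mem Gc Hz (@leaf_parent T l))); congr nth.
have [i li Eli] := opened_branch_index Hz lp ne.
have [j lj El] : exists2 j, j < 4 & l = zn j.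
  by case: Eli => -[-> _]; [exists i|exists i.+1]; rewrite // -s4 // ltnW.
have -> : l = zn 3.
  move: (LR lL); rewrite El; case: j lj El => [|[|[|[|]]]] // _ _.
  + by rewrite square_root_core.
  + by rewrite square_mid_core.
  + by rewrite square_mid_core.
rewrite /in_A square_parent_last !(branch_id Gc Hz) ?zmem //.
by rewrite !(negPf (zneq _ _ _)).
Qed.

Lemma square_root_size : w 0 = #|side 0| + xA.
Proof.
rewrite /branch_size -[LHS](cardsID R); congr (_ + _).
  by apply: eq_card => v; rewrite !inE andbC.
rewrite /xA -size_filter -(card_uniqP (filter_uniq _ (enum_uniq _))).
apply: eq_card => v; rewrite !inE mem_filter; have [vL|vL] := boolP (v \in L).
  by rewrite (LR vL) square_leaf_branch // andbT.
by move: vL; rewrite mem_enum inE negbK => ->; rewrite andbF.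
Qed.

Lemma card_core_sides : #|side 0| + #|side 2| + 1 = t.
Proof.
have side1 i : i \in [:: 0; 2] -> zn 1 \notin side i.
  rewrite !inE (branch_id Gc Hz) ?zmem // negb_and => /orP[]/eqP ->;
  by rewrite zneq ?orbT.
have -> : t = 1 + #|side 0 :|: side 2|.
  rewrite -Rt (cardsD1 (zn 1) R) square_mid_core //; congr (_ + _).
  apply: eq_card => v; rewrite !(inE, in_setU); apply/andP/orP => [[v1 vR]|].
    case: (square_core_parts vR) => [v0|E|v2]; [left|by rewrite E eqxx in v1|right].
      by move: v0; rewrite inE.
    by move: v2; rewrite inE.
  by case=> /andP[vR bv]; split=> //; apply: contraTneq bv => ->;
    rewrite (branch_id Gc Hz) ?zmem // zneq.
rewrite cardsU (_ : side 0 :&: side 2 = set0) ?cards0 ?subn0 1?addnC //.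
apply/setP => v; rewrite !inE; apply/negP => /andP[/andP[_ /eqP ->] /andP[_]].
by rewrite (negPf (zneq _ _ _)).
Qed.

Lemma side_seq i : i \in [:: 0; 2] ->
  exists s, [/\ tree_seq (@gdist T) s, uniq s, s =i side i & size s = #|side i|].
Proof.
move=> i02; have [li iR] : i < 4 /\ zn i \in R.
  by move: i02; rewrite !inE => /orP[]/eqP ->; rewrite ?square_root_core ?square_mid_core.
have [s [ts us sR]] := rooted_tree_seq Ttree (side_rooted li iR).
by exists s; split=> //; rewrite -(card_uniqP us); apply: eq_card.
Qed.

Lemma side_branch i v : v \in side i -> branch z v = zn i.
Proof. by rewrite inE => /andP[_ /eqP]. Qed.

Lemma side_root i : i \in [:: 0; 2] -> zn i \in side i.
Proof.
move=> i02; rewrite inE (branch_id Gc Hz); last first.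
  by apply: zmem; move: i02; rewrite !inE => /orP[]/eqP ->.
rewrite eqxx andbT.
by move: i02; rewrite !inE => /orP[]/eqP ->; rewrite ?square_root_core ?square_mid_core.
Qed.

Lemma cross_dist u v : u \in side 0 -> v \in side 2 ->
  @gdist T u v = @gdist T u (zn 0) + 2 + @gdist T (zn 2) v.
Proof.
move=> /side_branch bu /side_branch bv.
have iu : branch_index z u = 0 by rewrite /branch_index bu index_uniq ?s4 // sole_cycle_uniq.
have iv : branch_index z v = 2 by rewrite /branch_index bv index_uniq ?s4 // sole_cycle_uniq.
by rewrite (opened_dist Gc Hz) iu iv // bu bv.
Qed.

(** On a path, [zn 2] would have [#|side 2| - 1] vertices on one side and [#|side 0|.+1] on the
    other; their product is the shortfall of [path_dist_sum]. For other shapes of the sides the sum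
    is only smaller. *)
Lemma end_dist_sum s : uniq s -> s =i R ->
  2 * dist_sum (@gdist T) s (zn 2) + 2 * ((#|side 2| - 1) * (#|side 0|).+1) <= t * t.-1.
Proof.
move=> us sR; have [sA [tA uA A0 zA]] := side_seq (isT : 0 \in [:: 0; 2]).
have [sC [tC uC C0 zC]] := side_seq (isT : 2 \in [:: 0; 2]).
have perm : perm_eq s (zn 1 :: sA ++ sC).
  apply: uniq_perm => //.
    rewrite /= mem_cat A0 C0 cat_uniq uA uC andbT /= negb_or !inE.
    rewrite !(branch_id Gc Hz) ?zmem // !(negPf (zneq _ _ _)) // !andbF /=.
    apply/hasPn => v; rewrite C0 A0 !inE => /andP[_ /eqP ->].
    by rewrite (negPf (zneq _ _ _)) // andbF.
  move=> v; rewrite sR inE mem_cat A0 C0; apply/idP/idP.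
    by case/square_core_parts => [->|->|->]; rewrite ?eqxx ?orbT.
  case/predU1P => [->|]; first exact: square_mid_core.
  by case/orP; rewrite inE => /andP[].
have -> : dist_sum (@gdist T) s (zn 2) =
    dist_sum (@gdist T) (zn 1 :: sA ++ sC) (zn 2) by rewrite /dist_sum (perm_big _ perm).
rewrite dist_sum_cons; have -> : dist_sum (@gdist T) (sA ++ sC) (zn 2) =
    dist_sum (@gdist T) sA (zn 2) + dist_sum (@gdist T) sC (zn 2).
  by rewrite /dist_sum big_cat.
have -> : @gdist T (zn 2) (zn 1) = 1.
  by apply/eqP; rewrite (gdist_eq1 Tc) adj_sym square_edge.
have -> : dist_sum (@gdist T) sA (zn 2) = dist_sum (@gdist T) sA (zn 0) + 2 * size sA.
  rewrite /dist_sum mulnC -sum1_size big_distrl -big_split /=.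
  apply: eq_big_seq => v; rewrite A0 => vA.
  rewrite (gdist_sym Tc) (cross_dist vA) ?side_root // gdistxx addn0.
  by rewrite (gdist_sym Tc).
have hA := dist_sum_le (@gdistxx T) (gdist_sym Tc) tA (i := zn 0).
have hC := dist_sum_le (@gdistxx T) (gdist_sym Tc) tC (i := zn 2).
rewrite A0 side_root // zA in hA; rewrite C0 side_root // zC in hC.
have {hA} := hA isT; have {hC} := hC isT.
have C1 : 0 < #|side 2| by apply/card_gt0P; exists (zn 2); rewrite side_root.
rewrite zA -card_core_sides.
move: (dist_sum _ _ _) (dist_sum _ _ _) C1; move: #|side 0| #|side 2|; clear.
move=> p [//|q] X Y _; rewrite /= addn1 /= subn1 /=; nia.
Qed.

Lemma leaves_size : size L = k.
Proof. by rewrite (core_leaves Rt) -ac. Qed.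

(** Distances between the sides pass through [zn 0] and [zn 2], which are 2 apart. So the sum splits
    into two placements, each collapsing the opposite side to a root, and a 2 for every separated
    pair in either order. *)
Lemma side_placed : placed_dist (@gdist T) L (@leaf_parent T) <=
  2 * ((#|side 0| - 1) * (c * a)) + 2 * ((#|side 2| - 1) * (c * a)) + 4 * (xA * (k - xA)).
Proof.
have [sA [tA uA A0 zA]] := side_seq (isT : 0 \in [:: 0; 2]).
have [sC [tC uC C0 zC]] := side_seq (isT : 2 \in [:: 0; 2]).
pose fA (l : T) : T := if in_A l then leaf_parent l else zn 0.
pose fC (l : T) : T := if in_A l then zn 2 else leaf_parent l.
have inA l : l \in L -> in_A l -> @leaf_parent T l \in side 0.
  by move=> lL; have := leaf_side lL; rewrite /in_A => H E; rewrite E in H.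
have inC l : l \in L -> ~~ in_A l -> @leaf_parent T l \in side 2.
  by move=> lL; have := leaf_side lL; rewrite /in_A => H /negPf E; rewrite E in H.
have fAs : {in L, forall l, fA l \in sA}.
  move=> l lL; rewrite /fA A0; case: ifP => [/inA|_]; [exact|exact: side_root].
have fCs : {in L, forall l, fC l \in sC}.
  move=> l lL; rewrite /fC C0; case: ifP => [_|/negbT/inC]; [exact: side_root|exact].
have bA := placed_dist_le (@gdistxx T) (gdist_sym Tc) tA fAs (etrans leaves_size ac) ca.
have bC := placed_dist_le (@gdistxx T) (gdist_sym Tc) tC fCs (etrans leaves_size ac) ca.
rewrite zA -subn1 in bA; rewrite zC -subn1 in bC.
suff -> : placed_dist (@gdist T) L (@leaf_parent T) =
    placed_dist (@gdist T) L fA + placed_dist (@gdist T) L fC + 4 * (xA * (k - xA)).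
  by rewrite leq_add2r leq_add.
have -> : 4 * (xA * (k - xA)) = \sum_(l <- L) \sum_(l' <- L) 2 * (in_A l (+) in_A l').
  rewrite -leaves_size -(mulnA 2 2) -sum_xor big_distrr /=.
  by apply: eq_bigr => l _; rewrite big_distrr.
rewrite /placed_dist -!big_split /=; apply: eq_big_seq => l lL.
rewrite -!big_split /=; apply: eq_big_seq => l' lL'; rewrite /fA /fC.
have [h|h] := boolP (in_A l); have [h'|h'] := boolP (in_A l'); rewrite /= ?gdistxx.
- by rewrite muln0 !addn0.
- by rewrite (cross_dist (inA _ lL h) (inC _ lL' h')) muln1; move: (gdist _ _) (gdist _ _); clear; lia.
- rewrite (gdist_sym Tc) (cross_dist (inA _ lL' h') (inC _ lL h)) muln1.
  rewrite (gdist_sym Tc _ (zn 0)) (gdist_sym Tc (zn 2)).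
  by move: (gdist _ _) (gdist _ _); clear; lia.
- by rewrite muln0 !addn0.
Qed.

(** The vertex [zn 3] certainly hangs at [zn 2] and gets the sharper [end_dist_sum]; all the others
    get the general maximum. *)
Lemma leaf_sums s : tree_seq (@gdist T) s -> uniq s -> s =i R -> size s = t ->
  2 * (\sum_(l <- L) dist_sum (@gdist T) s (@leaf_parent T l))
  + 2 * ((#|side 2| - 1) * (#|side 0|).+1) <= k * (t * t.-1).
Proof.
move=> ts us sR ss; have DL : zn 3 \in L by rewrite mem_enum inE DR.
rewrite (perm_big _ (perm_to_rem DL)) /= big_cons square_parent_last.
have h1 : 2 * (\sum_(l <- rem (zn 3) L) dist_sum (@gdist T) s (@leaf_parent T l)) <=
    k.-1 * (t * t.-1).
  rewrite -leaves_size -(size_rem DL) -sum1_size big_distrl big_distrr /= !big_seq.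
  apply: leq_sum => l; rewrite mem_rem_uniq ?enum_uniq // inE => /andP[_ lL].
  rewrite mul1n -ss; apply: (dist_sum_le (@gdistxx T) (gdist_sym Tc) ts).
  exact: (leaf_parent_seq Ttree T2 cR sR).
have -> : k * (t * t.-1) = k.-1 * (t * t.-1) + t * t.-1.
  by rewrite -{1}(prednK (_ : 0 < k)) ?mulSn ?[t * t.-1 + _]addnC //; move: m1 mn; clear; lia.
by rewrite mulnDr addnAC addnC; apply: leq_add h1 (end_dist_sum us sR).
Qed.

Lemma square_tree_bound :
  3 * (\sum_(x : T) \sum_(y : T) gdist x y)
  + 6 * ((#|side 2| - 1) * (#|side 0|).+1) + 12 * (c * a) <= B + 12 * (xA * (k - xA)).
Proof.
have [s [ts us sR ss]] := core_seq Ttree cR square_root_core; rewrite Rt in ss.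
have sL := core_leaves Rt.
have [H1 _] := core_sums_le Ttree T2 cR ts sR.
have p1 : 0 < #|side 0| by apply/card_gt0P; exists (zn 0); rewrite side_root.
have p2 : 0 < #|side 2| by apply/card_gt0P; exists (zn 2); rewrite side_root.
apply: (square_sum_arith p1 p2 card_core_sides _ _ _ side_placed).
- by have E := core_total Ttree T2 cR us sR sL; rewrite ss in E; apply: E.
- by rewrite ss in H1; apply: H1.
- by rewrite -ac; apply: leaf_sums ts us sR ss.
Qed.

Lemma square_defect_le : defect G m <= 2 * (t - 2) + 2 * c.
Proof. by rewrite /defect; case: (leqP k 3); move: m1 mn; clear; lia. Qed.

(** For k <= 3 the equation n - 2 = 2(t - 2) + 2c reads t = k + 2 - 2c, and t >= 3 leaves t = 3 with
    k = 1 or k = 3. These are the exceptional pairs (4, 2) and (6, 2). *)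
Lemma square_defect_eq : defect G m = 2 * (t - 2) + 2 * c ->
  3 < k \/ m = 2 /\ (k = 1 \/ k = 3).
Proof. by rewrite /defect; case: (leqP k 3); move: m1 mn; clear; lia. Qed.

Let side0_gt0 : 0 < #|side 0|. Proof. by apply/card_gt0P; exists (zn 0); rewrite side_root. Qed.
Let side2_gt0 : 0 < #|side 2|. Proof. by apply/card_gt0P; exists (zn 2); rewrite side_root. Qed.

Let xA_le : xA <= a + c.
Proof. by rewrite -ac -leaves_size /xA; apply: count_size. Qed.

Let loss_bound : 6 * Wiener G + 6 * (2 * (#|side 0| + xA)) <=
  3 * (\sum_(x : T) \sum_(y : T) gdist x y).
Proof. by have := loss_le Gc Hz; rewrite square_loss square_root_size. Qed.

Let other_root_size : #|side 2| - 1 + (a + c - xA) <= #|side 0| + xA.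
Proof.
have := square_size; have := w20; rewrite square_root_size -ac.
have := xA_le; have := card_core_sides; have := side2_gt0; rewrite -ac.
by move: (w 2) mn; move: xA #|side 0| #|side 2|; clear; lia.
Qed.

Let tree_bd : 3 * (\sum_(x : T) \sum_(y : T) gdist x y)
  + 6 * ((#|side 2| - 1) * (#|side 0|).+1) + 12 * (c * a) <= B + 12 * (xA * (a + c - xA)).
Proof. by rewrite -ac; apply: square_tree_bound. Qed.

Lemma square_le : 6 * Wiener G + 6 * defect G m <= B.
Proof.
exact: (square_bound_arith side0_gt0 side2_gt0 card_core_sides ca xA_le loss_bound
          tree_bd square_defect_le).1.
Qed.

Lemma square_dumbbell : 6 * Wiener G + 6 * defect G m = B -> exists q, dumbbell R q.
Proof.
move=> E; have [s [ts us sR ss]] := core_seq Ttree cR square_root_core; rewrite Rt in ss.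
have sL := core_leaves Rt.
have [||//|gap] := core_gap Ttree T2 cR ts us sR.
- by rewrite Rt; move: m1; clear; lia.
- have mnT : 2 * m <= #|T| := mn.
  by rewrite Rt; move: m1 mnT; clear; lia.
case: (square_gap_arith side0_gt0 side2_gt0 card_core_sides _ ca xA_le loss_bound
          tree_bd _ other_root_size square_defect_le E).
  by move: m1; clear; lia.
rewrite -ac; apply: (square_sum_gap_arith side0_gt0 side2_gt0 card_core_sides _ _ side_placed).
- by have E' := core_total Ttree T2 cR us sR sL; rewrite ss in E'; apply: E'.
- by rewrite ss sL in gap.
Qed.

(** A vertex at position i >= 1 of the path is at distance i - 1 from [zn 1], which has position 1;
    but a vertex of [side 2] is reached from [zn 1] through [zn 2], at distance i + 1. *)
Lemma dumbbell_side2 (q : seq T) : dumbbell R q -> nth x0 q 0 = zn 2 ->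
  nth x0 q 1 = zn 1 /\ forall v, v \in side 2 -> v = zn 2.
Proof.
move=> qd q0; have [qR uq oq ends] := qd.
have q1 : nth x0 q 1 = zn 1.
  apply: (dumbbell_nth qd); first exact: square_mid_core.
  by rewrite q0; apply/eqP; rewrite (gdist_eq1 Tc) adj_sym square_edge.
split=> // v v2; have vR : v \in R by move: v2; rewrite inE => /andP[].
have vq : v \in q by rewrite qR.
have lv : index v q < size q by rewrite index_mem.
have s1 : 1 < size q by rewrite -(card_uniqP uq) (eq_card qR) Rt; move: m1; clear; lia.
have dC : @gdist T (zn 2) v = index v q.
  by rewrite -q0 -{1}(nth_index x0 vq) oq // ?subn0 //; apply: leq_ltn_trans lv.
have dB : @gdist T (zn 1) v = (1 - index v q) + (index v q - 1).
  by rewrite -q1 -{1}(nth_index x0 vq) oq.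
have iv : branch_index z v = 2.
  by rewrite /branch_index (side_branch v2) index_uniq ?s4 // (sole_cycle_uniq Hz).
have := @opened_dist _ Gc _ Hz (zn 1) v; rewrite bidx // iv (side_branch v2).
rewrite (branch_id Gc Hz) ?zmem // gdistxx dC dB => /(_ isT) E.
have i0 : index v q = 0 by move: E; clear; lia.
by rewrite -q0 -i0 nth_index.
Qed.

Lemma dumbbell_far_end (q : seq T) l : dumbbell R q -> nth x0 q 0 = zn 2 -> l \in L ->
  @leaf_parent T l = nth x0 q (if in_A l then t.-1 else 0).
Proof.
move=> qd q0 lL; have [qR uq oq ends] := qd; have [_ C2] := dumbbell_side2 qd q0.
have := leaf_side lL; rewrite -/(in_A l); case: ifP => _ pl; last by rewrite q0; apply: C2.
case: (ends x0 _ (LR lL)) => E; last by rewrite E Rt.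
have := side_branch pl; rewrite E q0 (branch_id Gc Hz) ?zmem // => /eqP.
by rewrite (negPf (zneq _ _ _)).
Qed.

Lemma dumbbell_balanced (q : seq T) : dumbbell R q -> nth x0 q 0 = zn 2 ->
  6 * Wiener G + 6 * defect G m = B -> #|side 2| = 1 /\ xA = c.
Proof.
move=> qd q0 E; have [qR uq oq ends] := qd; have [_ C2] := dumbbell_side2 qd q0.
have side2_1 : #|side 2| = 1.
  by apply/eqP/cards1P; exists (zn 2); apply/setP => v; rewrite in_set1; apply/idP/eqP => [/C2//|->];
     apply: side_root.
split=> //; have [_ /(_ E)[Ee Ex _]] := square_bound_arith side0_gt0 side2_gt0 card_core_sides
  ca xA_le loss_bound tree_bd square_defect_le.
have [s [ts us sR ss]] := core_seq Ttree cR square_root_core; rewrite Rt in ss.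
have sL := core_leaves Rt; have [W1 W2] := core_sums_le Ttree T2 cR ts sR.
have qs : size q = t by rewrite -Rt -(card_uniqP uq); apply: eq_card.
have pt : (#|side 0|).+2 = t by have := card_core_sides; rewrite side2_1; clear; lia.
have owle := other_root_size; rewrite side2_1 subnn add0n in owle.
apply: (square_dumbbell_arith side0_gt0 pt ca xA_le loss_bound _ owle Ex E Ee).
apply: dumbbell_sum_arith.
- by have E' := core_total Ttree T2 cR us sR sL; rewrite ss in E'; apply: E'.
- by rewrite ss in W1; apply: W1.
- by rewrite ss sL in W2; apply: W2.
rewrite -ac -leaves_size -sum_xor big_distrr /= /placed_dist !big_seq.
apply: leq_sum => l lL; rewrite big_distrr /= !big_seq; apply: leq_sum => l' lL'.
rewrite (dumbbell_far_end qd q0 lL) (dumbbell_far_end qd q0 lL') oq.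
- by case: (in_A l); case: (in_A l'); rewrite /= ?muln0 ?muln1; clear; lia.
- by case: ifP; rewrite qs; move: m1; clear; lia.
- by case: ifP; rewrite qs; move: m1; clear; lia.
Qed.

(** Of the [n - t] vertices outside the core, half, rounded down, hang at the far end A_j. One of
    those at C_0 = [zn 2] is [zn 3], which becomes D_0; hence the predecessor in the second
    parameter. *)
Lemma square_iso (q : seq T) n : #|G| = n -> dumbbell R q -> nth x0 q 0 = zn 2 ->
  xA = c ->
  isomorphic G (G4 (n - t)./2 ((n - t).-1 - (n - t)./2) (2 * m - 4)).
Proof.
move=> nG qd q0 xAc; have [qR uq oq ends] := qd; have [q1 _] := dumbbell_side2 qd q0.
have nm : 2 * m <= n by rewrite -nG.
have kE : k = n - t by rewrite nG.
set a' := (n - t)./2; set c' := _ - a'; set j := 2 * m - 4.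
have qs : size q = t by rewrite -Rt -(card_uniqP uq); apply: eq_card.
have AR := square_root_core.
have DL : zn 3 \in L by rewrite mem_enum inE DR.
have uL : uniq L := enum_uniq _.
have A3 : in_A (zn 3) = false.
  by rewrite /in_A square_parent_last (branch_id Gc Hz) ?zmem // (negPf (zneq _ _ _)).
pose LA := filter in_A (rem (zn 3) L); pose LC := filter (predC in_A) (rem (zn 3) L).
have sA : size LA = a'.
  rewrite size_filter /a' -kE -xAc /xA.
  by rewrite (seq.permP (perm_to_rem DL)) /= A3.
have sC : size LC = c'.
  have := count_predC in_A (rem (zn 3) L); rewrite -!size_filter -/LA -/LC sA.
  by rewrite size_rem // leaves_size kE /c' => <-; rewrite addKn.
have q2 : nth x0 q 2 = zn 0.
  apply: (dumbbell_nth qd AR); rewrite q0 (gdist_sym Tc).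
  by rewrite (cross_dist (side_root _) (side_root _)) // !gdistxx.
(* [q] begins with C_0, B_0, A_0, so [drop 2 q] lists A_0, ..., A_j. As in the numbering of [G4],
   the pendant vertices of A_j precede those of C_0. *)
pose s : seq G := drop 2 q ++ zn 1 :: zn 2 :: zn 3 :: LA ++ LC.
have sz : size s = a' + c' + j + 4.
  rewrite size_cat size_drop qs /= size_cat sA sC /j.
  by move: (a' + c') m1; clear; lia.
have szn : size s = n by rewrite sz /a' /c' /j; move: m1 nm; clear; lia.
have js : size (drop 2 q) = j.+1 by rewrite size_drop qs /j; move: m1; clear; lia.
have sG : s =i predT.
  move=> x; rewrite inE mem_cat !inE mem_cat; apply/idP.
  have [xR|xR] := boolP (x \in R).
    have : x \in q by rewrite qR.
    case: (q) q0 q1 => [|y [|y' q']] //= -> E; rewrite ?inE.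
      by move=> ->; rewrite ?orbT.
    rewrite drop0 -E => /predU1P[->|/predU1P[->|->]] //; first by rewrite eqxx !orbT.
    by rewrite eqxx !orbT.
  have [->|xD] := eqVneq x (zn 3); first by rewrite !orbT.
  rewrite !mem_filter mem_rem_uniq // !inE xD mem_enum inE xR !andbT.
  by rewrite orbN !orbT.
have us : uniq s.
  by apply/card_uniqP; rewrite (eq_card sG) szn -[LHS]/#|G| nG.
have nq i : i <= j -> nth x0 s i = nth x0 q i.+2.
  by move=> li; rewrite nth_cat js ltnS li nth_drop.
have nB : nth x0 s j.+1 = zn 1 by rewrite nth_cat js ltnn subnn.
have nC : nth x0 s j.+2 = zn 2 by rewrite nth_cat js ltnNge leqnSn /= subSnn.
have nD : nth x0 s j.+3 = zn 3.
  rewrite nth_cat js ltnNge (leq_trans (leqnSn _) (leqnSn _)) /=.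
  by have -> : j.+3 - j.+1 = 2 by clear; lia.
have lt_eq i h : i < size s -> h < size s -> (nth x0 s i == nth x0 s h) = (i == h).
  by move=> li lj; rewrite nth_uniq.
apply: (isomorphic_arcs us sG sz) => u v uv lv; rewrite -sz in lv.
have lu := ltn_trans uv lv.
pose ix i := if i <= j then i.+2 else if i == j.+1 then 1 else 0.
have dq i : i <= j.+2 -> nth x0 s i = nth x0 q (ix i).
  move=> li; rewrite /ix; case: leqP => [/nq //|ji].
  case: eqP => [->|ne]; first by rewrite nB q1.
  have -> : i = j.+2 by move: li ji ne; clear; lia.
  by rewrite nC q0.
have ixq i : i <= j.+2 -> ix i < size q.
  move=> _; rewrite /ix qs; case: ifP => [|_]; first by rewrite /j; move: m1; clear; lia.
  by case: ifP => _; move: m1; clear; lia.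
have nR i : i <= j.+2 -> nth x0 s i \in R.
  by move=> li; rewrite dq // -qR mem_nth // ixq.
have [v1|v1] := leqP v j.+2.
  have u1 := leq_trans (ltnW uv) v1.
  apply: (etrans (adj_core Hz KR (nR u u1) (nR v v1))).
  rewrite (dq u u1) (dq v v1) oq ?ixq // G4_arcs_core // /ix; move: uv v1; clear.
  move: (j) => {}j uv v1; have u1 : u <= j.+1 by lia.
  case: (leqP u j) => hu; last first.
    have -> : u = j.+1 by lia.
    have -> : v = j.+2 by lia.
    have -> : (j.+2 <= j) = false by lia.
    have -> : (j.+2 == j.+1) = false by lia.
    by rewrite !eqxx !orbT.
  case: (leqP v j) => hv; first lia.
  by case: (v =P j.+1) => hv'; lia.
have s0 : 0 < size s by apply: leq_ltn_trans lv.
have n0 : nth x0 s 0 = zn 0 by rewrite nq ?q2.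
have jlt : j.+3 < size s by rewrite sz; clear; lia.
have jlt2 : j.+2 < size s by apply: ltnW.
have jlt0 : j < size s by apply: ltnW (ltnW _).
move: v1; rewrite leq_eqVlt => /predU1P[Ev|v1].
  rewrite -Ev nD; apply: (etrans (adj_off_core Hz G2 cR AR (nth x0 s u) DR)).
  rewrite square_parent_last s4 /= eqxx -nC -n0 /= !lt_eq //.
  by rewrite /G4_arcs; move: uv; rewrite -Ev; clear; move: (j) (a') => {}j {}a'; lia.
have nv : nth x0 s v = nth x0 (LA ++ LC) (v - j.+4).
  rewrite nth_cat js ltnNge (ltnW (ltnW (ltnW v1))) /=.
  have -> : v - j.+1 = (v - j.+4).+3 by move: v1; clear; lia.
  by [].
have lvA : v - j.+4 < size (LA ++ LC).
  by move: lv v1; rewrite sz size_cat sA sC; clear; lia.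
have vAC : nth x0 s v \in LA ++ LC by rewrite nv mem_nth.
have vrem : nth x0 s v \in rem (zn 3) L.
  by move: vAC; rewrite mem_cat !mem_filter => /orP[]/andP[].
have /andP[vD vL] : (nth x0 s v != zn 3) && (nth x0 s v \in L).
  by move: vrem; rewrite mem_rem_uniq // inE.
have vR := LR vL.
have pv : @leaf_parent T (nth x0 s v) = nth x0 s (if v < j.+4 + a' then j else j.+2).
  rewrite (dumbbell_far_end qd q0 vL) nv nth_cat sA.
  have -> : (v < j.+4 + a') = (v - j.+4 < a') by move: v1; clear; lia.
  case: ltnP => h.
    have : nth x0 LA (v - j.+4) \in LA by rewrite mem_nth ?sA.
    rewrite mem_filter => /andP[-> _]; rewrite nq //.
    by congr nth; rewrite /j; move: m1; clear; lia.
  have : nth x0 LC (v - j.+4 - a') \in LC.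
    by rewrite mem_nth ?sC //; move: lvA h; rewrite size_cat sA sC; clear; lia.
  by rewrite mem_filter => /andP[/negPf /= -> _]; rewrite nC q0.
apply: (etrans (adj_off_core Hz G2 cR AR (nth x0 s u) vR)).
rewrite pv s4 /= (negPf vD) andFb orbF.
have -> : (nth x0 s u == nth x0 s (if v < j.+4 + a' then j else j.+2)) =
    (u == if v < j.+4 + a' then j else j.+2) by apply: lt_eq => //; case: ifP.
by rewrite G4_arcs_pendant.
Qed.

Lemma square_eq n : #|G| = n -> 6 * Wiener G + 6 * defect G m = B ->
  (3 < k \/ m = 2 /\ (k = 1 \/ k = 3)) /\
  isomorphic G (G4 (n - t)./2 ((n - t).-1 - (n - t)./2) (2 * m - 4)).
Proof.
move=> nG E; split.
  apply: square_defect_eq.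
  by have [_ /(_ E)[]] := square_bound_arith side0_gt0 side2_gt0 card_core_sides
    ca xA_le loss_bound tree_bd square_defect_le.
have [q qd] := square_dumbbell E.
have [q' [qd' q0]] := dumbbell_oriented square_root_core KR qd.
rewrite s4 /= square_parent_last in q0.
by have [_ xc] := dumbbell_balanced qd' q0 E; apply: square_iso nG qd' q0 xc.
Qed.

End WithCore.

Lemma square_bound : 6 * Wiener G + 6 * defect G m <= B /\
  (6 * Wiener G + 6 * defect G m = B -> forall n, #|G| = n ->
    (3 < k \/ m = 2 /\ (k = 1 \/ k = 3)) /\
    isomorphic G (G4 (n - t)./2 ((n - t).-1 - (n - t)./2) (2 * m - 4))).
Proof.
have [R [cR Rt DR]] := opened_core m1 mG mn Hz square_last_leaf.
split=> [|E n nG]; first exact: (square_le cR Rt DR).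
exact: (square_eq cR Rt DR nG E).
Qed.

End Square.

(** * The extremal graphs *)

Lemma isomorphic_connected (G H : sgraph) : connected G -> isomorphic G H -> connected H.
Proof.
move=> [/card_gt0P[g _] Gc] [f [f' fK f'K] fadj]; split; first by apply/card_gt0P; exists (f g).
move=> x y; rewrite -(f'K x) -(f'K y); case/connectP: (Gc (f' x) (f' y)) => p pp ->.
rewrite -last_map; apply/connectP; exists (map f p) => //.
by elim: p (f' x) pp => //= a p IH z /andP[za /IH ->]; rewrite fadj za.
Qed.

(** * Lower bounds for the Wiener indices of the extremal graphs *)

Section Levels.

Definition gap x y := (x - y) + (y - x).

Lemma gapxx x : gap x x = 0. Proof. by rewrite /gap subnn. Qed.

Lemma gap0n x : gap 0 x = x. Proof. by rewrite /gap subn0. Qed.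

Lemma gapn0 x : gap x 0 = x. Proof. by rewrite /gap subn0 addn0. Qed.

Definition gap_sum (r s : seq nat) := \sum_(x <- r) \sum_(y <- s) gap x y.

Lemma gap_sum_catl r1 r2 s : gap_sum (r1 ++ r2) s = gap_sum r1 s + gap_sum r2 s.
Proof. by rewrite /gap_sum big_cat. Qed.

Lemma gap_sum_catr r s1 s2 : gap_sum r (s1 ++ s2) = gap_sum r s1 + gap_sum r s2.
Proof. by rewrite /gap_sum -big_split; apply: eq_bigr => x _; rewrite big_cat. Qed.

Lemma gap_sumC r s : gap_sum r s = gap_sum s r.
Proof.
by rewrite /gap_sum exchange_big; do 2 apply: eq_bigr => ? _; rewrite /gap addnC.
Qed.

Lemma gap_sum_nseq n p s : gap_sum (nseq n p) s = n * gap_sum [:: p] s.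
Proof. by rewrite /gap_sum big_nseq big_seq1 iter_addn_0 mulnC. Qed.

Lemma gap_sum_nseqr n p s : gap_sum s (nseq n p) = n * gap_sum [:: p] s.
Proof. by rewrite gap_sumC gap_sum_nseq. Qed.

Lemma gap_sum1 p q : gap_sum [:: p] [:: q] = gap p q.
Proof. by rewrite /gap_sum !big_seq1. Qed.

Lemma gap_sum_below p b n : p <= b ->
  2 * gap_sum [:: p] (iota b n) + n = 2 * (n * (b - p)) + n * n.
Proof.
move=> pb; rewrite /gap_sum big_seq1.
elim: n b pb => [|n IH] b pb; first by rewrite big_nil.
rewrite /= big_cons [gap p b]/gap; have := IH b.+1 (leqW pb).
have -> : p - b + (b - p) = b - p by lia.
have -> : b.+1 - p = (b - p).+1 by lia.
move: (\sum_(y <- _) _) (b - p) => A e; nia.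
Qed.

Lemma gap_sum_above p b n : b + n <= p.+1 ->
  2 * gap_sum [:: p] (iota b n) + n * n = 2 * (n * (p - b)) + n.
Proof.
rewrite /gap_sum big_seq1.
elim: n b => [|n IH] b pb; first by rewrite big_nil.
rewrite /= big_cons [gap p b]/gap.
have -> : p - b + (b - p) = p - b by lia.
case: n IH pb => [|n] IH pb; first by rewrite big_nil; lia.
have {IH} := IH b.+1 ltac:(lia).
have [e E] : exists e, p - b = n.+1 + e by exists (p - b - n.+1); lia.
have -> : p - b.+1 = n + e by lia.
rewrite E; move: (\sum_(y <- _) _) => A; nia.
Qed.

Lemma gap_sum_iota b n : 3 * gap_sum (iota b n) (iota b n) + n = n ^ 3.
Proof.
elim: n b => [|n IH] b; first by rewrite /gap_sum big_nil.
have -> : iota b n.+1 = [:: b] ++ iota b.+1 n by [].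
rewrite gap_sum_catl !gap_sum_catr (gap_sumC (iota _ _) [:: b]) gap_sum1.
have := gap_sum_below n (leqnSn b); have := IH b.+1; rewrite /gap subnn subSnn !expnS expn0.
move: (gap_sum _ _) (gap_sum _ _) => A B; nia.
Qed.

(* A level function changing by at most one along each arc bounds the distance of
   two vertices below by their level gap; [e] adds the distances inside levels. *)
Lemma arcs_Wiener_ge N (r : rel nat) (f : nat -> nat) (e : nat -> nat -> nat) :
  connected (graph_of_arcs N r) ->
  (forall u v, u < N -> v < N -> r u v -> f u <= (f v).+1 /\ f v <= (f u).+1) ->
  (forall u v, u < N -> v < N -> 0 < e u v ->
     [/\ f u = f v, u != v & e u v <= if r u v || r v u then 1 else 2]) ->
  gap_sum (map f (iota 0 N)) (map f (iota 0 N)) +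
  \sum_(u <- iota 0 N) \sum_(v <- iota 0 N) e u v <= 2 * Wiener (graph_of_arcs N r).
Proof.
move=> Hc rf He; rewrite (Wiener_double Hc).
have ordE (F : nat -> nat) : \sum_(u <- iota 0 N) F u = \sum_(u < N) F u.
  by rewrite -[in RHS](big_mkord xpredT) /index_iota subn0.
rewrite /gap_sum big_map !ordE -big_split /=; apply: leq_sum => u _.
rewrite big_map !ordE -big_split /=; apply: leq_sum => v _.
have H : forall x y : graph_of_arcs N r, f (y : 'I_N) <= f (x : 'I_N) + gdist x y.
  move=> x y; apply: (gdist_lipschitz Hc (f := fun i : graph_of_arcs N r => f (i : 'I_N))).
  by move=> a b /andP[_ /orP[]] /rf; case.
have h1 := H u v; have h2 := H v u; rewrite (gdist_sym Hc v u) in h2.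
have [e0|e0] := posnP (e u v); first by rewrite e0 /gap; lia.
have [fuv nuv le] := He u v (ltn_ord u) (ltn_ord v) e0.
rewrite /gap fuv subnn add0n; apply: leq_trans le _.
have n0 : 0 < @gdist (graph_of_arcs N r) u v by rewrite gdist_gt0.
case: ifP => nr; first by [].
rewrite ltn_neqAle n0 andbT eq_sym (gdist_eq1 Hc).
by rewrite /= /arcs_adj nr andbF.
Qed.

Lemma sum_pairs_neq (P : pred nat) s : uniq s ->
  \sum_(u <- s) \sum_(v <- s) [&& P u, P v & u != v] = count P s * (count P s).-1.
Proof.
elim: s => [|x s IH] /= => [_|/andP[xs us]]; first by rewrite big_nil.
rewrite big_cons big_cons eqxx !andbF add0n.
under [X in _ + X]eq_bigr => u _ do rewrite big_cons.
rewrite big_split /= IH //.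
have E1 : \sum_(v <- s) [&& P x, P v & x != v] = P x * count P s.
  rewrite -sum1_count big_distrr /= [RHS]big_mkcond !big_seq; apply: eq_bigr => v vs.
  by rewrite (contraNneq _ xs) ?andbT => [|->//]; case: (P x); case: (P v).
have -> : \sum_(u <- s) [&& P u, P x & u != x] = P x * count P s.
  by rewrite -E1; apply: eq_bigr => u _; rewrite andbCA eq_sym.
by rewrite E1; case: (P x) => /=; case: (count P s) => *; lia.
Qed.

Lemma count_range lo hi N :
  count (fun u => lo <= u < hi) (iota 0 N) = minn hi N - lo.
Proof.
elim: N => [|N IH]; first by rewrite minn0.
by rewrite -[N.+1]addn1 iotaD count_cat IH /= add0n; lia.
Qed.

Lemma map_iota_nseq (f : nat -> nat) b n p :
  (forall i, b <= i < b + n -> f i = p) -> map f (iota b n) = nseq n p.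
Proof.
move=> H; apply/(@eq_from_nth _ 0); rewrite ?size_map ?size_iota ?size_nseq // => i ia.
by rewrite (nth_map 0) ?size_iota // nth_iota // nth_nseq ia H //; lia.
Qed.

Lemma map_iota_shift (f : nat -> nat) b n q :
  (forall i, b <= i < b + n -> f i + b = i + q) -> map f (iota b n) = iota q n.
Proof.
move=> H; apply: (@eq_from_nth _ 0); rewrite ?size_map ?size_iota // => i ij.
by rewrite (nth_map 0) ?size_iota // !nth_iota //; have := H (b + i); lia.
Qed.

End Levels.

Lemma Wiener_G3_ge a j : connected (G3 a j) ->
  (j.+1 ^ 3 - j.+1) + 3 * (2 * (j.+1 * j.+2) + a * (j.+1 * j.+2) + 2 + 4 * (a * j.+2))
  + 3 * (2 * (a * a.-1)) <= 6 * Wiener (G3 a j).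
Proof.
(* Levels: B_0 and C_0 at 0, A_i at i + 1, pendant vertices at j + 2. Inside a level, [e] supplies 1
   for B_0 and C_0 and 2 for two pendant vertices. *)
move=> Hc; pose f u := if u <= j then u.+1 else if u <= j.+2 then 0 else j.+2.
pose P u := j.+3 <= u < a + j + 3; pose Q u := j < u < j.+3.
pose e u v : nat := 2 * [&& P u, P v & u != v] + [&& Q u, Q v & u != v].
have := @arcs_Wiener_ge (a + j + 3) (G3_arcs j) f e Hc.
have -> : map f (iota 0 (a + j + 3)) = iota 1 j.+1 ++ nseq 2 0 ++ nseq a j.+2.
  have -> : a + j + 3 = j.+1 + (2 + a) by lia.
  rewrite !iotaD !map_cat; congr (_ ++ (_ ++ _)).
  - by apply: map_iota_shift => i; rewrite /f; case: ifP; lia.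
  - by apply: map_iota_nseq => i; rewrite /f; case: ifP => h; [lia | case: ifP; lia].
  - by apply: map_iota_nseq => i; rewrite /f; case: ifP => h; [lia | case: ifP; lia].
have -> : \sum_(u <- iota 0 (a + j + 3)) \sum_(v <- iota 0 (a + j + 3)) e u v =
    2 * (a * a.-1) + 2.
  under eq_bigr => u _ do rewrite /e big_split -big_distrr /=.
  rewrite big_split -big_distrr /= !sum_pairs_neq ?iota_uniq // !count_range.
  have -> : minn (a + j + 3) (a + j + 3) - j.+3 = a by lia.
  by have -> : minn j.+3 (a + j + 3) - j.+1 = 2 by lia.
rewrite !gap_sum_catl !gap_sum_catr !gap_sum_nseqr !gap_sum_nseq !gap_sum1.
have below := @gap_sum_below 0 1 j.+1 isT; have above := @gap_sum_above j.+2 1 j.+1 (leqnSn _).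
have mid := gap_sum_iota 1 j.+1.
move=> H.
apply: leq_trans (_ : 3 * (2 * Wiener (G3 a j)) <= _); last by rewrite mulnA.
apply: leq_trans (leq_mul (leqnn 3) (H _ _)).
- have le3 : j.+1 <= j.+1 ^ 3 by rewrite -{1}[j.+1]expn1 leq_pexp2l.
  have {}below : 2 * gap_sum [:: 0] (iota 1 j.+1) = j.+1 * j.+2.
    by move: below; rewrite subn0 muln1; move: (gap_sum _ _) => X; clear; nia.
  have {}above : 2 * gap_sum [:: j.+2] (iota 1 j.+1) = j.+1 * j.+2.
    by move: above; rewrite subn1 /=; move: (gap_sum _ _) => X; clear; nia.
  have {}above := congr1 (muln a) above; rewrite mulnCA in above.
  rewrite !gapxx gap0n gapn0 !(mulnCA a 2) !muln0.
  move: mid below above le3.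
  move: (gap_sum _ _) (a * gap_sum _ _) (gap_sum _ _) (j.+1 ^ 3).
  move: (j.+1 * j.+2) (a * (_ * _)) (a * j.+2) (a * a.-1); clear; lia.
- move=> u v uN vN; rewrite /G3_arcs /f => arc; move: uN vN arc; clear.
  by case: (leqP u j) => h1; case: (leqP v j) => h2; try (case: (leqP u j.+2) => h3);
     try (case: (leqP v j.+2) => h4); lia.
- move=> u v uN vN; rewrite /e /f.
  case: (boolP [&& P u, P v & u != v]) => [/and3P[Pu Pv uv] _|_]; last first.
    case: (boolP [&& Q u, Q v & u != v]) => [/and3P[Qu Qv uv] _|_] //.
    split=> //; last by case: ifP.
    by move: Qu Qv; rewrite /Q; do ! case: ifP; lia.
  have -> : [&& Q u, Q v & u != v] = false by move: Pu; rewrite /Q /P; lia.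
  split=> //; first by move: Pu Pv; rewrite /P; do ! case: ifP; lia.
  have -> : G3_arcs j u v = false by move: Pu Pv; rewrite /P /G3_arcs; lia.
  by have -> : G3_arcs j v u = false by move: Pu Pv; rewrite /P /G3_arcs; lia.
Qed.

Lemma Wiener_G4_ge a c j : connected (G4 a c j) ->
  (j.+1 ^ 3 - j.+1)
  + 3 * (2 * (j.+1 * j.+2) + j.+1 * j.+4 + a * (j.+1 * j.+2) + c * (j.+1 * (j + 6)))
  + 3 * (4 + 2 * (a * (3 * j + 7)) + 10 * c + 2 * (a * (c * j.+4)))
  + 3 * (2 * (a * a.-1) + 2 * (c * c.-1) + 4) <= 6 * Wiener (G4 a c j).
Proof.
move=> Hc; pose N := a + c + j + 4.
(* Levels: pendant vertices of C_0 at 0, C_0 at 1, B_0 and D_0 at 2, A_i at i + 3, pendant vertices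
   of A_j at j + 4. Distinct vertices of one level are at distance 2. *)
pose f u := if u <= j then u + 3 else if u == j.+2 then 1 else if u <= j.+3 then 2
            else if u < j.+4 + a then j.+4 else 0.
pose P u := j.+4 <= u < j.+4 + a; pose P' u := j.+4 + a <= u < N.
pose Q u := (u == j.+1) || (u == j.+3).
pose e u v : nat := 2 * [&& P u, P v & u != v] + 2 * [&& P' u, P' v & u != v]
                    + 2 * [&& Q u, Q v & u != v].
have := @arcs_Wiener_ge N (G4_arcs a j) f e Hc.
have NE : N = j.+1 + (3 + (a + c)) by rewrite /N; lia.
have -> : map f (iota 0 N) = iota 3 j.+1 ++ [:: 2; 1; 2] ++ nseq a j.+4 ++ nseq c 0.
  rewrite NE !iotaD !map_cat; congr (_ ++ (_ ++ (_ ++ _))).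
  - by apply: map_iota_shift => i; rewrite /f; case: ifP; lia.
  - rewrite /= /f; have -> : (0 + j.+1 <= j) = false by lia.
    have -> : ((0 + j.+1).+1 <= j) = false by lia.
    have -> : ((0 + j.+1).+2 <= j) = false by lia.
    have -> : (0 + j.+1 == j.+2) = false by lia.
    have -> : ((0 + j.+1).+2 == j.+2) = false by lia.
    by rewrite !add0n eqxx leqnn (leq_trans (leqnSn _) (leqnSn _)).
  - apply: map_iota_nseq => i h; rewrite /f.
    have -> : (i <= j) = false by lia.
    have -> : (i == j.+2) = false by lia.
    have -> : (i <= j.+3) = false by lia.
    by have -> : i < j.+4 + a by lia.
  - apply: map_iota_nseq => i h; rewrite /f.
    have -> : (i <= j) = false by lia.
    have -> : (i == j.+2) = false by lia.
    have -> : (i <= j.+3) = false by lia.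
    by have -> : (i < j.+4 + a) = false by lia.
have cQ : count Q (iota 0 N) = 2.
  have out b n : (forall i, b <= i < b + n -> Q i = false) -> count Q (iota b n) = 0.
    move=> H; apply/eqP; rewrite -leqn0 leqNgt -has_count; apply/hasPn => i.
    by rewrite mem_iota => /H ->.
  rewrite NE !iotaD !count_cat out; last by move=> i; rewrite /Q; lia.
  rewrite [count Q (iota _ a)]out; last by move=> i; rewrite /Q; lia.
  rewrite [count Q (iota _ c)]out; last by move=> i; rewrite /Q; lia.
  by rewrite /= /Q !add0n; lia.
have -> : \sum_(u <- iota 0 N) \sum_(v <- iota 0 N) e u v =
    2 * (a * a.-1) + 2 * (c * c.-1) + 4.
  pose S p := \sum_(u <- iota 0 N) \sum_(v <- iota 0 N) [&& p u, p v & u != v].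
  have -> : \sum_(u <- iota 0 N) \sum_(v <- iota 0 N) e u v = 2 * S P + 2 * S P' + 2 * S Q.
    rewrite /S !big_distrr -!big_split /=; apply: eq_bigr => u _.
    by rewrite !big_distrr -!big_split /=.
  rewrite /S !sum_pairs_neq ?iota_uniq // !count_range cQ.
  have -> : minn (j.+4 + a) N - j.+4 = a by rewrite /N; lia.
  by have -> : minn N N - (j.+4 + a) = c by rewrite /N; lia.
have below2 : 2 * gap_sum [:: 2] (iota 3 j.+1) = j.+1 * j.+2.
  have := @gap_sum_below 2 3 j.+1 isT; rewrite muln1.
  by move: (gap_sum _ _) => X; clear; nia.
have below1 : 2 * gap_sum [:: 1] (iota 3 j.+1) = j.+1 * j.+4.
  have := @gap_sum_below 1 3 j.+1 isT; rewrite (_ : 3 - 1 = 2) //.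
  by move: (gap_sum _ _) => X; clear; nia.
have below0 : 2 * gap_sum [:: 0] (iota 3 j.+1) = j.+1 * (j + 6).
  have := @gap_sum_below 0 3 j.+1 isT; rewrite (_ : 3 - 0 = 3) //.
  by move: (gap_sum _ _) => X; clear; nia.
have above : 2 * gap_sum [:: j.+4] (iota 3 j.+1) = j.+1 * j.+2.
  have := @gap_sum_above j.+4 3 j.+1 (leqnSn _); rewrite (_ : j.+4 - 3 = j.+1); last by lia.
  by move: (gap_sum _ _) => X; clear; nia.
have mid := gap_sum_iota 3 j.+1.
have -> : [:: 2; 1; 2] = nseq 1 2 ++ nseq 1 1 ++ nseq 1 2 by [].
rewrite -?catA !gap_sum_catl !gap_sum_catr !gap_sum_nseqr !gap_sum_nseq !gap_sum1 !mul1n.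
move=> H.
apply: leq_trans (_ : 3 * (2 * Wiener (G4 a c j)) <= _); last by rewrite mulnA.
apply: leq_trans (leq_mul (leqnn 3) (H _ _)) => {H}.
- have le3 : j.+1 <= j.+1 ^ 3 by rewrite -{1}[j.+1]expn1 leq_pexp2l.
  have {}above := congr1 (muln a) above; rewrite mulnCA in above.
  have {}below0 := congr1 (muln c) below0; rewrite mulnCA in below0.
  have g21 : gap 2 1 = 1 by [].
  have g12 : gap 1 2 = 1 by [].
  have g2a : gap 2 j.+4 = j.+2 by rewrite /gap; lia.
  have ga2 : gap j.+4 2 = j.+2 by rewrite /gap; lia.
  have g1a : gap 1 j.+4 = j.+3 by rewrite /gap; lia.
  have ga1 : gap j.+4 1 = j.+3 by rewrite /gap; lia.
  rewrite !(gapxx, g21, g12, g2a, ga2, g1a, ga1, gap0n, gapn0) !muln0 !muln1.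
  move: mid below0 below1 below2 above le3 {Hc P P' Q e f cQ g21 g12 g2a ga2 g1a ga1}.
  have -> : c * (a * j.+4) = a * (c * j.+4) by rewrite mulnCA.
  have -> : a * (3 * j + 7) = 2 * (a * j.+2) + a * j.+3 by nia.
  move: (gap_sum (iota _ _) _) (c * gap_sum _ _) (a * gap_sum _ _) => A B C.
  move: (gap_sum _ _) (gap_sum _ _) (j.+1 ^ 3) => D E F.
  move: (c * (j.+1 * _)) => G; move: (a * (j.+1 * _)) (j.+1 * j.+4) => H1 H2.
  move: (j.+1 * j.+2) => H3.
  move: (a * (c * _)) (a * j.+2) (a * j.+3) (a * a.-1) (c * c.-1); clear; lia.
- move=> u v _ _; rewrite /G4_arcs.
  case/or4P=> [/andP[h /eqP->]|/andP[/eqP-> /eqP->]|/andP[/eqP-> /eqP->]|].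
  + by rewrite /f h (ltnW h); lia.
  + by rewrite /f leq0n ltnn; do ! case: ifP; lia.
  + by rewrite /f ltnn; do ! case: ifP; lia.
  case/or4P=> [/andP[/eqP-> /eqP->]|/andP[/eqP-> /eqP->]|/andP[/eqP-> h]|/andP[/eqP-> h]].
  + by rewrite /f; do ! case: ifP; lia.
  + by rewrite /f leq0n; do ! case: ifP; lia.
  + by rewrite /f; do ! case: ifP; lia.
  + by rewrite /f; do ! case: ifP; lia.
- move=> u v uN vN euv.
  have uv : u != v by apply: contraTneq euv => ->; rewrite /e eqxx !andbF.
  have PP' w : P w -> P' w = false by clear; rewrite /P /P'; lia.
  have PQ w : P w -> Q w = false by clear; rewrite /P /Q; lia.
  have P'Q w : P' w -> Q w = false by clear; rewrite /P' /Q; lia.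
  have [[Pu Pv]|[Pu Pv]|[Qu Qv]] : [\/ P u /\ P v, P' u /\ P' v | Q u /\ Q v].
  + move: euv; rewrite /e uv !andbT.
    case: (boolP (P u && P v)) => [/andP[]|_]; first by constructor 1.
    case: (boolP (P' u && P' v)) => [/andP[]|_]; first by constructor 2.
    by case: (boolP (Q u && Q v)) => [/andP[]|_] // ? ?; constructor 3.
  + rewrite /e !(PP' _ Pu) !(PQ _ Pu) Pu Pv uv /=; split=> //.
      by move: Pu Pv; rewrite /P /f; clear; do ! case: ifP; lia.
    have -> : G4_arcs a j u v = false by move: Pu Pv; rewrite /P /G4_arcs; clear; lia.
    by have -> : G4_arcs a j v u = false by move: Pu Pv; rewrite /P /G4_arcs; clear; lia.
  + have nPu : P u = false by apply: contraTF Pu => /PP' ->.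
    rewrite /e nPu !(P'Q _ Pu) Pu Pv uv /=; split=> //.
      by move: Pu Pv; rewrite /P' /f; clear; do ! case: ifP; lia.
    have -> : G4_arcs a j u v = false by move: Pu Pv; rewrite /P' /G4_arcs; clear; lia.
    by have -> : G4_arcs a j v u = false by move: Pu Pv; rewrite /P' /G4_arcs; clear; lia.
  + have nPu : P u = false by apply: contraTF Qu => /PQ ->.
    have nP'u : P' u = false by apply: contraTF Qu => /P'Q ->.
    rewrite /e nPu nP'u Qu Qv uv /=; split=> //.
      by move: Qu Qv; rewrite /Q /f; clear; do ! case: ifP; lia.
    have -> : G4_arcs a j u v = false by move: Qu Qv uv; rewrite /Q /G4_arcs; clear; lia.
    by have -> : G4_arcs a j v u = false by move: Qu Qv uv; rewrite /Q /G4_arcs; clear; lia.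
Qed.

Lemma cube_pred s : s.+1 ^ 3 - s.+1 = s * s.+1 * s.+2.
Proof. by rewrite !expnS expn0; lia. Qed.

(** * The integer form of the theorem *)

Section Extremal.

Variables (n m : nat).

Hypotheses (m1 : 1 < m) (mn : 2 * m <= n).

Let t := (2 * m).-1.

Let k := n - t.

Definition wiener_bound := tree_bound t k./2 (k - k./2).

Definition wiener_defect := if k <= 3 then n - 2 else 2 * (t - 2) + 2 * k./2.

Definition triangle_extremal G :=
  k <= 3 /\ isomorphic G (G3 (n - 2 * m) (2 * m - 3)).

Definition square_extremal G :=
  (3 < k \/ m = 2 /\ (k = 1 \/ k = 3)) /\
  isomorphic G (G4 k./2 (k.-1 - k./2) (2 * m - 4)).

Lemma Wiener_le_bound G : in_U n m G ->
  6 * Wiener G + 6 * wiener_defect <= wiener_bound /\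
  (6 * Wiener G + 6 * wiener_defect = wiener_bound ->
   triangle_extremal G \/ square_extremal G).
Proof.
move=> [Gn [Gc [C [[z [z2 zc CE]] uC]]] Gm].
have Hz : sole_cycle z.
  split=> // p p2 pc; rewrite -CE; symmetry; apply: uC; by exists p.
have Gm' : matching_number G <= m by rewrite Gm.
have Gn' : 2 * m <= #|G| by rewrite Gn.
have dE : defect G m = wiener_defect by rewrite /defect Gn.
have bE : tree_bound (2 * m).-1 (#|G| - (2 * m).-1)./2
      (#|G| - (2 * m).-1 - (#|G| - (2 * m).-1)./2) = wiener_bound.
  by rewrite Gn.
rewrite -dE -bE.
have [s4|s4] := ltnP 4 (size z).
  have s := strict_long Gc m1 Gm' Gn' Hz s4.
  by split; [apply: ltnW|move: s => /[swap] ->; rewrite ltnn].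
have [s3|s3] : size z = 3 \/ size z = 4.
- by move: z2 s4; clear; lia.
- case: (strict_triangle Gc m1 Gm' Gn' Hz s3) => [s|[r _ [w1 w2]]].
    by split; [apply: ltnW|move: s => /[swap] ->; rewrite ltnn].
  case: (triangle_bound m1 Gm' Gn' (sole_cycle_rot r Hz) _ w1 w2); first by rewrite size_rot.
  move=> le eq; split=> // /eq[k3 iso]; left; split; last exact: iso.
  by move: k3; rewrite Gn.
- case: (strict_square Gc m1 Gm' Gn' Hz s3) => [s|[r _ [w1 w2 w3]]].
    by split; [apply: ltnW|move: s => /[swap] ->; rewrite ltnn].
  case: (square_bound m1 Gm' Gn' (sole_cycle_rot r Hz) _ w1 w2 w3); first by rewrite size_rot.
  move=> le eq; split=> // /eq/(_ n Gn)[k3 iso]; right; split; last exact: iso.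
  by move: k3; rewrite Gn.
Qed.

(** With the upper bound of [Wiener_le_bound] available, equality needs only the lower estimate of
    [Wiener_G3_ge]. *)
Lemma triangle_attains G : connected G -> triangle_extremal G ->
  wiener_bound <= 6 * Wiener G + 6 * wiener_defect.
Proof.
move=> Gc [k3 iso]; rewrite (isomorphic_Wiener Gc (isomorphic_connected Gc iso) iso).
have := Wiener_G3_ge (isomorphic_connected Gc iso).
rewrite /wiener_bound /wiener_defect k3 /tree_bound.
move: (Wiener _) => W {iso}.
have [p mE] : exists p, m = p.+2 by exists (m - 2); lia.
have tE : t = (2 * p).+3 by rewrite /t mE; lia.
have -> : 2 * m - 3 = (2 * p).+1 by rewrite mE; lia.
have -> : n - 2 * m = k.-1 by rewrite /k tE mE; lia.
have -> : n = (2 * p).+3 + k by rewrite /k tE; move: mn; rewrite mE; lia.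
rewrite tE !cube_pred.
have : 0 < k by rewrite /k tE; move: mn; rewrite mE; lia.
by move: k k3; clear; case=> [|[|[|[|]]]] //= _ _; nia.
Qed.

Lemma square_attains G : connected G -> square_extremal G ->
  wiener_bound <= 6 * Wiener G + 6 * wiener_defect.
Proof.
move=> Gc [k3 iso]; rewrite (isomorphic_Wiener Gc (isomorphic_connected Gc iso) iso).
have := Wiener_G4_ge (isomorphic_connected Gc iso).
rewrite /wiener_bound /wiener_defect /tree_bound.
move: (Wiener _) => W {iso}.
have [p mE] : exists p, m = p.+2 by exists (m - 2); lia.
have tE : t = (2 * p).+3 by rewrite /t mE; lia.
have -> : 2 * m - 4 = (2 * p) by rewrite mE; lia.
have -> : n = (2 * p).+3 + k by rewrite /k tE; move: mn; rewrite mE; lia.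
rewrite tE !cube_pred.
have /orP : (3 < k) || (p == 0) && ((k == 1) || (k == 3)) by move: k3; rewrite mE; lia.
case=> [k4|/andP[/eqP-> /orP[]/eqP->]] /=; [|lia|lia].
have [b [o kE ob]] : exists b, exists2 o, k = b.+1.*2 + o & (o == 0) || (o == 1).
  by exists (k./2).-1, (odd k) => //; lia.
have k2 : k./2 = b.+1 by move: ob; rewrite kE; lia.
rewrite [k <= 3]leqNgt k4 /= k2.
have -> : k - b.+1 = b.+1 + o by rewrite kE; lia.
have -> : k.-1 - b.+1 = b + o by rewrite kE; lia.
have bo : 0 < b by move: k4 ob; rewrite kE; lia.
case/orP: ob bo => /eqP->; rewrite ?addn0 ?addn1 /=; clear; case: b => // b _ /=; nia.
Qed.

Lemma Wiener_extremal G : in_U n m G ->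
  6 * Wiener G + 6 * wiener_defect <= wiener_bound /\
  (6 * Wiener G + 6 * wiener_defect = wiener_bound <->
   triangle_extremal G \/ square_extremal G).
Proof.
move=> GU; have [le eq] := Wiener_le_bound GU; split=> //; split=> // ext.
apply/eqP; rewrite eqn_leq le /=; have [_ [Gc _] _] := GU.
by case: ext; [apply: triangle_attains | apply: square_attains].
Qed.

End Extremal.

(** * The closed forms over the rationals *)

Import Order.TTheory GRing.Theory Num.Theory.
Local Open Scope ring_scope.

Lemma scaled_bound (W D T : nat) (B : rat) : 6 * B + 6 * D%:R = T%:R ->
  (W%:R <= B) = (6 * W + 6 * D <= T)%N /\ (W%:R = B <-> (6 * W + 6 * D = T)%N).
Proof.
move=> BE; split.
  by rewrite -(ler_nat rat) natrD !natrM -BE; apply/idP/idP; lra.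
split=> [WB|/(congr1 (GRing.natmul (1 : rat)))].
  by apply/eqP; rewrite -(eqr_nat rat) natrD !natrM -BE -WB.
by rewrite natrD !natrM -BE => H; lra.
Qed.

Lemma bound_few_pendants (n m : nat) : (1 < m)%N -> (2 * m <= n)%N -> (n <= 2 * m + 2)%N ->
  let N : rat := n%:R in let M : rat := m%:R in
  6 * (2 - 8 / 3 * M ^+ 3 + 2 * M ^+ 2 + 5 / 3 * M
       + 2 * M ^+ 2 * N - 3 * M * N - 2 * N + N ^+ 2)
  + 6 * (wiener_defect n m)%:R = (wiener_bound n m)%:R.
Proof.
move=> m1 mn nm N M; rewrite /N /M {N M} /wiener_defect /wiener_bound /tree_bound.
have [p mE] : exists p, m = p.+2 by exists (m - 2)%N; lia.
have tE : (2 * m).-1 = (2 * p).+3 by rewrite mE; lia.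
have [k nE] : exists k, n = ((2 * p).+3 + k)%N by exists (n - (2 * p).+3)%N; lia.
rewrite tE nE addKn mE cube_pred.
have k0 : (0 < k)%N by lia.
have k3 : (k <= 3)%N by lia.
rewrite k3; case: k k0 k3 {nE} => [|[|[|[|k]]]] //= _ _.
- have -> : ((2 * p).+3 + 1 - 2 = 2 * p + 2)%N by lia.
  by rewrite subn0; field.
- have -> : ((2 * p).+3 + 2 - 2 = 2 * p + 3)%N by lia.
  by rewrite subn1 /=; field.
- have -> : ((2 * p).+3 + 3 - 2 = 2 * p + 4)%N by lia.
  by have -> : (3 - 1 = 2)%N by []; field.
Qed.

Lemma bound_odd (n m : nat) : (1 < m)%N -> (2 * m + 3 <= n)%N -> odd n ->
  let N : rat := n%:R in let M : rat := m%:R in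
  6 * (9 / 2 - N - 2 / 3 * M ^+ 3 + 1 / 2 * N ^+ 2 - 2 * N * M + 2 * M ^+ 2
       + 1 / 2 * M * N ^+ 2 - 11 / 6 * M)
  + 6 * (wiener_defect n m)%:R = (wiener_bound n m)%:R.
Proof.
move=> m1 mn no N M; rewrite /N /M {N M} /wiener_defect /wiener_bound /tree_bound.
have [p mE] : exists p, m = p.+2 by exists (m - 2)%N; lia.
have tE : (2 * m).-1 = (2 * p).+3 by rewrite mE; lia.
(* [n] and [(2 * m).-1] are both odd, so their difference is even, and it is at least 4. *)
have [c nE] : exists c, n = ((2 * p).+3 + c.+2.*2)%N.
  by exists ((n - (2 * p).+3)./2 - 2)%N; move: no; rewrite mE in mn; lia.
rewrite tE nE addKn mE cube_pred doubleK -addnn addnK [(_ + _ <= 3)%N]leqNgt.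
have -> : (3 < c.+2 + c.+2)%N by lia.
have -> : ((2 * p).+3 - 2 = (2 * p).+1)%N by lia.
by rewrite addnS /=; field.
Qed.

Lemma bound_even (n m : nat) : (1 < m)%N -> (2 * m + 4 <= n)%N -> ~~ odd n ->
  let N : rat := n%:R in let M : rat := m%:R in
  6 * (6 - N - 2 / 3 * M ^+ 3 + 1 / 2 * N ^+ 2 - 2 * N * M + 2 * M ^+ 2
       + 1 / 2 * M * N ^+ 2 - 7 / 3 * M)
  + 6 * (wiener_defect n m)%:R = (wiener_bound n m)%:R.
Proof.
move=> m1 mn no N M; rewrite /N /M {N M} /wiener_defect /wiener_bound /tree_bound.
have [p mE] : exists p, m = p.+2 by exists (m - 2)%N; lia.
have tE : (2 * m).-1 = (2 * p).+3 by rewrite mE; lia.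
(* Here the difference is odd and at least 5, so one end of the dumbbell has one pendant vertex
   more. *)
have [c nE] : exists c, n = ((2 * p).+3 + c.+2.*2.+1)%N.
  by exists ((n - (2 * p).+3)./2 - 2)%N; move: no; rewrite mE in mn; lia.
rewrite tE nE addKn mE cube_pred.
have -> : c.+2.*2.+1./2 = c.+2 by lia.
have -> : (c.+2.*2.+1 - c.+2 = c.+3)%N by lia.
have -> : (c.+2.*2.+1 <= 3)%N = false by lia.
have -> : ((2 * p).+3 - 2 = (2 * p).+1)%N by lia.
by rewrite addnS /= -addnn; field.
Qed.

Theorem theorem7p1 (n m : nat) (G : sgraph)
    (hm : (2 <= m <= n./2)%N) (hG : in_U n m G) :
  let N : rat := n%:R in
  let M : rat := m%:R in
  let W : rat := (Wiener G)%:R in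
  [/\ (n <= 2 * m + 2)%N ->
        let B : rat := 2 - 8 / 3 * M ^+ 3 + 2 * M ^+ 2 + 5 / 3 * M
                       + 2 * M ^+ 2 * N - 3 * M * N - 2 * N + N ^+ 2 in
        W <= B /\
        (W = B <->
          if (n == 4%N) && (m == 2%N) then
            isomorphic G (G4 0 0 0) \/ isomorphic G (G3 0 1)
          else if (n == 6%N) && (m == 2%N) then
            isomorphic G (G4 1 1 0) \/ isomorphic G (G3 2 1)
          else isomorphic G (G3 (n - 2 * m) (2 * m - 3))),
      (2 * m + 3 <= n)%N -> odd n ->
        let B : rat := 9 / 2 - N - 2 / 3 * M ^+ 3 + 1 / 2 * N ^+ 2
                       - 2 * N * M + 2 * M ^+ 2 + 1 / 2 * M * N ^+ 2
                       - 11 / 6 * M in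
        W <= B /\
        (W = B <-> isomorphic G (G4 (n.+1./2 - m) (n.-1./2 - m) (2 * m - 4)))
    & (2 * m + 4 <= n)%N -> ~~ odd n ->
        let B : rat := 6 - N - 2 / 3 * M ^+ 3 + 1 / 2 * N ^+ 2
                       - 2 * N * M + 2 * M ^+ 2 + 1 / 2 * M * N ^+ 2
                       - 7 / 3 * M in
        W <= B /\
        (W = B <-> isomorphic G (G4 (n./2 - m) (n./2 - m) (2 * m - 4)))].

Proof.
have [Gn [Gc _] _] := hG.
have m1 : (1 < m)%N by case/andP: hm.
have mn : (2 * m <= n)%N by case/andP: hm; lia.
have [le eq] := Wiener_extremal m1 mn hG.
move=> N M W; split=> [nm|nm no|nm no] B.
- have [-> WB] := scaled_bound (Wiener G) (bound_few_pendants m1 mn nm); split=> //.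
  apply: iff_trans WB (iff_trans eq _); rewrite /triangle_extremal /square_extremal.
  have k3 : (n - (2 * m).-1 <= 3)%N by lia.
  rewrite k3 ltnNge k3; split.
  + case=> [[_ iso]|[[//|[m2 k13]] iso]].
      case: ifP => [/andP[/eqP n4 /eqP m2]|_]; first by right; rewrite n4 m2 in iso.
      by case: ifP => [/andP[/eqP n4 /eqP m2]|_] //; right; rewrite n4 m2 in iso.
    (* With at most three vertices outside the core a square is extremal only for [m = 2], where it
       ties with the triangle. *)
    have [n4|n6] : n = 4%N \/ n = 6%N by lia.
      by rewrite n4 m2 /=; left; rewrite n4 m2 in iso.
    by rewrite n6 m2 /=; left; rewrite n6 m2 in iso.
  + case: ifP => [/andP[/eqP n4 /eqP m2]|_].
      by rewrite n4 m2 => -[iso|iso]; [right|left]; split=> //; right; split=> //; left.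
    case: ifP => [/andP[/eqP n4 /eqP m2]|_]; last by left.
    by rewrite n4 m2 => -[iso|iso]; [right|left]; split=> //; right; split=> //; right.
- have [-> WB] := scaled_bound (Wiener G) (bound_odd m1 nm no); split=> //.
  apply: iff_trans WB (iff_trans eq _); rewrite /triangle_extremal /square_extremal.
  have k3 : (3 < n - (2 * m).-1)%N by lia.
  have -> : ((n - (2 * m).-1)./2 = n.+1./2 - m)%N by move: no; lia.
  have -> : ((n - (2 * m).-1).-1 - (n.+1./2 - m) = n.-1./2 - m)%N by move: no; lia.
  rewrite leqNgt k3; split=> [[[]|[]]|] //; by right; split=> //; left.
- have [-> WB] := scaled_bound (Wiener G) (bound_even m1 nm no); split=> //.
  apply: iff_trans WB (iff_trans eq _); rewrite /triangle_extremal /square_extremal.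
  have k3 : (3 < n - (2 * m).-1)%N by lia.
  have -> : ((n - (2 * m).-1)./2 = n./2 - m)%N by move: no; lia.
  have -> : ((n - (2 * m).-1).-1 - (n./2 - m) = n./2 - m)%N by move: no; lia.
  rewrite leqNgt k3; split=> [[[]|[]]|] //; by right; split=> //; left.
Qed.
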